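(* Let $s\in(0,1)$ and let $K$ satisfy $K(h)=|h|^{-n-2s}K(h/|h|)$, $\lambda\le K(h/|h|)=K(-h/|h|)\le\Lambda$ for all $h\neq0$, with $0<\lambda\le\Lambda<\infty$. Assume that $K\in C^{5+2\alpha}(\mathbb{S}^{n-1})$ for some $\alpha\in(0,s)$. Let $v\in C^\gamma(\mathbb{R}^n)$ for some $\gamma\in(\max\{0,2s-1\},s+1)$ be such that $|v(x)|\le C(1+|x|^\gamma)$. Then, for every $\eta\in C_c^\infty(\mathbb{R}^n)$, $$\int_{\mathbb{R}^n}\int_{\mathbb{R}^n}(v(x)-v(y))(\eta(x)-\eta(y))(x_n)_+^{s-1}(y_n)_+^{s-1}K(x-y)\,dy\,dx$$ $$=\int_{\{x_n>0\}}v\,(x_n)_+^{s-1}L\big((x_n)_+^{s-1}\eta\big)\,dx-\int_{\{x_n=0\}}(\theta_K\cdot\nabla\eta)\,v\,dx' .$$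
   Context: Convention: $(x_n)_+^{s-1}=x_n^{s-1}$ if $x_n>0$ and $0$ otherwise. Points are written $x=(x',x_n)\in\mathbb{R}^{n-1}\times\mathbb{R}$. $Lu(x)=2\,\mathrm{p.v.}\int_{\mathbb{R}^n}(u(x)-u(y))K(x-y)\,dy$. The vector $\theta_K$ is $$\theta_K=2c_s\int_{\mathbb{R}^{n-1}}(h',1)\,K((h',1))\,dh'\in\mathbb{R}^n,\qquad c_s=\int_0^1r^{s-1}\int_1^\infty t^{s-1}|r-t|^{-2s}\,dt\,dr<\infty .$$ For $\gamma>0$ write $\gamma=m+\beta$ with $m\in\mathbb{N}\cup\{0\}$, $\beta\in(0,1]$; $C^\gamma=C^{m,\beta}$. *)

(* Defs.v *)
From HB Require Import structures.
From mathcomp Require Import all_boot all_order all_algebra.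
From mathcomp Require Import all_classical all_reals all_analysis.

Set Implicit Arguments.
Unset Strict Implicit.
Unset Printing Implicit Defensive.

Import Order.TTheory GRing.Theory Num.Theory.
Import numFieldNormedType.Exports.

Local Open Scope classical_set_scope.
Local Open Scope ring_scope.

(* R^n is the type 'rV[R]_n.  Its library topology is that of the max norm;
   [enorm] is the Euclidean norm. *)
Definition enorm (R : realType) (n : nat) (x : 'rV[R]_n) : R :=
  Num.sqrt (\sum_i x 0 i ^+ 2).

(* [rsnoc x' a] is the point (x', a) of R^(n+1) = R^n x R, and [xlast x] is the
   last coordinate of x. *)
Definition rsnoc (R : realType) (n : nat) (x' : 'rV[R]_n) (a : R) : 'rV[R]_n.+1 :=
  \row_i (if unlift ord_max i is Some j then x' 0 j else a).

Definition xlast (R : realType) (n : nat) (x : 'rV[R]_n.+1) : R := x 0 ord_max.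

(* Borel sigma-algebra of R^n, generated by the coordinate functions. *)
Section measurable_rV.
Context (R : realType) (n : nat).

Definition rV_measurable : set (set 'rV[R]_n) :=
  g_sigma_preimage (fun i (x : 'rV[R]_n) => x 0 i : measurableTypeR R).

Let rV_set0 : rV_measurable set0.
Proof. exact: sigma_algebra0. Qed.

Let rV_setC A : rV_measurable A -> rV_measurable (~` A).
Proof. exact: sigma_algebraC. Qed.

Let rV_bigcup (F : (set 'rV[R]_n)^nat) : (forall i, rV_measurable (F i)) ->
  rV_measurable (\bigcup_i F i).
Proof. exact: sigma_algebra_bigcup. Qed.

HB.instance Definition _ := @isMeasurable.Build default_measure_display
  'rV[R]_n rV_measurable rV_set0 rV_setC rV_bigcup.

End measurable_rV.

(* Lebesgue measure on R^n: the point mass for n = 0, and the product measure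
   transported by (x', a) |-> rsnoc x' a from R^n x R to R^(n+1). *)
Fixpoint leb (R : realType) (n : nat) : set 'rV[R]_n -> \bar R :=
  match n return set 'rV[R]_n -> \bar R with
  | 0%N => dirac (0 : 'rV[R]_0)
  | n'.+1 => pushforward (@leb R n' \x lebesgue_measure)%E
               (fun p : 'rV[R]_n' * measurableTypeR R => rsnoc p.1 p.2)
  end.
Arguments leb {R} n.

Section leb_sigma_finite.
Context (R : realType).

Lemma measurable_coord n (i : 'I_n) :
  measurable_fun [set: 'rV[R]_n] (fun x : 'rV[R]_n => x 0 i : measurableTypeR R).
Proof.
move=> _ Y mY; rewrite setTI; apply: sub_sigma_algebra => /=.
rewrite -bigcup_seq/=; exists i => /=; first by rewrite mem_index_enum.
by exists Y => //; rewrite setTI.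
Qed.

Lemma measurable_fun_rVP d (T : measurableType d) n (f : T -> 'rV[R]_n) :
  (forall i, measurable_fun [set: T] (fun t => f t 0 i : measurableTypeR R)) ->
  measurable_fun [set: T] f.
Proof.
move=> mf.
suff H : preimage_set_system [set: T] f (rV_measurable (R := R) (n := n)) `<=` measurable.
  by move=> _ A mA; apply: H; exists A.
rewrite -g_sigma_preimage_comp.
apply: smallest_sub; first exact: sigma_algebra_measurable.
case: n => [|n] in f mf *; first by rewrite big_ord0.
rewrite -bigcup_mkord_ord; apply: bigcup_sub => i Ii.
by move=> A [B mB <-]; exact: mf.
Qed.

Lemma measurable_rsnoc n : measurable_fun [set: 'rV[R]_n * measurableTypeR R]
  (fun p : 'rV[R]_n * measurableTypeR R => rsnoc p.1 p.2).
Proof.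
apply: measurable_fun_rVP => i.
case: (unliftP ord_max i) => [j ->|->].
  rewrite (_ : (fun _ => _) = (fun x : 'rV[R]_n => x 0 j : measurableTypeR R) \o fst).
    exact: measurableT_comp (measurable_coord j) measurable_fst.
  by apply/funext => p /=; rewrite mxE liftK.
rewrite (_ : (fun _ => _) = snd); first exact: measurable_snd.
by apply/funext => p /=; rewrite mxE unlift_none.
Qed.

Lemma product_measure1_sigma_finite d1 d2 (T1 : measurableType d1)
    (T2 : measurableType d2) (m1 : {sigma_finite_measure set T1 -> \bar R})
    (m2 : {sigma_finite_measure set T2 -> \bar R}) :
  sigma_finite setT (m1 \x m2)%E.
Proof.
have /sigma_finiteP[F [TF ndF Foo]] := sigma_finiteT m1.
have /sigma_finiteP[G [TG ndG Goo]] := sigma_finiteT m2.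
exists (fun n => F n `*` G n).
  rewrite -setXTT TF TG predeqE => -[x y]; split.
    move=> [/= [n _ Fnx] [k _ Gky]]; exists (maxn n k) => //; split.
    - by move: x Fnx; exact/subsetPset/ndF/leq_maxl.
    - by move: y Gky; exact/subsetPset/ndG/leq_maxr.
  by move=> [n _ []/= ? ?]; split; exists n.
move=> k; have [? ?] := Foo k; have [? ?] := Goo k.
split; first exact: measurableX.
by rewrite product_measure1E// lte_mul_pinfty// ge0_fin_numE.
Qed.

Lemma leb_sigma_finite_measure n :
  exists mu : {sigma_finite_measure set 'rV[R]_n -> \bar R}, leb n = mu.
Proof.
elim: n => [|n [mu lebE]]; first by exists (dirac (0 : 'rV[R]_0)).
pose f := fun p : 'rV[R]_n * measurableTypeR R => rsnoc p.1 p.2.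
pose g := fun x : 'rV[R]_n.+1 =>
  ((\row_j x 0 (lift ord_max j) : 'rV[R]_n), x 0 ord_max : measurableTypeR R).
have fK : cancel f g.
  move=> [x a]; rewrite /f/g/=; congr (_, _); last by rewrite mxE unlift_none.
  by apply/rowP => j; rewrite !mxE liftK.
have mg : measurable_fun setT g.
  apply/measurable_fun_pairP; split.
    apply: measurable_fun_rVP => i.
    rewrite (_ : (fun _ => _) = (fun x : 'rV[R]_n.+1 => x 0 (lift ord_max i) : measurableTypeR R)).
      exact: measurable_coord.
    by apply/funext => x /=; rewrite mxE.
  exact: measurable_coord.
pose P : {measure set ('rV[R]_n * measurableTypeR R)%type -> \bar R} :=
  (mu \x @lebesgue_measure R)%E.
pose m : {measure set 'rV[R]_n.+1 -> \bar R} :=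
  measure_function_pushforward__canonical__measure_function_Measure
  P (measurable_rsnoc (n := n)).
have sm : sigma_finite setT m.
  have [F TF Foo] := product_measure1_sigma_finite mu lebesgue_measure.
  exists (fun k => g @^-1` F k).
    by rewrite -preimage_bigcup -TF preimage_setT.
  move=> k; have [mF Fk] := Foo k; split.
    by rewrite -[X in measurable X]setTI; exact: mg.
  rewrite /m/= /pushforward -comp_preimage.
  by rewrite (_ : g \o _ = id) //; apply/funext => p; exact: fK.
pose b := Measure_isSigmaFinite.Build _ _ _ m sm.
pose m' : {sigma_finite_measure set 'rV[R]_n.+1 -> \bar R} := HB.pack (m : set _ -> _) (Measure.class m) b.
by exists m'; rewrite /= lebE.
Qed.

Section instances.
Context (n : nat).

Let leb0 : leb (R := R) n set0 = 0%E.
Proof. by have [mu ->] := leb_sigma_finite_measure n; exact: measure0. Qed.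

Let leb_ge0 (A : set 'rV[R]_n) : (0 <= leb n A)%E.
Proof. by have [mu ->] := leb_sigma_finite_measure n; exact: measure_ge0. Qed.

Let leb_sigma_additive : semi_sigma_additive (leb (R := R) n).
Proof.
by have [mu ->] := leb_sigma_finite_measure n; exact: measure_semi_sigma_additive.
Qed.

HB.instance Definition _ :=
  isMeasure.Build _ _ _ (leb (R := R) n) leb0 leb_ge0 leb_sigma_additive.

Let leb_sigma_finite : sigma_finite setT (leb (R := R) n).
Proof. by have [mu ->] := leb_sigma_finite_measure n; exact: sigma_finiteT. Qed.

HB.instance Definition _ :=
  Measure_isSigmaFinite.Build _ _ _ (leb (R := R) n) leb_sigma_finite.

End instances.
End leb_sigma_finite.

Section Holder_classes.
Context (R : realType) (n : nat).
Implicit Types (Omega : set 'rV[R]_n) (f : 'rV[R]_n -> R).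

(* Iterated partial derivatives; the list [l] is a multi-index. *)
Definition pderivs (l : seq 'I_n) f : 'rV[R]_n -> R :=
  foldr (fun i (g : 'rV[R]_n -> R) => 'D_(delta_mx 0 i) g) f l.

(* f is of class C^k on the open set Omega. *)
Definition is_Ck (k : nat) Omega f : Prop :=
  forall l : seq 'I_n, (size l <= k)%N -> forall x, Omega x ->
    {for x, continuous (pderivs l f)} /\
    ((size l < k)%N -> forall i, derivable (pderivs l f) x (delta_mx 0 i)).

(* Hoelder continuity of exponent beta, uniform on compact subsets of Omega. *)
Definition loc_holder (beta : R) Omega f : Prop :=
  forall A : set 'rV[R]_n, compact A -> A `<=` Omega ->
    exists C : R, forall x y, A x -> A y ->
      `|f x - f y| <= C * enorm (x - y) `^ beta.

(* C^gamma(Omega) = C^(m,beta)(Omega), where gamma = m + beta and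
   0 < beta <= 1 (so m and beta are determined by gamma); the Hoelder condition
   is local in the open set Omega and no bound at infinity is included. *)
Definition is_Cgamma (gamma : R) Omega f : Prop :=
  exists (m : nat) (beta : R), [/\ gamma = m%:R + beta, 0 < beta <= 1,
    is_Ck m Omega f &
    forall l : seq 'I_n, size l = m -> loc_holder beta Omega (pderivs l f)].

Definition is_Cc_smooth f : Prop :=
  (forall k, is_Ck k setT f) /\ compact (closure [set x | f x != 0]).

End Holder_classes.

(* The unit sphere of R^(n+1) is covered by the graphs
   x_i = +/- sqrt (1 - |y|^2), where y collects the other coordinates and
   |y| < 1; [sphere_chart i b] parametrizes the one of sign (-1)^b. *)
Definition sphere_chart (R : realType) (n : nat) (i : 'I_n.+1) (b : bool)
    (y : 'rV[R]_n) : 'rV[R]_n.+1 :=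
  \row_j (if unlift i j is Some k then y 0 k
          else (-1) ^+ b * Num.sqrt (1 - enorm y ^+ 2)).

(* f restricted to the unit sphere S^n of R^(n+1) is in C^gamma(S^n). *)
Definition is_Cgamma_sphere (R : realType) (n : nat) (gamma : R)
    (f : 'rV[R]_n.+1 -> R) : Prop :=
  forall (i : 'I_n.+1) (b : bool),
    is_Cgamma gamma [set y : 'rV[R]_n | enorm y < 1]
      (fun y => f (sphere_chart i b y)).

(* (t)_+^p *)
Definition pospow (R : realType) (t p : R) : R := if 0 < t then t `^ p else 0.

Section operator.
Context (R : realType) (n : nat) (K : 'rV[R]_n -> R) (u : 'rV[R]_n -> R).

Definition L_trunc (x : 'rV[R]_n) (eps : R) : R :=
  \int[leb n]_(y in [set y | eps < enorm (x - y)]) ((u x - u y) * K (x - y)).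

Definition Lop (x : 'rV[R]_n) : R := 2 * lim (L_trunc x eps @[eps --> 0^'+]).

(* [lim] is a total function; this says that the principal value in [Lop] at x
   is a genuine limit of absolutely convergent integrals. *)
Definition Lop_defined (x : 'rV[R]_n) : Prop :=
  (forall eps, 0 < eps -> (leb n).-integrable [set y | eps < enorm (x - y)]
     (fun y => ((u x - u y) * K (x - y))%:E)) /\
  cvg (L_trunc x eps @[eps --> 0^'+]).

End operator.

Definition c_s (R : realType) (s : R) : R :=
  \int[lebesgue_measure]_(r in `]0, 1[%classic)
    (r `^ (s - 1) * \int[lebesgue_measure]_(t in `]1, +oo[%classic)
      (t `^ (s - 1) * `|r - t| `^ (- (2 * s)))).

Definition theta (R : realType) (n : nat) (s : R) (K : 'rV[R]_n.+1 -> R) :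
    'rV[R]_n.+1 :=
  \row_i (2 * c_s s * \int[leb n]_h' (rsnoc h' 1 0 i * K (rsnoc h' 1))).

Definition gradient (R : realType) (n : nat) (f : 'rV[R]_n -> R)
    (x : 'rV[R]_n) : 'rV[R]_n := \row_i 'D_(delta_mx 0 i) f x.

Definition dot (R : realType) (n : nat) (a b : 'rV[R]_n) : R :=
  \sum_i a 0 i * b 0 i.

(* Main.v *)
Require Import Defs.
From mathcomp Require Import all_boot all_order all_algebra.
From mathcomp Require Import all_classical all_reals all_analysis.
From mathcomp Require Import measurable_realfun ring lra.

Import Order.TTheory GRing.Theory Num.Theory.
Import numFieldNormedType.Exports.

(** Write N = n + 1, w(x) = (x_N)_+^(s-1), and let
    R(x,y) = eta(x) - eta(y) - grad eta(x) . (x - y) be the first order Taylor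
    remainder of eta. The identity separates the regular part of the energy,
    carried by R, from a singular part, carried by the gradient of eta, which
    only sees the hyperplane x_N = 0.

    The weight is harmonic for the operator: on the line, the second difference
    2 a_+^(s-1) - (a-t)_+^(s-1) - (a+t)_+^(s-1) integrates to zero against
    |t|^(-1-2s), and the first difference (a-t)_+^(s-1) - (a+t)_+^(s-1)
    integrates to zero against t |t|^(-1-2s) (pospow_harmonic,
    pospow_antisym). The slices h_N = t of a homogeneous kernel are dilates of
    the slice h_N = 1, so both facts pass from the line to R^N
    (tensor_integral). In the principal value defining L(w eta)(x) they kill
    the zeroth and first order terms of the expansion of eta at x, and what
    remains is the absolutely convergent integral
    L(w eta)(x) = 2 int w(y) R(x,y) K(x-y) dy (Lop_remainder).

    Put Phi(x,y) = v(x) w(x) w(y) R(x,y) K(x-y) and F_i = v d_i eta. Expanding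
    eta(x) - eta(y) at x in the term with v(x) and at y in the term with v(y)
    gives the pointwise identity (energy_split): the energy density is
    Phi(x,y) + Phi(y,x) plus the sum over i of
    w(x) w(y) (F_i(x) - F_i(y)) (x_i - y_i) K(x-y). The first two terms
    integrate to 2 int int Phi, which is the integral of v w L(w eta).

    For a term of the last kind, put y = x - h and integrate first in the
    tangential variables, then over the slices of h. With
    f(a) = int F_i(x',a) dx', what is left is the mass of h_i K on the slice
    h_N = 1 times the integral on the line of
    a_+^(s-1) b_+^(s-1) (f(a) - f(b)) (a-b) |a-b|^(-1-2s). On b < a the
    substitution b = r a produces the Frullani integral of (f(a) - f(r a)) / a,
    equal to - f(0) int_1^(1/r) dt/t (frullani): this is where only the
    boundary value f(0) survives. Integrated over r in (0,1) against
    r^(s-1) (1-r)^(-2s) this is - c_s f(0), since a scaling in the double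
    integral defining c_s brings it to the same form (c_sE). Counting also
    a < b, the term contributes - theta_i f(0) (half_formE, grad_formE).

    All integrals converge absolutely once an exponent q is chosen with
    max(1, 2s, gamma) < q < min(1 + s, 1 + gamma) (exponent_exists): every
    integrand on R^N x R^N is dominated by a multiple of
    (1_B(x) + 1_B(y)) w(x) w(y) |x-y|^(q-N-2s) for a box B, and this is
    integrable (majorantN_integrable). The y-integral converges near y = x as
    q > 2s and at infinity as q < 1 + s; by scaling it is a multiple of
    x_N^(q-1-s), and q > 1 makes w(x) x_N^(q-1-s) integrable up to the
    boundary. *)

Local Open Scope classical_set_scope.
Local Open Scope ring_scope.

Set Implicit Arguments.
Unset Strict Implicit.

Local Arguments leb {R} n : simpl never.

(** * Affine changes of variables *)

Section lebesgue_affine.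
Context {R : realType}.
Local Notation lam := (@lebesgue_measure R).
Local Open Scope ereal_scope.

Lemma measurable_affine (c d : R) :
  measurable_fun [set: measurableTypeR R]
    (fun x : measurableTypeR R => c * x + d : measurableTypeR R)%R.
Proof.
apply: (measurable_funD)=> //; exact: measurable_funM.
Qed.

Lemma preimage_affine_itv (c d a b : R) : (c != 0)%R ->
  lam ((fun x => c * x + d)%R @^-1` `]a, b]) = (`|c|^-1)%:E * lam `]a, b].
Proof.
move=> c0; have [c_gt0|c_lt0] := ltP 0%R c.
  rewrite (_ : _ @^-1` _ = `](a - d) / c, (b - d) / c]%classic)%R; last first.
    apply/seteqP; split=> x; rewrite /= !in_itv/= => /andP[xa xb]; apply/andP; split.
    - by rewrite ltr_pdivrMr// mulrC ltrBlDr.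
    - by rewrite ler_pdivlMr// mulrC lerBrDr.
    - by rewrite -ltrBlDr mulrC -ltr_pdivrMr.
    - by rewrite -lerBrDr mulrC -ler_pdivlMr.
  rewrite !lebesgue_measure_itv/= !lte_fin ltr_pM2r ?invr_gt0// ltrD2r.
  case: ifP => _; last by rewrite mule0.
  by rewrite -!EFinD -EFinM gtr0_norm//; congr (_%:E); field.
have {c_lt0}c_lt0 : (c < 0)%R by rewrite lt_neqAle c0.
rewrite (_ : _ @^-1` _ = `[(b - d) / c, (a - d) / c[%classic)%R; last first.
  apply/seteqP; split=> x; rewrite /= !in_itv/= => /andP[xa xb]; apply/andP; split.
  - by rewrite ler_ndivrMr// mulrC lerBrDr.
  - by rewrite ltr_ndivlMr// mulrC ltrBlDr.
  - by rewrite -ltrBlDr mulrC -ltr_ndivlMr.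
  - by rewrite -lerBrDr mulrC -ler_ndivrMr.
rewrite !lebesgue_measure_itv/= !lte_fin ltr_nM2r ?invr_lt0// ltrD2r.
case: ifP => _; last by rewrite mule0.
by rewrite -!EFinD -EFinM ltr0_norm//; congr (_%:E); field.
Qed.

(** The dilated pull-back of Lebesgue measure agrees with Lebesgue measure on
    half-open intervals, hence everywhere by uniqueness of the extension. *)
Lemma lebesgue_measure_affine (c d : R) (A : set (measurableTypeR R)) :
  (c != 0)%R -> measurable A ->
  lam ((fun x => c * x + d)%R @^-1` A) = (`|c|^-1)%:E * lam A.
Proof.
move=> c0 mA.
have cpos : (0 <= `|c|)%R by [].
pose phi := (fun x : measurableTypeR R => c * x + d : measurableTypeR R)%R.
pose m := mscale (NngNum cpos)
  (measure_function_pushforward__canonical__measure_function_Measure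
    lam (measurable_affine c d)).
have h X : ocitv X -> lam X = m X.
  move=> [[a b]] _ <-; rewrite /m /mscale/= /pushforward preimage_affine_itv//.
  by rewrite muleA -EFinM mulfV ?normr_eq0// mul1e.
rewrite (lebesgue_measure_unique h mA) /m /mscale/= muleA -EFinM.
by rewrite mulVf ?normr_eq0// mul1e.
Qed.

Lemma ge0_integral_affine (c d : R) (f : measurableTypeR R -> \bar R) : (c != 0)%R ->
  measurable_fun setT f -> (forall x, 0 <= f x) ->
  \int[lam]_x f (c * x + d)%R = (`|c|^-1)%:E * \int[lam]_x f x.
Proof.
move=> c0 mf f0.
have cpos : (0 <= `|c|^-1)%R by rewrite invr_ge0.
rewrite -[LHS](@ge0_integral_pushforward _ _ _ _ _ _ (measurable_affine c d) lam setT f)//.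
rewrite (eq_measure_integral (mscale (NngNum cpos) lam)); last first.
  by move=> mphi A mA _; exact: (lebesgue_measure_affine d c0 mA).
  exact: measurable_affine.
by rewrite ge0_integral_mscale.
Qed.

End lebesgue_affine.

Section leb_basic.
Context {R : realType}.
Local Notation lam := (@lebesgue_measure R).
Local Open Scope ereal_scope.

Lemma measurable_rsnocl n (a : R) :
  measurable_fun setT (fun x' : 'rV[R]_n => rsnoc x' a).
Proof.
exact: (measurableT_comp (@measurable_rsnoc R n)
  (measurable_fun_pair (@measurable_id _ _ setT) (@measurable_cst _ _ _ _ setT (a : measurableTypeR R)))).
Qed.

Lemma ge0_leb_prod n (f : 'rV[R]_n.+1 -> \bar R) :
  measurable_fun setT f -> (forall x, 0 <= f x) ->
  \int[leb n.+1]_x f x = \int[leb n \x lam]_p f (rsnoc p.1 p.2).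
Proof.
move=> mf f0.
exact: (@ge0_integral_pushforward _ _ _ _ _ _ (@measurable_rsnoc R n)
  (leb n \x lam) setT f).
Qed.

Lemma ge0_lebSr n (f : 'rV[R]_n.+1 -> \bar R) :
  measurable_fun setT f -> (forall x, 0 <= f x) ->
  \int[leb n.+1]_x f x = \int[lam]_a \int[leb n]_x' f (rsnoc x' a).
Proof.
move=> mf f0; rewrite ge0_leb_prod//.
apply: (@fubini_tonelli2 _ _ _ _ _ (leb n) lam
  (fun p : 'rV[R]_n * measurableTypeR R => f (rsnoc p.1 p.2))) => //.
exact: measurableT_comp mf (@measurable_rsnoc R n).
Qed.

Lemma integrable_leb_prod n (f : 'rV[R]_n.+1 -> \bar R) :
  (leb n.+1).-integrable setT f ->
  (leb n \x lam).-integrable setT (fun p => f (rsnoc p.1 p.2)).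
Proof.
move=> /integrableP[mf foo]; apply/integrableP; split.
  exact: measurableT_comp mf (@measurable_rsnoc R n).
suff <- : \int[leb n.+1]_x `|f x| = \int[leb n \x lam]_p `|f (rsnoc p.1 p.2)| by [].
by apply: (@ge0_leb_prod n (abse \o f)) => [|x]; [exact: measurableT_comp|exact: abse_ge0].
Qed.

Lemma leb_prod n (f : 'rV[R]_n.+1 -> \bar R) :
  (leb n.+1).-integrable setT f ->
  \int[leb n.+1]_x f x = \int[leb n \x lam]_p f (rsnoc p.1 p.2).
Proof.
move=> fi; have mf := measurable_int _ fi.
exact: (@integral_pushforward _ _ _ _ _ _ (@measurable_rsnoc R n)
  (leb n \x lam) setT f mf (integrable_leb_prod fi) measurableT).
Qed.

Lemma lebSr n (f : 'rV[R]_n.+1 -> \bar R) :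
  (leb n.+1).-integrable setT f ->
  \int[leb n.+1]_x f x = \int[lam]_a \int[leb n]_x' f (rsnoc x' a).
Proof.
move=> fi; rewrite leb_prod//.
by rewrite -(integral21_prod_meas1 (integrable_leb_prod fi)).
Qed.

Lemma measurable_rV_affine n (c : R) (v : 'rV[R]_n) :
  measurable_fun setT (fun x : 'rV[R]_n => c *: x + v)%R.
Proof.
apply: measurable_fun_rVP => i.
rewrite (_ : (fun _ => _) = (fun x : 'rV[R]_n => c * x 0 i + v 0 i)%R); last first.
  by apply/funext => x; rewrite !mxE.
exact: measurableT_comp (measurable_affine c (v 0%R i)) (measurable_coord i).
Qed.

(** By induction on the dimension: an affine homothety acts separately on the
    last coordinate and on the other ones. *)
Lemma ge0_leb_affine n (c : R) (v : 'rV[R]_n) (f : 'rV[R]_n -> \bar R) :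
  (c != 0)%R -> measurable_fun setT f -> (forall x, 0 <= f x) ->
  \int[leb n]_x f (c *: x + v)%R = ((`|c| ^- n)%R)%:E * \int[leb n]_x f x.
Proof.
elim: n => [|n IHn] in v f * => c0 mf f0.
  rewrite expr0 invr1 mul1e; apply: eq_integral => x _.
  by congr f; apply/rowP => -[].
rewrite ge0_lebSr//; last first.
  exact: measurableT_comp mf (measurable_rV_affine c v).
pose v' : 'rV[R]_n := \row_j v 0%R (lift ord_max j).
have vE (x' : 'rV[R]_n) (a : R) :
    (c *: rsnoc x' a + v)%R = rsnoc (c *: x' + v')%R (c * a + v 0%R ord_max)%R.
  apply/rowP => i; rewrite !mxE; case: unliftP => [j ->|->] //.
  by rewrite !mxE.
transitivity (\int[lam]_a (((`|c| ^- n)%R)%:E *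
    \int[leb n]_x' f (rsnoc x' (c * a + v 0%R ord_max)%R))).
  apply: eq_integral => a _; rewrite -(IHn v' (fun x' => f (rsnoc x' (c * a + v 0%R ord_max)%R)))//.
    by apply: eq_integral => x' _; rewrite vE.
  exact: measurableT_comp mf (measurable_rsnocl _).
have mF : measurable_fun [set: measurableTypeR R]
    (fun a : measurableTypeR R => \int[leb n]_x' f (rsnoc x' a)).
  apply: (@measurable_fun_fubini_tonelli_G _ _ _ _ _ (leb n)
    (fun p : 'rV[R]_n * measurableTypeR R => f (rsnoc p.1 p.2))) => //.
  exact: measurableT_comp mf (@measurable_rsnoc R n).
rewrite ge0_integralZl_EFin; last 4 first.
- exact: measurableT.
- by move=> a _; exact: integral_ge0.
- exact: measurableT_comp mF (measurable_affine _ _).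
- by rewrite invr_ge0 exprn_ge0.
rewrite (@ge0_integral_affine R c (v 0%R ord_max)
  (fun a => \int[leb n]_x' f (rsnoc x' a)))//; last by move=> a; exact: integral_ge0.
by rewrite -ge0_lebSr// muleA -EFinM -invfM -exprSr.
Qed.

Lemma leb_affine n (c : R) (v : 'rV[R]_n) (f : 'rV[R]_n -> R) :
  (c != 0)%R -> (leb n).-integrable setT (EFin \o f) ->
  (leb n).-integrable setT (fun x => (f (c *: x + v)%R)%:E) /\
  \int[leb n]_x (f (c *: x + v)%R)%:E = ((`|c| ^- n)%R)%:E * \int[leb n]_x (f x)%:E.
Proof.
move=> c0 fi; have mf := measurable_int _ fi.
have maf := measurable_rV_affine c v.
have cge0 : (0 <= `|c| ^- n)%R by rewrite invr_ge0 exprn_ge0.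
have fi' : (leb n).-integrable setT (fun x => (f (c *: x + v)%R)%:E).
  apply/integrableP; split; first exact: measurableT_comp mf maf.
  rewrite (@ge0_leb_affine n c v (fun x => `|(f x)%:E|))//; last exact: measurableT_comp.
  rewrite lte_mul_pinfty//; by case/integrableP : fi.
split=> //; rewrite integralE [in RHS]integralE.
have mp : measurable_fun setT (EFin \o f)^\+ by exact: measurable_funepos.
have mn : measurable_fun setT (EFin \o f)^\- by exact: measurable_funeneg.
rewrite muleBr//; last first.
  apply: fin_num_adde_defr.
  exact: (integrable_pos_fin_num _ fi).
rewrite -(ge0_leb_affine v c0 mp (fun x => funepos_ge0 _ x)).
rewrite -(ge0_leb_affine v c0 mn (fun x => funeneg_ge0 _ x)).
by congr (_ - _); apply: eq_integral => x _; rewrite ?funeposE ?funenegE.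
Qed.

End leb_basic.

(** * Borel sets, and integrals of powers on the line *)

Section rV_topology.
Context {R : realType}.

Lemma rV_ballP n (x y : 'rV[R]_n) (e : R) : 0 < e ->
  ball x e y <-> forall i, `|x 0 i - y 0 i| < e.
Proof.
move=> e0; split; first by move=> [_ h] i; exact: h.
by move=> h; split=> // i j; rewrite (ord1 i); exact: h.
Qed.

(** An open set is a countable union of boxes with rational centre and radius
    [1/k], and boxes belong to the sigma-algebra of the coordinates. *)
Lemma open_measurable_rV n (U : set 'rV[R]_n) : open U -> measurable U.
Proof.
move=> oU.
pose B (q : 'rV[rat]_n * nat) : set 'rV[R]_n :=
  [set x | forall i, `|ratr (q.1 0 i) - x 0 i| < q.2.+1%:R^-1].
have mB q : measurable (B q).
  rewrite (_ : B q = \bigcap_(i in [set: 'I_n])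
      ((fun x : 'rV[R]_n => x 0 i : measurableTypeR R) @^-1`
        ball (ratr (q.1 0 i) : R) q.2.+1%:R^-1)); last first.
    apply/seteqP; split=> x /= h i; first by move=> _; exact: h.
    exact: h.
  apply: fin_bigcap_measurable; first exact: finite_finset.
  move=> i _; rewrite -[X in measurable X]setTI.
  by apply: measurable_coord => //; exact: measurable_ball.
rewrite (_ : U = \bigcup_(q in [set q | B q `<=` U]) B q); last first.
  apply/seteqP; split; last by move=> x [q /= BU /BU].
  move=> x Ux; have /nbhs_ballP[e /= e0 xeU] := open_nbhs_nbhs (conj oU Ux).
  have [k ke] : exists k : nat, k.+1%:R^-1 < e / 2.
    have : 0 < e / 2 by rewrite divr_gt0.
    move=> e2; have [k _ /(_ k (leqnn k)) /= ?] := near_infty_natSinv_lt (PosNum e2).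
    by exists k.
  have kpos : 0 < k.+1%:R^-1 :> R by rewrite invr_gt0.
  have /choice[r hr] : forall i : 'I_n, exists r : rat, `|ratr r - x 0 i| < k.+1%:R^-1.
    move=> i; have /rat_in_itvoo[r] : x 0 i - k.+1%:R^-1 < x 0 i + k.+1%:R^-1.
      by rewrite ltrD2l gtrN.
    rewrite in_itv/= => /andP[h1 h2]; exists r.
    by rewrite ltr_distl h1 h2.
  exists (\row_i r i, k); last by move=> i /=; rewrite mxE.
  move=> y /= h; apply: xeU; apply/rV_ballP => // i.
  have := h i; rewrite mxE => {}h; have := hr i.
  rewrite distrC => h2.
  rewrite (_ : x 0 i - y 0 i = (x 0 i - ratr (r i)) + (ratr (r i) - y 0 i)); last by ring.
  apply: le_lt_trans (ler_normD _ _) _.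
  by rewrite (splitr e) ltrD// (lt_trans _ ke).
rewrite (_ : \bigcup_(q in _) _ = \bigcup_k
    (if unpickle k is Some q then if `[< B q `<=` U >] then B q else set0 else set0)).
  apply: bigcupT_measurable => k; case: unpickle => [q|]; last exact: measurable0.
  by case: ifPn => // _; exact: measurable0.
apply/seteqP; split=> [x [q /= BU Bx]|x [k _]].
  by exists (pickle q) => //; rewrite pickleK; case: asboolP.
by case: unpickle => // q; case: asboolP => // BU Bx; exists q.
Qed.

Lemma continuous_measurable_rV n (f : 'rV[R]_n -> R) (N : set 'rV[R]_n) :
  open N -> (forall x, N x -> {for x, continuous f}) -> measurable_fun N f.
Proof.
move=> oN cf mN; apply: (measurability _ (RGenOpens.measurableE R)) => //.
move=> _ [_ [a [b ->] <-]]; apply: open_measurable_rV.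
rewrite openE => x [Nx fx]; apply: filterI; first exact: open_nbhs_nbhs.
by apply: cf => //; apply: open_nbhs_nbhs; split => //; exact: interval_open.
Qed.

Lemma continuousT_measurable_rV n (f : 'rV[R]_n -> R) :
  continuous f -> measurable_fun setT f.
Proof.
by move=> cf; apply: continuous_measurable_rV => [|x _]; [exact: openT|exact: cf].
Qed.

Lemma measurable_rV_set1 n (x : 'rV[R]_n) : measurable [set x].
Proof.
rewrite (_ : [set x] = ~` (~` [set x])); last by rewrite setCK.
apply: measurableC; apply: open_measurable_rV; apply: closed_openC.
exact: accessible_closed_set1 (hausdorff_accessible (@norm_hausdorff _ _)) x.
Qed.

(** Kernels are continuous off the origin only, and a point is measurable. *)
Lemma continuous0_measurable_rV n (f : 'rV[R]_n -> R) :
  (forall x, x != 0 -> {for x, continuous f}) -> measurable_fun setT f.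
Proof.
move=> cf; rewrite -(setUv [set (0 : 'rV[R]_n)]) setUC.
apply/measurable_funU.
- by apply: measurableC; exact: measurable_rV_set1.
- exact: measurable_rV_set1.
split; last exact: measurable_fun_set1.
apply: continuous_measurable_rV => [|x /= /eqP]; last exact: cf.
apply: closed_openC.
exact: accessible_closed_set1 (hausdorff_accessible (@norm_hausdorff _ _)) 0.
Qed.

End rV_topology.

Section integrals_on_the_line.
Context {R : realType}.
Local Notation lam := (@lebesgue_measure R).
Local Open Scope ereal_scope.

(** Monotone convergence along compact intervals that exhaust an open one:
    this is how integrands singular at both ends are reached. *)
Lemma ge0_exhaust_oo (f : R -> R) (a b : R) (u : R ^nat) (v : R ^nat) (M : \bar R) :
  measurable_fun `]a, b[ f -> (forall x, a < x < b -> 0 <= f x)%R ->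
  (forall k, a < u k)%R -> (forall k, v k < b)%R ->
  {homo u : i j / (i <= j)%N >-> (j <= i)%R} ->
  {homo v : i j / (i <= j)%N >-> (i <= j)%R} ->
  (forall x, (a < x < b)%R -> exists k, (u k <= x <= v k)%R) ->
  \int[lam]_(x in `[u k, v k]) (f x)%:E @[k --> \oo] --> M ->
  \int[lam]_(x in `]a, b[) (f x)%:E = M.
Proof.
move=> mf f0 au vb du dv ex cv.
have sub k : `[u k, v k] `<=` `]a, b[.
  move=> x /=; rewrite !in_itv/= => /andP[ux xv].
  by rewrite (lt_le_trans (au k) ux) (le_lt_trans xv (vb k)).
have := @ge0_nondecreasing_set_cvg_integral _ (measurableTypeR R) R
  (fun k => `[u k, v k]%classic) (EFin \o f) lam.
rewrite (_ : \bigcup_i _ = `]a, b[%classic); last first.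
  apply/seteqP; split=> [x [k _ /sub//]|x /=].
  by rewrite in_itv/= => /ex[k kx]; exists k; rewrite //= in_itv.
move=> h; apply/esym; apply: cvg_unique cv (h _ _ _ _) => //.
- move=> i j ij; rewrite subsetEset => x /=; rewrite !in_itv/= => /andP[ux xv].
  by rewrite (le_trans (du _ _ ij) ux) (le_trans xv (dv _ _ ij)).
- move=> i; apply/measurable_EFinP; apply: measurable_funS mf => //; exact: sub.
- by move=> i x /sub /=; rewrite in_itv/= lee_fin; exact: f0.
Qed.

Lemma powR_continuous_gt0 (p x : R) : (0 < x)%R -> {for x, continuous (@powR R ^~ p)}.
Proof.
move=> x0; apply: differentiable_continuous; apply/derivable1_diffP.
by apply: derivable_powR; rewrite in_itv/= x0.
Qed.

(** Only one-sided limits of the primitive are required, so that [f] may blow up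
    at [a] and at [b]. *)
Lemma ge0_FTC_oo (f F : R -> R) (a b la lb : R) : (a < b)%R ->
  (forall x, a < x < b -> 0 <= f x)%R ->
  (forall x, (a < x < b)%R -> {for x, continuous f}) ->
  (forall x, (a < x < b)%R -> is_derive x (1%R : R) F (f x)) ->
  F x @[x --> a^'+] --> la -> F x @[x --> b^'-] --> lb ->
  \int[lam]_(x in `]a, b[) (f x)%:E = (lb - la)%:E.
Proof.
move=> ab f0 cf dF Fa Fb.
pose d k : R := ((b - a) / k.+3%:R)%R.
have ba : (0 < b - a)%R by rewrite subr_gt0.
have d0 k : (0 < d k)%R by rewrite divr_gt0.
have d3 k : (d k <= (b - a) / 3)%R.
  by rewrite ler_pM2l// lef_pV2 ?posrE// ler_nat.
have dd i j : (i <= j)%N -> (d j <= d i)%R.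
  by move=> ij; rewrite ler_pM2l// lef_pV2 ?posrE// ler_nat !ltnS.
have dcv : d k @[k --> \oo] --> (0 : R)%R.
  rewrite -[X in _ --> X](mulr0 (b - a))%R; apply: cvgMr.
  apply/cvgrPdist_lt => e e0; have [k _ hk] := near_infty_natSinv_lt (PosNum e0).
  near=> m; rewrite sub0r normrN gtr0_norm ?invr_gt0//.
  have /hk /= : (k <= m.+2)%N by near: m; exists k => // m /= km; rewrite (leq_trans km)// ltnW// ltnW.
  by [].
apply: (@ge0_exhaust_oo _ _ _ (fun k => a + d k)%R (fun k => b - d k)%R).
- apply: open_continuous_measurable_fun; first exact: interval_open.
  by move=> x; rewrite inE/= in_itv/=; exact: cf.
- by [].
- by move=> k; rewrite ltrDl.
- by move=> k; rewrite gtrBl.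
- by move=> i j /dd; rewrite lerD2l.
- by move=> i j /dd; rewrite lerD2l lerN2.
- move=> x /andP[ax xb].
  have e0 : (0 < Num.min (x - a) (b - x))%R by rewrite lt_min !subr_gt0 ax xb.
  have /cvgrPdist_lt/(_ _ e0)[k _ /(_ k (leqnn k))/=] := dcv.
  rewrite sub0r normrN gtr0_norm// lt_min => /andP[h1 h2].
  by exists k; apply/andP; split; lra.
have E k : \int[lam]_(x in `[(a + d k)%R, (b - d k)%R]) (f x)%:E =
    (F (b - d k) - F (a + d k))%:E%R.
  have h := d0 k; have h' := d3 k.
  have sub x : (a + d k <= x <= b - d k -> a < x < b)%R.
    by move=> /andP[? ?]; apply/andP; split; lra.
  rewrite (@continuous_FTC2 _ f F)//; first lra.
  - apply: continuous_in_subspaceT => x; rewrite inE/= in_itv/= => /sub; exact: cf.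
  - have cF x : (a < x < b)%R -> {for x, continuous F}.
      move=> /dF dFx; apply: differentiable_continuous; exact/derivable1_diffP/ex_derive.
    split.
    + move=> x; rewrite in_itv/= => /andP[x1 x2].
      by have /dF[]: (a < x < b)%R by apply/sub; rewrite !ltW.
    + by apply: cvg_at_right_filter; apply: cF; apply: sub; lra.
    + by apply: cvg_at_left_filter; apply: cF; apply: sub; lra.
  - move=> x; rewrite in_itv/= => /andP[x1 x2]; rewrite derive1E.
    have /dF dFx : (a < x < b)%R by apply/sub; rewrite !ltW.
    exact: derive_val.
under eq_fun do rewrite E.
apply: cvg_EFin; first by near=> k.
apply: cvgB.
- move/cvg_at_leftP : Fb; apply; split; first by move=> k; rewrite gtrBl.
  by rewrite -[X in _ --> X]subr0; apply: cvgB => //; exact: cvg_cst.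
- move/cvg_at_rightP : Fa; apply; split; first by move=> k; rewrite ltrDl.
  by rewrite -[X in _ --> X]addr0; apply: cvgD => //; exact: cvg_cst.
Unshelve. all: by end_near. Qed.

Lemma integral_powR_01 (p : R) : (-1 < p)%R ->
  \int[lam]_(x in `]0%R, 1%R[) (x `^ p)%:E = ((p + 1)^-1)%:E.
Proof.
move=> p1; have p10 : (0 < p + 1)%R by lra.
pose F (x : R) := ((p + 1)^-1 * x `^ (p + 1))%R.
rewrite -[X in X%:E]subr0; apply: (@ge0_FTC_oo _ F) => //.
- by move=> x _; exact: powR_ge0.
- by move=> x /andP[x0 _]; exact: powR_continuous_gt0.
- move=> x /andP[x0 _]; rewrite /F.
  have h := is_derive1_powR (p + 1) x0.
  apply: is_derive_eq.
  by rewrite addrK /GRing.scale/= mulrA mulVf ?mul1r// gt_eqF.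
- rewrite -[X in _ --> X](mulr0 (p + 1)^-1)%R; apply: cvgMr; exact: powR_cvg0.
- rewrite (_ : (p + 1)^-1 = (p + 1)^-1 * 1 `^ (p + 1))%R; last by rewrite powR1 mulr1.
  apply: cvgMr; apply: cvg_at_left_filter; exact: powR_continuous_gt0.
Qed.

Lemma powR_cvgy0 (p : R) : (p < 0)%R -> (x `^ p)%R @[x --> +oo%R] --> (0%R : R).
Proof.
move=> p0; apply: (@cvg_trans _ (expR (- (- p * ln x)) @[x --> +oo%R])).
  apply: near_eq_cvg; near=> x.
  have x0 : (0 < x)%R by near: x; exact: nbhs_pinfty_gt.
  by rewrite /powR gt_eqF// mulNr opprK.
apply: (@cvg_comp _ _ _ (fun x => - p * ln x)%R (fun x => expR (- x)) _ (pinfty_nbhs R)).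
  apply: gt0_cvgMry; first by rewrite oppr_gt0.
  apply/cvgryPge => A; near=> x.
  rewrite -ler_expR lnK; first by near: x; exact: nbhs_pinfty_ge.
  by rewrite posrE; near: x; exact: nbhs_pinfty_gt.
exact: cvgr_expR.
Unshelve. all: by end_near. Qed.

Lemma integral_powR_1y (p : R) : (p < -1)%R ->
  \int[lam]_(x in `[1%R, +oo[) (x `^ p)%:E = (- (p + 1)^-1)%:E.
Proof.
move=> p1; have p10 : (p + 1 < 0)%R by lra.
pose F (x : R) := ((p + 1)^-1 * x `^ (p + 1))%R.
rewrite (@ge0_continuous_FTC2y _ _ F _ 0%R)//.
- by rewrite /F powR1 mulr1 sub0e.
- by move=> x _; exact: powR_ge0.
- apply: continuous_in_subspaceT => x; rewrite inE/= in_itv/= andbT => x1.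
  by apply: powR_continuous_gt0; lra.
- rewrite -[X in _ --> X](mulr0 (p + 1)^-1)%R; apply: cvgMr.
  exact: powR_cvgy0.
- move=> x x1; apply: derivableM => //.
  by apply: derivable_powR; rewrite in_itv/= andbT; lra.
- apply: cvgMr; apply: cvg_at_right_filter; exact: powR_continuous_gt0.
- move=> x; rewrite in_itv/= andbT => x1; rewrite derive1E.
  have x0 : (0 < x)%R by lra.
  have h := is_derive1_powR (p + 1) x0.
  apply: derive_val.
  apply: is_derive_eq.
  by rewrite addrK /GRing.scale/= mulrA mulVf ?mul1r// lt_eqF.
Qed.

End integrals_on_the_line.

(** * Integrability of real integrands, norms and powers *)

Section real_integrands.
Context d (T : measurableType d) (R : realType) (mu : {measure set T -> \bar R}).
Variables (D : set T) (mD : measurable D).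
Implicit Types (f g : T -> R) (c : R).

Lemma integrableRD f g : mu.-integrable D (fun x => (f x)%:E) ->
  mu.-integrable D (fun x => (g x)%:E) ->
  mu.-integrable D (fun x => (f x + g x)%:E).
Proof. by move=> fi gi; have := integrableD mD fi gi; apply: eq_integrable. Qed.

Lemma integrableRB f g : mu.-integrable D (fun x => (f x)%:E) ->
  mu.-integrable D (fun x => (g x)%:E) ->
  mu.-integrable D (fun x => (f x - g x)%:E).
Proof. by move=> fi gi; have := integrableB mD fi gi; apply: eq_integrable. Qed.

Lemma integrableRZ c f : mu.-integrable D (fun x => (f x)%:E) ->
  mu.-integrable D (fun x => (c * f x)%:E).
Proof. by move=> fi; have := integrableZl mD c fi; apply: eq_integrable. Qed.

Lemma integrableR_sum (I : Type) (r : seq I) (f : I -> T -> R) :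
  (forall i, mu.-integrable D (fun x => (f i x)%:E)) ->
  mu.-integrable D (fun x => (\sum_(i <- r) f i x)%:E).
Proof.
move=> fi; have := @integrable_sum _ _ _ mu D mD I r xpredT (fun i x => (f i x)%:E) (fun i _ => fi i).
by apply: eq_integrable => // x _; rewrite -sumEFin.
Qed.

Lemma le_integrableR f g :
  measurable_fun D f -> (forall x, D x -> `|f x| <= g x) ->
  mu.-integrable D (fun x => (g x)%:E) -> mu.-integrable D (fun x => (f x)%:E).
Proof.
move=> mf fg; apply: le_integrable => //; first exact/measurable_EFinP.
move=> x Dx /=; rewrite lee_fin; apply: le_trans (fg x Dx) _; exact: ler_norm.
Qed.

Lemma integrable_indicM f : mu.-integrable D (fun x => (f x)%:E) ->
  mu.-integrable setT (fun x => (\1_D x * f x)%:E).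
Proof.
move=> /(integrable_mkcond _ mD); apply: eq_integrable => // x _.
by rewrite patchE indicE; case: (x \in D); rewrite ?mul1r ?mul0r.
Qed.

Lemma ge0_integrable f : measurable_fun D f ->
  (forall x, D x -> 0 <= f x) ->
  (\int[mu]_(x in D) (f x)%:E < +oo)%E -> mu.-integrable D (fun x => (f x)%:E).
Proof.
move=> mf f0 foo; apply/integrableP; split; first exact/measurable_EFinP.
rewrite (eq_integral (fun x => (f x)%:E))// => x /[!inE] /f0 fx.
by rewrite /= ger0_norm.
Qed.

End real_integrands.

Section enorm_theory.
Context {R : realType}.

Lemma enorm_ge0 n (x : 'rV[R]_n) : 0 <= enorm x.
Proof. exact: sqrtr_ge0. Qed.

Lemma ge0_sumsq n (x : 'rV[R]_n) : 0 <= \sum_i x 0 i ^+ 2.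
Proof. by apply: sumr_ge0 => i _; exact: sqr_ge0. Qed.

Lemma coord_le_enorm n (x : 'rV[R]_n) i : `|x 0 i| <= enorm x.
Proof.
rewrite -sqrtr_sqr ler_sqrt ?ge0_sumsq// (bigD1 i)//= lerDl.
by apply: sumr_ge0 => j _; exact: sqr_ge0.
Qed.

Lemma enorm_le_bound n (x : 'rV[R]_n) (M : R) : 0 <= M ->
  (forall i, `|x 0 i| <= M) -> enorm x <= n%:R * M.
Proof.
move=> M0 h; rewrite -(ger0_norm (mulr_ge0 (ler0n R n) M0)) -sqrtr_sqr ler_sqrt ?sqr_ge0//.
apply: (@le_trans _ _ (\sum_(i < n) M ^+ 2)).
  by apply: ler_sum => i _; rewrite -(real_normK (num_real (x 0 i))) lerXn2r ?nnegrE.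
rewrite sumr_const card_ord -[M ^+ 2 *+ n]mulr_natl exprMn.
apply: ler_wpM2r; first exact: sqr_ge0.
by case: n {x h} => [|n]; rewrite ?expr0n// -natrX ler_nat leq_pmulr.
Qed.

Lemma enormZ n (c : R) (x : 'rV[R]_n) : enorm (c *: x) = `|c| * enorm x.
Proof.
rewrite -[`|c|]sqrtr_sqr -sqrtrM ?sqr_ge0// /enorm; congr Num.sqrt.
by rewrite mulr_sumr; apply: eq_bigr => i _; rewrite mxE exprMn.
Qed.

Lemma enormN n (x : 'rV[R]_n) : enorm (- x) = enorm x.
Proof. by rewrite -scaleN1r enormZ normrN1 mul1r. Qed.

Lemma enormB n (x y : 'rV[R]_n) : enorm (x - y) = enorm (y - x).
Proof. by rewrite -opprB enormN. Qed.

Lemma enorm_eq0 n (x : 'rV[R]_n) : (enorm x == 0) = (x == 0).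
Proof.
apply/eqP/eqP => [x0|->].
  apply/rowP => i; rewrite mxE; apply/eqP; rewrite -normr_le0 -x0.
  exact: coord_le_enorm.
by rewrite -(scale0r 0) enormZ normr0 mul0r.
Qed.

Lemma enorm_gt0 n (x : 'rV[R]_n) : (0 < enorm x) = (x != 0).
Proof. by rewrite lt0r enorm_eq0 enorm_ge0 andbT. Qed.

Lemma coord_continuous_rV n (i : 'I_n) : continuous (fun x : 'rV[R]_n => x 0 i).
Proof. exact: coord_continuous. Qed.

Lemma enorm_continuous n : continuous (@enorm R n).
Proof.
move=> x; apply: (@continuous_comp _ _ _ (fun x : 'rV[R]_n => \sum_i x 0 i ^+ 2) Num.sqrt).
  apply: (@cvg_big _ _ +%R 0 xpredT) => [||i _]; last first.
  - apply: (@cvg_comp _ _ _ (fun x : 'rV[R]_n => x 0 i) (fun t => t ^+ 2)).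
      exact: coord_continuous_rV.
    exact: exprn_continuous.
  - exact: nbhs_filter.
  - exact: add_continuous.
exact: sqrt_continuous.
Qed.

Lemma measurable_enorm n : measurable_fun setT (@enorm R n).
Proof. exact: continuousT_measurable_rV (@enorm_continuous n). Qed.

Lemma rsnoc_lift n (x' : 'rV[R]_n) (a : R) j : rsnoc x' a 0 (lift ord_max j) = x' 0 j.
Proof. by rewrite mxE liftK. Qed.

Lemma rsnoc_max n (x' : 'rV[R]_n) (a : R) : rsnoc x' a 0 ord_max = a.
Proof. by rewrite mxE unlift_none. Qed.

Lemma xlast_rsnoc n (x' : 'rV[R]_n) (a : R) : xlast (rsnoc x' a) = a.
Proof. exact: rsnoc_max. Qed.

Lemma rsnocB n (x' y' : 'rV[R]_n) (a b : R) :
  rsnoc x' a - rsnoc y' b = rsnoc (x' - y') (a - b).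
Proof. by apply/rowP => i; rewrite !mxE; case: unliftP => [j _|_]; rewrite ?mxE. Qed.

Lemma rsnocZ n (x' : 'rV[R]_n) (a c : R) : c *: rsnoc x' a = rsnoc (c *: x') (c * a).
Proof. by apply/rowP => i; rewrite !mxE; case: unliftP => [j _|_]; rewrite ?mxE. Qed.

Lemma xlastB n (x y : 'rV[R]_n.+1) : xlast (x - y) = xlast x - xlast y.
Proof. by rewrite /xlast !mxE. Qed.

Lemma rsnoc_surj n (x : 'rV[R]_n.+1) :
  x = rsnoc (\row_j x 0 (lift ord_max j)) (xlast x).
Proof. by apply/rowP => i; rewrite !mxE; case: unliftP => [j ->|->]; rewrite ?mxE. Qed.

Lemma rsnoc_eq0 n (x' : 'rV[R]_n) (a : R) : rsnoc x' a = 0 -> a = 0.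
Proof. by move=> /(congr1 (@xlast R n)); rewrite xlast_rsnoc /xlast mxE. Qed.

Lemma measurable_xlast n : measurable_fun setT (@xlast R n).
Proof. exact: measurable_coord. Qed.

Lemma measurable_rVB n : measurable_fun setT
  (fun p : 'rV[R]_n * 'rV[R]_n => p.1 - p.2).
Proof.
apply: measurable_fun_rVP => i; under eq_fun do rewrite !mxE.
apply: measurable_funB.
  exact: measurableT_comp (measurable_coord i) measurable_fst.
exact: measurableT_comp (measurable_coord i) measurable_snd.
Qed.

Lemma measurable_subl n (x : 'rV[R]_n) : measurable_fun setT (fun y : 'rV[R]_n => x - y).
Proof.
rewrite (_ : (fun _ => _) = (fun y => -1 *: y + x)); first exact: measurable_rV_affine.
by apply/funext => y; rewrite scaleN1r addrC.
Qed.

End enorm_theory.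

Section pospow_theory.
Context {R : realType}.
Implicit Types t p c : R.

Lemma pospow_ge0 t p : 0 <= pospow t p.
Proof. by rewrite /pospow; case: ifP => // _; exact: powR_ge0. Qed.

Lemma pospowE t p : 0 < t -> pospow t p = t `^ p.
Proof. by rewrite /pospow => ->. Qed.

Lemma pospow_le0 t p : t <= 0 -> pospow t p = 0.
Proof. by rewrite /pospow; case: ltP. Qed.

Lemma pospowM c t p : 0 < c -> pospow (c * t) p = c `^ p * pospow t p.
Proof.
move=> c0; rewrite /pospow pmulr_rgt0//; case: ifP => [t0|]; last by rewrite mulr0.
by rewrite powRM// ltW.
Qed.

Lemma measurable_pospow p : measurable_fun setT (fun t => pospow t p).
Proof.
rewrite /pospow; apply: measurable_fun_ifT => //.
by apply: measurable_fun_ltr => //; exact: measurable_id.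
Qed.

End pospow_theory.

Section weight_convolution.
Context {R : realType}.
Local Notation lam := (@lebesgue_measure R).
Local Open Scope ereal_scope.

Lemma measurable_weight_kernel (p e a : R) : measurable_fun setT
  (fun b : measurableTypeR R => pospow b p * `|a - b| `^ e)%R.
Proof.
apply: measurable_funM; first exact: measurable_pospow.
apply: (measurableT_comp (measurable_powR e)).
apply: (measurableT_comp (@normr_measurable R setT)).
by apply: measurable_funB => //; exact: measurable_id.
Qed.

(** Substitute [b = a b']. *)
Lemma weight_kernel_scale (p e a : R) : (0 < a)%R ->
  \int[lam]_b (pospow b p * `|a - b| `^ e)%:E =
  (a `^ (p + e + 1))%:E * \int[lam]_b (pospow b p * `|1 - b| `^ e)%:E.
Proof.
move=> a0; have aN0 : a != 0%R by rewrite gt_eqF.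
have mf : measurable_fun setT (fun b : measurableTypeR R =>
    (pospow b p * `|a - b| `^ e)%:E).
  by apply/measurable_EFinP; exact: measurable_weight_kernel.
have H := ge0_integral_affine 0 aN0 mf
  (fun b => mulr_ge0 (pospow_ge0 _ _) (powR_ge0 _ _)).
transitivity (a%:E * \int[lam]_b (pospow (a * b + 0)%R p * `|a - (a * b + 0)| `^ e)%:E).
  by rewrite H muleA -EFinM gtr0_norm// mulfV// mul1e.
rewrite (_ : (a `^ (p + e + 1))%:E = a%:E * (a `^ (p + e))%:E); last first.
  rewrite -EFinM; congr EFin; rewrite powRD ?aN0 ?implybT// powRr1 ?ltW//.
  by rewrite mulrC.
rewrite -muleA; congr (_ * _); rewrite -ge0_integralZl_EFin//.
- apply: eq_integral => b _; rewrite -EFinM; congr EFin.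
  rewrite addr0 pospowM// -{2}[a]mulr1 -mulrBr normrM powRM// gtr0_norm//.
  by rewrite (powRD (x:=a)) ?aN0 ?implybT//; ring.
- by move=> b _; rewrite lee_fin mulr_ge0 ?pospow_ge0 ?powR_ge0.
- by apply/measurable_EFinP; exact: measurable_weight_kernel.
- exact: powR_ge0.
Qed.

Lemma lam_affine (c d : R) (f : R -> R) :
  (c != 0)%R -> lam.-integrable setT (EFin \o f) ->
  lam.-integrable setT (fun x => (f (c * x + d)%R)%:E) /\
  \int[lam]_x (f (c * x + d)%R)%:E = (`|c|^-1)%:E * \int[lam]_x (f x)%:E.
Proof.
move=> c0 fi; have mf := measurable_int _ fi.
have maf := measurable_affine c d.
have fi' : lam.-integrable setT (fun x => (f (c * x + d)%R)%:E).
  apply/integrableP; split; first exact: measurableT_comp mf maf.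
  rewrite (@ge0_integral_affine R c d (fun x => `|(f x)%:E|))//; last exact: measurableT_comp.
  by rewrite lte_mul_pinfty// ?lee_fin ?invr_ge0//; case/integrableP : fi.
split=> //; rewrite integralE [in RHS]integralE.
have mp : measurable_fun setT (EFin \o f)^\+ by exact: measurable_funepos.
have mn : measurable_fun setT (EFin \o f)^\- by exact: measurable_funeneg.
rewrite muleBr//; last first.
  by apply: fin_num_adde_defr; exact: (integrable_pos_fin_num _ fi).
rewrite -(ge0_integral_affine d c0 mp (fun x => funepos_ge0 _ x)).
rewrite -(ge0_integral_affine d c0 mn (fun x => funeneg_ge0 _ x)).
by congr (_ - _); apply: eq_integral => x _; rewrite ?funeposE ?funenegE.
Qed.

Lemma integrable_powR_01 (p : R) : (-1 < p)%R ->
  lam.-integrable setT (fun x => (\1_(`]0%R, 1%R[%classic : set R) x * x `^ p)%:E).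
Proof.
move=> p1; apply: integrable_indicM => //; apply: ge0_integrable => //.
- by apply: measurable_funTS; exact: measurable_powR.
- by move=> x _; exact: powR_ge0.
- by rewrite integral_powR_01// ltry.
Qed.

Lemma integrable_powR_1y (p : R) : (p < -1)%R ->
  lam.-integrable setT (fun x => (\1_(`[1%R, +oo[%classic : set R) x * x `^ p)%:E).
Proof.
move=> p1; apply: integrable_indicM => //; apply: ge0_integrable => //.
- by apply: measurable_funTS; exact: measurable_powR.
- by move=> x _; exact: powR_ge0.
- by rewrite integral_powR_1y// ltry.
Qed.

(** Integrable at [b = 0] since [p > -1], at [b = 1] since [e > -1], at infinity
    since [p + e < -1]; the constant [C] of the proof accounts for the factor
    that is not singular on each piece, where [b] or [|1 - b|] is at least 1/2. *)
Lemma weight_kernel_integrable1 (p e : R) : (-1 < p < 0)%R -> (-1 < e < 0)%R ->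
  (p + e < -1)%R ->
  lam.-integrable setT (fun b => (pospow b p * `|1 - b| `^ e)%:E).
Proof.
move=> /andP[p1 p0] /andP[e1 e0] pe.
pose g r (x : R) := (\1_(`]0%R, 1%R[%classic : set R) x * x `^ r)%R.
pose k r (x : R) := (\1_(`[1%R, +oo[%classic : set R) x * x `^ r)%R.
have ge1 := @lam_affine (-1) 1 (g e) _ (integrable_powR_01 e1).
have ge2 := @lam_affine 1 (-1) (g e) _ (integrable_powR_01 e1).
have g0 r x : (0 <= g r x)%R by rewrite mulr_ge0// powR_ge0.
have k0 r x : (0 <= k r x)%R by rewrite mulr_ge0// powR_ge0.
pose C := (2^-1 `^ (p + e) : R)%R.
have bound (b : R) : (pospow b p * `|1 - b| `^ e <=
    C * (g p b + (g e (-1 * b + 1) + (g e (1 * b - 1) + k (p + e) b))))%R.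
  have h2 (r : R) : (r < 0 -> 1 <= 2^-1 `^ r)%R.
    move=> r0; rewrite -[leLHS](powRr0 (2^-1)); apply: ger_powR; last exact: ltW.
    by apply/andP; split; lra.
  have CE : C = (2^-1 `^ p * 2^-1 `^ e)%R by rewrite /C powRD// invr_eq0 pnatr_eq0 implybT.
  have [hp he] := (h2 _ p0, h2 _ e0).
  have mono (r x y : R) : (r < 0 -> 0 < x -> x <= y -> y `^ r <= x `^ r)%R.
    move=> r0 x0 xy; rewrite -[r]opprK !(powRN _ (- r)) lef_pV2 ?posrE ?powR_gt0//; last lra.
    by apply: ge0_ler_powR; rewrite ?nnegrE; lra.
  have [b0|b0] := leP b 0%R.
    by rewrite pospow_le0// mul0r mulr_ge0// ?powR_ge0// !addr_ge0.
  rewrite pospowE//.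
  have [b1|b1] := leP b 2^-1%R.
    apply: (@le_trans _ _ (C * g p b)%R); last first.
      by rewrite ler_wpM2l ?powR_ge0// lerDl !addr_ge0.
    rewrite /g indicE mem_set ?mul1r; last by rewrite /= in_itv/= b0; lra.
    rewrite mulrC ler_wpM2r ?powR_ge0// CE.
    apply: le_trans (ler_peMl (powR_ge0 _ _) hp).
    by apply: mono => //; rewrite ?ger0_norm; lra.
  have [b2|b2] := leP 2%R b.
    apply: (@le_trans _ _ (C * k (p + e) b)%R); last first.
      by rewrite ler_wpM2l ?powR_ge0// !addrA lerDr !addr_ge0.
    rewrite /k indicE mem_set ?mul1r; last by rewrite /= in_itv/= andbT; lra.
    have -> : (b `^ (p + e) = b `^ p * b `^ e)%R by rewrite powRD// (gt_eqF b0) implybT.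
    rewrite [leRHS](_ : _ = b `^ p * (C * b `^ e))%R; last by ring.
    rewrite ler_wpM2l ?powR_ge0// CE -mulrA.
    apply: (@le_trans _ _ (2^-1 `^ e * b `^ e)%R); last first.
      by apply: ler_peMl hp; rewrite mulr_ge0 ?powR_ge0.
    rewrite -powRM//; [|lra..]; apply: mono => //; first lra.
    by rewrite ler0_norm; lra.
  apply: (@le_trans _ _ (C * (g e (-1 * b + 1) + g e (1 * b - 1)))%R); last first.
    rewrite ler_wpM2l ?powR_ge0// [leRHS]addrA addrA -addrA.
    rewrite [leRHS](_ : _ = g e (-1 * b + 1) + g e (1 * b - 1) + (g p b + k (p + e) b))%R; last by ring.
    by rewrite lerDl addr_ge0.
  apply: ler_pM; rewrite ?powR_ge0//.
    rewrite CE; apply: le_trans (ler_peMr (powR_ge0 _ _) he).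
    by apply: mono => //; lra.
  have [->|b1'] := eqVneq b 1%R.
    by rewrite subrr normr0 powR0 ?addr_ge0// lt_eqF.
  have [b3|b3] := ltP b 1%R.
    apply: (@le_trans _ _ (g e (-1 * b + 1))%R); last by rewrite lerDl.
    rewrite /g indicE mem_set ?mul1r; last by rewrite /= in_itv/=; apply/andP; split; lra.
    by rewrite ger0_norm; [rewrite mulN1r addrC|lra].
  have {}b3 : (1 < b)%R by rewrite lt_neqAle eq_sym b1'.
  apply: (@le_trans _ _ (g e (1 * b - 1))%R); last by rewrite lerDr.
  rewrite /g indicE mem_set ?mul1r; last by rewrite /= in_itv/=; apply/andP; split; lra.
  by rewrite ler0_norm; [rewrite opprB|lra].
apply: (@le_integrableR _ (measurableTypeR R) _ lam setT measurableT
  (fun b => pospow b p * `|1 - b| `^ e)%R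
  (fun b => C * (g p b + (g e (-1 * b + 1) + (g e (1 * b - 1) + k (p + e) b))))%R).
- exact: measurable_weight_kernel.
- move=> b _; rewrite ger0_norm; first exact: bound.
  by rewrite mulr_ge0 ?pospow_ge0 ?powR_ge0.
- apply: integrableRZ => //; apply: integrableRD => //; first exact: integrable_powR_01.
  apply: integrableRD => //; first by case: ge1 => //; rewrite oppr_eq0.
  apply: integrableRD => //; first by case: ge2.
  exact: integrable_powR_1y.
Qed.

End weight_convolution.

(** * Radial kernels *)

Section product_integrands.
Context {R : realType}.
Local Notation lam := (@lebesgue_measure R).

Lemma leb_integrable_prod n (f : 'I_n -> R -> R) :
  (forall i, measurable_fun setT (f i)) -> (forall i t, 0 <= f i t) ->
  (forall i, lam.-integrable setT (fun t => (f i t)%:E)) ->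
  (leb n).-integrable setT (fun x => (\prod_i f i (x 0 i))%:E).
Proof.
have mprod m (g : 'I_m -> R -> R) : (forall i, measurable_fun setT (g i)) ->
    measurable_fun setT (fun x : 'rV[R]_m => \prod_i g i (x 0 i)).
  move=> mg; elim: (index_enum _) => [|i r IH].
    by under eq_fun do rewrite big_nil; exact: measurable_cst.
  under eq_fun do rewrite big_cons.
  apply: measurable_funM => //.
  exact: measurableT_comp (mg i) (measurable_coord i).
move=> mf f0 fi; apply: ge0_integrable => //; first exact: mprod.
  by move=> x _; exact: prodr_ge0.
elim: n => [|n IHn] in f mf f0 fi *.
  rewrite (_ : (fun _ => _) = cst 1%:E); last first.
    by apply/funext => x; rewrite big_ord0.
  rewrite (eq_measure_integral (dirac (0 : 'rV[R]_0)))// integral_cst//=.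
  by rewrite mul1e diracT ltry.
rewrite ge0_lebSr; last 2 first.
- by apply/measurable_EFinP; exact: mprod.
- by move=> x; rewrite lee_fin prodr_ge0.
have IH := IHn (fun i => f (lift ord_max i)) _ _ _.
pose A := (\int[leb n]_x (\prod_i f (lift ord_max i) (x 0 i))%:E)%E.
have A0 : (0 <= A)%E by apply: integral_ge0 => x _; rewrite lee_fin prodr_ge0.
have Aoo : (A < +oo)%E by exact: IH.
apply: (@le_lt_trans _ _ (\int[lam]_a (A * (f ord_max a)%:E))%E).
  rewrite le_eqVlt; apply/orP; left; apply/eqP; apply: eq_integral => a _.
  rewrite muleC /A -ge0_integralZl_EFin//; last 2 first.
  - by move=> x _; rewrite lee_fin prodr_ge0.
  - by apply/measurable_EFinP; exact: (mprod n (fun i => f (lift ord_max i))).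
  apply: eq_integral => x _; rewrite -EFinM; congr EFin.
  rewrite big_ord_recr/= mulrC rsnoc_max; congr (_ * _).
  apply: eq_bigr => j _; rewrite (_ : widen_ord _ _ = lift ord_max j) ?rsnoc_lift//.
  by apply: ord_inj; rewrite lift_max.
rewrite ge0_integralZl//; last 2 first.
- by apply/measurable_EFinP; exact: mf.
- by move=> a _; rewrite lee_fin; exact: f0.
by rewrite lte_mul_pinfty// ?ge0_fin_numE//; exact: (integrable_lty measurableT (fi ord_max)).
Qed.

(** A power decaying at infinity and constant near zero. Products of [flat] over
    the coordinates dominate powers of the norm, which gives the integrability
    of the latter at infinity without polar coordinates. *)
Definition flat (r t : R) : R := Num.max 1 `|t| `^ r.

Lemma flat_ge0 r t : 0 <= flat r t. Proof. exact: powR_ge0. Qed.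

Lemma measurable_flat r : measurable_fun setT (flat r).
Proof.
apply: (measurableT_comp (measurable_powR r)).
apply: measurable_maxr => //; exact: normr_measurable.
Qed.

Lemma integrable_flat r : r < -1 -> lam.-integrable setT (fun t => (flat r t)%:E).
Proof.
move=> r1.
pose k (x : R) := \1_(`[1, +oo[%classic : set R) x * x `^ r.
have ki : lam.-integrable setT (fun x => (k x)%:E) by exact: integrable_powR_1y.
have [kNi _] := @lam_affine _ (-1) 0 k (ltac:(by rewrite oppr_eq0)) ki.
have k0 x : 0 <= k x by rewrite mulr_ge0// powR_ge0.
apply: (@le_integrableR _ _ _ lam setT measurableT (flat r)
  (fun t => \1_(`[-1, 1]%classic : set R) t + (k t + k (-1 * t + 0)))).
- exact: measurable_flat.
- move=> t _; rewrite ger0_norm ?flat_ge0// /flat.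
  have [t1|t1] := leP `|t| 1.
    rewrite powR1 indicE mem_set ?lerDl ?addr_ge0//= in_itv/=.
    by rewrite -ler_norml.
  have [t0|t0] := leP 0 t.
    rewrite ger0_norm//; apply: (@le_trans _ _ (k t)).
      rewrite /k indicE mem_set ?mul1r//= in_itv/= andbT.
      by move: t1; rewrite ger0_norm// => /ltW.
    by rewrite addrCA lerDl addr_ge0.
  rewrite ltr0_norm//; apply: (@le_trans _ _ (k (-1 * t + 0))).
    rewrite /k addr0 mulN1r indicE mem_set ?mul1r//= in_itv/= andbT.
    by move: t1; rewrite ltr0_norm// => /ltW.
  by rewrite addrA lerDr addr_ge0.
- apply: integrableRD => //; last exact: integrableRD.
  exact: integrable_indic_itv.
Qed.

(** The exponent [p] is shared equally between the coordinates: each factor of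
    the right-hand side is at least [A `^ (- (p / n))]. *)
Lemma powR_le_prod_flat n (h : 'rV[R]_n) (A p : R) : 0 <= p -> 1 <= A ->
  (forall i, `|h 0 i| <= A) -> A `^ (- p) <= \prod_i flat (- (p / n%:R)) (h 0 i).
Proof.
move=> p0 A1 hA; have A0 : 0 < A by lra.
case: n h hA => [|n] h hA.
  rewrite big_ord0 -[leRHS](powRr0 A); apply: ler_powR => //; lra.
apply: (@le_trans _ _ (\prod_(i < n.+1) A `^ (- (p / n.+1%:R)))).
  by rewrite prodr_const card_ord -powR_mulrn ?powR_ge0// -powRrM mulNr divfK ?pnatr_eq0.
apply: ler_prod => i _; rewrite powR_ge0/= /flat !powRN lef_pV2 ?posrE ?powR_gt0//.
  apply: ge0_ler_powR; rewrite ?nnegrE ?divr_ge0// ?le_max ?ler01// ?(ltW A0)//.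
  by rewrite ge_max A1 hA.
Qed.

Lemma integrable_prod_flat n (p : R) : n%:R < p ->
  (leb n).-integrable setT (fun h => (\prod_i flat (- (p / n%:R)) (h 0 i))%:E).
Proof.
move=> np; apply: (@leb_integrable_prod n (fun _ => flat (- (p / n%:R)))).
- by move=> _; exact: measurable_flat.
- by move=> _; exact: flat_ge0.
- case: n np => [|n] np i; first by case: i.
  by apply: integrable_flat; rewrite ltrN2 ltr_pdivlMr// mul1r.
Qed.

End product_integrands.

Section radial_kernels.
Context {R : realType}.
Local Notation lam := (@lebesgue_measure R).

Lemma measurable_enormB_powR n (x : 'rV[R]_n) r :
  measurable_fun setT (fun y : 'rV[R]_n => enorm (x - y) `^ r).
Proof.
apply: (measurableT_comp (measurable_powR r)).
exact: measurableT_comp (@measurable_enorm R n) (measurable_subl x).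
Qed.

Lemma measurable_enorm_powR n r : measurable_fun setT (fun y : 'rV[R]_n => enorm y `^ r).
Proof. exact: (measurableT_comp (measurable_powR r) (@measurable_enorm R n)). Qed.

Lemma integrable_slice1 n (r : R) : r < - n%:R ->
  (leb n).-integrable setT (fun z : 'rV[R]_n => (enorm (rsnoc z 1) `^ r)%:E).
Proof.
move=> rn; have n0 : 0 <= n%:R :> R by [].
apply: (@le_integrableR _ _ _ (leb n) setT measurableT _
  (fun z => \prod_i flat (- (- r / n%:R)) (z 0 i))).
- exact: measurableT_comp (@measurable_enorm_powR n.+1 r) (measurable_rsnocl 1).
- move=> z _; rewrite ger0_norm ?powR_ge0//.
  rewrite -[in leLHS](opprK r); apply: powR_le_prod_flat; first lra.
    by have := coord_le_enorm (rsnoc z 1) ord_max; rewrite rsnoc_max normr1.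
  by move=> i; have := coord_le_enorm (rsnoc z 1) (lift ord_max i); rewrite rsnoc_lift.
- by apply: integrable_prod_flat; lra.
Qed.

Lemma integrable_away n (r e : R) : 0 < e -> r < - n%:R ->
  (leb n).-integrable setT
    (fun z : 'rV[R]_n => (\1_[set h | e < enorm h] z * enorm z `^ r)%:E).
Proof.
move=> e0 rn; have n0 : 0 <= n%:R :> R by [].
pose c := Num.min 1 e; have c0 : 0 < c by rewrite lt_min ltr01.
apply: (@le_integrableR _ _ _ (leb n) setT measurableT _
  (fun h => c `^ r * \prod_i flat (- (- r / n%:R)) (h 0 i))).
- apply: measurable_funM; last exact: measurable_enorm_powR.
  apply: measurable_indic; rewrite -[X in measurable X]setTI.
  by apply: measurable_fun_ltr => //; exact: measurable_enorm.
- move=> z _; rewrite ger0_norm ?mulr_ge0 ?powR_ge0//.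
  rewrite indicE; case: (boolP (z \in _)); last first.
    by move=> _; rewrite mul0r mulr_ge0 ?powR_ge0// prodr_ge0// => i _; exact: flat_ge0.
  rewrite inE/= mul1r => ez.
  have z0 : 0 < enorm z by exact: lt_trans ez.
  have -> : enorm z `^ r = c `^ r * (enorm z / c) `^ r.
    by rewrite -powRM ?divr_ge0 ?(ltW c0) ?(ltW z0)// mulrC divfK// gt_eqF.
  rewrite ler_wpM2l ?powR_ge0//.
  rewrite -[in leLHS](opprK r); apply: powR_le_prod_flat; first lra.
    by rewrite ler_pdivlMr// mul1r ge_min (ltW ez) orbT.
  move=> i; apply: le_trans (coord_le_enorm z i) _.
  by rewrite ler_pdivlMr// ler_piMr ?ge_min ?lexx// ltW.
- by apply: integrableRZ => //; apply: integrable_prod_flat; lra.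
Qed.

(** The hyperplane at height [t] is the dilate by [t] of the one at height 1;
    the Jacobian of the tangential variables is [`|t| ^+ n]. *)
Lemma slice_integral n (Q : 'rV[R]_n.+1 -> R) (t c : R) : t != 0 ->
  (forall z, Q (t *: rsnoc z 1) = c * Q (rsnoc z 1)) ->
  (leb n).-integrable setT (fun z => (Q (rsnoc z 1))%:E) ->
  (leb n).-integrable setT (fun h' => (Q (rsnoc h' t))%:E) /\
  (\int[leb n]_h' (Q (rsnoc h' t))%:E =
   (`|t| ^+ n * c)%:E * \int[leb n]_z (Q (rsnoc z 1))%:E)%E.
Proof.
move=> t0 Qt Qi.
have cQi := integrableRZ measurableT c Qi.
have tV0 : t^-1 != 0 by rewrite invr_eq0.
have [h1 h2] := @leb_affine R n t^-1 0 (fun z => c * Q (rsnoc z 1)) tV0 cQi.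
have E h' : c * Q (rsnoc (t^-1 *: h' + 0) 1) = Q (rsnoc h' t).
  by rewrite -Qt rsnocZ addr0 scalerA mulfV// scale1r mulr1.
split; first by apply: eq_integrable h1 => // h' _; rewrite E.
rewrite -(eq_integral _ _ (fun h' _ => congr1 EFin (E h'))) h2 normfV exprVn invrK EFinM -muleA; congr (_ * _)%E.
by rewrite -integralZl//; apply: eq_integral => z _; rewrite EFinM.
Qed.

Definition kslice n (r : R) : R := \int[leb n]_z (enorm (rsnoc z 1) `^ r).

Lemma slice_enorm n (r t : R) (x' : 'rV[R]_n) : t != 0 -> r < - n%:R ->
  (\int[leb n]_y' (enorm (rsnoc (x' - y') t) `^ r)%:E =
   (`|t| `^ (n%:R + r) * kslice n r)%:E)%E.
Proof.
move=> t0 rn; have i1 := integrable_slice1 rn.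
have [|ti tE] := @slice_integral n (fun h => enorm h `^ r) t (`|t| `^ r) t0 _ i1.
  by move=> z; rewrite enormZ powRM// enorm_ge0.
have N1 : -1 != 0 :> R by rewrite oppr_eq0.
have [_] := @leb_affine R n (-1) x' (fun h' => enorm (rsnoc h' t) `^ r) N1 ti.
rewrite normrN1 (expr1n R n) invr1 mul1e tE => H.
transitivity (\int[leb n]_y' (enorm (rsnoc (-1 *: y' + x') t) `^ r)%:E)%E.
  by apply: eq_integral => y' _; rewrite scaleN1r addrC.
rewrite H [in RHS]EFinM; congr (_ * _)%E.
  by rewrite -powR_mulrn// -powRD// normr_eq0 t0 implybT.
by rewrite fineK//; exact: (integrable_fin_num measurableT i1).
Qed.

Lemma ae_neq (a : R) : {ae lam, forall b : R, b != a}.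
Proof.
exists [set a]; split; first exact: measurable_set1.
  exact: lebesgue_measure_set1.
by move=> b /= /negP; rewrite negbK => /eqP.
Qed.

Definition xweight n (p : R) (x : 'rV[R]_n.+1) : R := pospow (xlast x) p.

Lemma measurable_xweight n p : measurable_fun setT (@xweight n p).
Proof. exact: (measurableT_comp (measurable_pospow p) (@measurable_xlast R n)). Qed.

Lemma xweight_ge0 n p (x : 'rV[R]_n.+1) : 0 <= xweight p x.
Proof. exact: pospow_ge0. Qed.

(** Integrating first along hyperplanes turns a power of the distance in
    dimension [n.+1] into a power in dimension one. *)
Lemma weight_kernel_rV n (p r : R) (x : 'rV[R]_n.+1) : r < - n%:R ->
  (\int[leb n.+1]_y (xweight p y * enorm (x - y) `^ r)%:E =
   (kslice n r)%:E *
     \int[lam]_b (pospow b p * `|xlast x - b| `^ (n%:R + r))%:E)%E.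
Proof.
move=> rn; rewrite ge0_lebSr; last 2 first.
- apply/measurable_EFinP; apply: measurable_funM; first exact: measurable_xweight.
  exact: measurable_enormB_powR.
- by move=> y; rewrite lee_fin mulr_ge0 ?pospow_ge0 ?powR_ge0.
have k0 : 0 <= kslice n r by apply: Rintegral_ge0 => z _; exact: powR_ge0.
rewrite -ge0_integralZl_EFin//; last 2 first.
- by move=> b _; rewrite lee_fin mulr_ge0 ?pospow_ge0 ?powR_ge0.
- by apply/measurable_EFinP; exact: measurable_weight_kernel.
apply: ge0_ae_eq_integral => //.
- apply: (@measurable_fun_fubini_tonelli_G _ _ _ _ _ (leb n)
    (fun z : 'rV[R]_n * measurableTypeR R =>
     (xweight p (rsnoc z.1 z.2) * enorm (x - rsnoc z.1 z.2) `^ r)%:E)).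
    apply/measurable_EFinP.
    apply: (@measurableT_comp _ _ _ _ _ _ (fun y => xweight p y * enorm (x - y) `^ r)).
      apply: measurable_funM; first exact: measurable_xweight.
      exact: measurable_enormB_powR.
    exact: measurable_rsnoc.
  by move=> z; rewrite lee_fin mulr_ge0 ?pospow_ge0 ?powR_ge0.
- apply/measurable_EFinP; apply: measurable_funM => //; exact: measurable_weight_kernel.
- by move=> b _; apply: integral_ge0 => y _; rewrite lee_fin mulr_ge0 ?pospow_ge0 ?powR_ge0.
- by move=> b _; rewrite lee_fin !mulr_ge0 ?pospow_ge0 ?powR_ge0.
apply: (@filterS _ _ (ae_filter_ringOfSetsType lam) _ _ _ (ae_neq (xlast x))) => b bx _.
have xb : xlast x - b != 0 by rewrite subr_eq0 eq_sym.
pose x' := \row_j x 0 (lift ord_max j).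
have xE y' : x - rsnoc y' b = rsnoc (x' - y') (xlast x - b).
  by rewrite {1}(rsnoc_surj x) rsnocB.
under eq_integral => y' _ do rewrite xE /xweight xlast_rsnoc EFinM.
rewrite ge0_integralZl_EFin ?pospow_ge0//; last 2 first.
- by move=> y' _; rewrite lee_fin powR_ge0.
- apply/measurable_EFinP.
  apply: (@measurableT_comp _ _ _ _ _ _ (fun y' => enorm (rsnoc y' (xlast x - b)) `^ r)).
    exact: measurableT_comp (@measurable_enorm_powR n.+1 r) (measurable_rsnocl _).
  exact: measurable_subl.
by rewrite slice_enorm// -!EFinM; congr EFin; ring.
Qed.

End radial_kernels.

(** * The dominating functions *)

Section boxes.
Context {R : realType}.
Local Notation lam := (@lebesgue_measure R).

(** By scaling, with the value of the integral at [a = 1] as the constant. *)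
Lemma weight_kernel_const (p r : R) : exists2 I : R, 0 <= I &
  (-1 < p < 0 -> -1 < r < 0 -> p + r < -1 -> forall a, 0 < a ->
   (\int[lam]_b (pospow b p * `|a - b| `^ r)%:E = (I * a `^ (p + r + 1))%:E)%E).
Proof.
exists (\int[lam]_b (pospow b p * `|1 - b| `^ r)).
  by apply: Rintegral_ge0 => b _; rewrite mulr_ge0 ?pospow_ge0 ?powR_ge0.
move=> p0 r0 pr a a0; rewrite weight_kernel_scale// mulrC EFinM; congr (_ * _)%E.
rewrite fineK//; apply: integrable_fin_num => //; exact: weight_kernel_integrable1.
Qed.

Definition box n (M : R) : set 'rV[R]_n := [set x | forall i, `|x 0 i| <= M].

Lemma indic_box n M (x : 'rV[R]_n) :
  \1_(box M) x = \prod_i \1_(`[- M, M]%classic) (x 0 i) :> R.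
Proof.
have [xM|] := pselect (box M x).
  rewrite indicE mem_set// big1// => i _; rewrite indicE mem_set//=.
  by rewrite in_itv/= -ler_norml; exact: xM.
move=> xM; rewrite indicE memNset//; have /existsNP[i xi] := xM.
rewrite (bigD1 i)//= indicE memNset ?mul0r//= in_itv/= -ler_norml.
exact: xi.
Qed.

Lemma measurable_box n M : measurable (@box n M).
Proof.
rewrite (_ : box M = \bigcap_(i in [set: 'I_n])
    ((fun x : 'rV[R]_n => x 0 i : measurableTypeR R) @^-1` `[- M, M]%classic)).
  apply: fin_bigcap_measurable; first exact: finite_finset.
  move=> i _; rewrite -[X in measurable X]setTI.
  by apply: measurable_coord => //; exact: measurable_itv.
apply/seteqP; split=> x /= h i; first by move=> _ /=; rewrite in_itv/= -ler_norml; exact: h.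
by have := h i I; rewrite /= in_itv/= -ler_norml.
Qed.

Lemma integrable_pospow_box (M p : R) : -1 < p ->
  lam.-integrable setT (fun a => (\1_(`[- M, M]%classic : set R) a * pospow a p)%:E).
Proof.
move=> p1.
pose g (x : R) := \1_(`]0, 1[%classic : set R) x * x `^ p.
have gi : lam.-integrable setT (fun x => (g x)%:E) by exact: integrable_powR_01.
have M1 : 0 < `|M| + 1 by rewrite ltr_wpDl.
have MV0 : (`|M| + 1)^-1 != 0 by rewrite invr_eq0 gt_eqF.
have [gMi _] := @lam_affine _ (`|M| + 1)^-1 0 g MV0 gi.
apply: (@le_integrableR _ _ _ lam setT measurableT _
  (fun a => (`|M| + 1) `^ p * g ((`|M| + 1)^-1 * a + 0))).
- apply: measurable_funM; last exact: measurable_pospow.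
  by apply: measurable_indic; exact: measurable_itv.
- move=> a _; rewrite ger0_norm ?mulr_ge0 ?pospow_ge0//.
  have g0 x : 0 <= g x by rewrite mulr_ge0 ?powR_ge0.
  have [a0|a0] := leP a 0; first by rewrite pospow_le0// mulr0 mulr_ge0 ?powR_ge0.
  rewrite indicE; case: (boolP (a \in _)); last first.
    by rewrite mul0r mulr_ge0 ?powR_ge0.
  rewrite inE/= in_itv/= => /andP[_ aM]; rewrite mul1r pospowE// /g addr0.
  have aM1 : a < `|M| + 1 by rewrite (le_lt_trans aM)// (le_lt_trans (ler_norm M))// ltrDl.
  rewrite indicE mem_set; last first.
    by rewrite /= in_itv/= mulr_gt0 ?invr_gt0//= mulrC ltr_pdivrMr// mul1r.
  by rewrite mul1r -powRM ?mulr_ge0 ?invr_ge0 ?(ltW a0) ?(ltW M1)// mulrA mulfV ?mul1r// gt_eqF.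
- exact: integrableRZ.
Qed.

End boxes.

Section domination.
Context {R : realType}.
Local Notation lam := (@lebesgue_measure R).
Variables (n : nat) (s q M : R).
Hypotheses (s01 : 0 < s < 1) (q1 : 1 < q) (q2s : 2 * s < q) (qs1 : q < 1 + s).

Let p_range : -1 < s - 1 < 0.
Proof. by move: s01 => /andP[? ?]; apply/andP; split; lra. Qed.
Let e_range : -1 < q - 1 - 2 * s < 0.
Proof. by move: s01 q2s qs1 => /andP[? ?] ? ?; apply/andP; split; lra. Qed.
Let pe_range : s - 1 + (q - 1 - 2 * s) < -1.
Proof. by move: qs1; lra. Qed.

Lemma integrable_swap d (T : measurableType d) (m : {sigma_finite_measure set T -> \bar R})
    (f : T * T -> R) :
  (m \x m)%E.-integrable setT (fun z => (f z)%:E) ->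
  (m \x m)%E.-integrable setT (fun z => (f (z.2, z.1))%:E).
Proof.
move=> fi; have mf := measurable_int _ fi.
have mf' : measurable_fun setT (fun z : T * T => (f (z.2, z.1))%:E).
  apply: (@measurableT_comp _ _ _ _ _ _ (fun z => (f z)%:E)) => //.
  exact: measurable_swap.
apply/(integrable21ltyP _ _ mf').
by move/(integrable12ltyP _ _ mf) : fi.
Qed.

(** The one-dimensional and [n.+1]-dimensional versions of the same function: two
    weights, a kernel improved by [q] orders of vanishing on the diagonal, and
    the localization of at least one of the two points. *)
Definition majorant1 (z : R * R) : R :=
  (\1_(`[- M, M]%classic : set R) z.1 + \1_(`[- M, M]%classic : set R) z.2) *
  (pospow z.1 (s - 1) * pospow z.2 (s - 1) * `|z.1 - z.2| `^ (q - 1 - 2 * s)).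

(** By symmetry one indicator suffices. The inner integral is a multiple of
    [a `^ (q - 1 - s)], and [a `^ (s - 1) * a `^ (q - 1 - s)] is integrable at 0
    as [q > 1]. *)
Lemma majorant1_integrable : (lam \x lam)%E.-integrable setT (fun z => (majorant1 z)%:E).
Proof.
pose h (z : R * R) := \1_(`[- M, M]%classic : set R) z.1 *
  (pospow z.1 (s - 1) * pospow z.2 (s - 1) * `|z.1 - z.2| `^ (q - 1 - 2 * s)).
have hE z : majorant1 z = h z + h (z.2, z.1).
  rewrite /majorant1 /h/= mulrDl; congr (_ + _ * _).
  by rewrite distrC [pospow z.2 _ * _]mulrC.
have hi : (lam \x lam)%E.-integrable setT (fun z => (h z)%:E).
  have mh : measurable_fun [set: measurableTypeR R * measurableTypeR R] (fun z => (h z)%:E).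
    apply/measurable_EFinP; apply: measurable_funM.
      apply: measurableT_comp measurable_fst.
      by apply: measurable_indic; exact: measurable_itv.
    apply: measurable_funM.
      apply: measurable_funM.
        exact: measurableT_comp (measurable_pospow _) measurable_fst.
      exact: measurableT_comp (measurable_pospow _) measurable_snd.
    apply: (measurableT_comp (measurable_powR _)).
    apply: (measurableT_comp (@normr_measurable R setT)).
    by apply: measurable_funB; [exact: measurable_fst|exact: measurable_snd].
  apply/(integrable12ltyP _ _ mh).
  have [I I0 IE] := weight_kernel_const (s - 1) (q - 1 - 2 * s).
  have q21 : -1 < q - 2 by move: q1; lra.
  have /integrableP[_] := integrableRZ measurableT I
    (@integrable_pospow_box R M (q - 2) q21).
  apply: le_lt_trans; rewrite le_eqVlt; apply/orP; left; apply/eqP.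
  apply: eq_integral => a _ /=.
  transitivity (\int[lam]_b ((\1_(`[- M, M]%classic : set R) a * pospow a (s - 1))%:E *
     (pospow b (s - 1) * `|a - b| `^ (q - 1 - 2 * s))%:E))%E.
    apply: eq_integral => b _; rewrite -EFinM ger0_norm; last first.
      by rewrite /h/= !mulr_ge0 ?pospow_ge0 ?powR_ge0.
    by congr EFin; rewrite /h/=; ring.
  rewrite ge0_integralZl_EFin//; last 3 first.
  - by move=> b _; rewrite lee_fin mulr_ge0 ?pospow_ge0 ?powR_ge0.
  - by apply/measurable_EFinP; exact: measurable_weight_kernel.
  - by rewrite mulr_ge0 ?pospow_ge0.
  rewrite ger0_norm ?mulr_ge0 ?pospow_ge0//.
  have [a0|a0] := leP a 0; first by rewrite !pospow_le0// !mulr0 mul0e.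
  rewrite IE// -EFinM; congr EFin; rewrite !pospowE//.
  rewrite (_ : q - 2 = (s - 1) + (s - 1 + (q - 1 - 2 * s) + 1)); last by ring.
  by rewrite (@powRD _ a (s - 1)) ?(gt_eqF a0) ?implybT//; ring.
apply: eq_integrable (integrableRD measurableT hi (integrable_swap hi)) => // z _.
by rewrite hE.
Qed.

Definition majorantN (z : 'rV[R]_n.+1 * 'rV[R]_n.+1) : R :=
  (\1_(box M) z.1 + \1_(box M) z.2) *
  (xweight (s - 1) z.1 * xweight (s - 1) z.2 *
   enorm (z.1 - z.2) `^ (q - n.+1%:R - 2 * s)).

(** Slicing reduces the integral to the one-dimensional one, whose exponent is
    [q - 1 - 2 s]. *)
Lemma inner_kernel_const : exists2 I : R, 0 <= I & forall x : 'rV[R]_n.+1, 0 < xlast x ->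
  (\int[leb n.+1]_y (xweight (s - 1) y * enorm (x - y) `^ (q - n.+1%:R - 2 * s))%:E =
  (I * xlast x `^ (q - 1 - s))%:E)%E.
Proof.
have [I I0 IE] := weight_kernel_const (s - 1) (q - 1 - 2 * s).
have rn : q - n.+1%:R - 2 * s < - n%:R.
  by rewrite -natr1; move: qs1 s01 => ? /andP[? ?]; lra.
have eE : n%:R + (q - n.+1%:R - 2 * s) = q - 1 - 2 * s by rewrite -natr1; ring.
exists (kslice n (q - n.+1%:R - 2 * s) * I).
  by rewrite mulr_ge0//; apply: Rintegral_ge0 => z _; exact: powR_ge0.
move=> x x0; rewrite weight_kernel_rV// eE IE// -EFinM mulrA.
by congr (_ * _ `^ _)%:E; ring.
Qed.

Lemma kernel_integrable (x : 'rV[R]_n.+1) : 0 < xlast x ->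
  (leb n.+1).-integrable setT
    (fun y => (xweight (s - 1) y * enorm (x - y) `^ (q - n.+1%:R - 2 * s))%:E).
Proof.
move=> x0; have [I I0 IE] := inner_kernel_const.
apply: ge0_integrable => //.
- by apply: measurable_funM; [exact: measurable_xweight|exact: measurable_enormB_powR].
- by move=> y _; rewrite mulr_ge0 ?pospow_ge0 ?powR_ge0.
- by rewrite IE// ltry.
Qed.

Lemma integrable_weight_box (p : R) : -1 < p ->
  (leb n.+1).-integrable setT (fun x => (\1_(box M) x * xweight p x)%:E).
Proof.
move=> p1.
pose f (i : 'I_n.+1) (t : R) : R := \1_(`[- M, M]%classic : set R) t *
  (if i == ord_max then pospow t p else 1).
have mI : measurable_fun setT (\1_(`[- M, M]%classic : set R) : R -> R).
  by apply: measurable_indic; exact: measurable_itv.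
have : (leb n.+1).-integrable setT (fun x => (\prod_i f i (x 0 i))%:E).
  apply: leb_integrable_prod => [i|i t|i]; rewrite /f.
  - apply: measurable_funM => //; case: (i == ord_max) => //.
    exact: measurable_pospow.
  - by rewrite mulr_ge0//; case: (i == ord_max) => //; exact: pospow_ge0.
  - case: (i == ord_max); first exact: integrable_pospow_box.
    under eq_fun do rewrite mulr1; exact: integrable_indic_itv.
apply: eq_integrable => // x _; congr EFin.
rewrite /f big_split/= -indic_box; congr (_ * _).
rewrite (bigD1 ord_max)//= eqxx big1 ?mulr1// => i /negbTE ->.
by [].
Qed.

Lemma majorantN_integrable : (leb n.+1 \x leb n.+1)%E.-integrable setT (fun z => (majorantN z)%:E).
Proof.
pose h (z : 'rV[R]_n.+1 * 'rV[R]_n.+1) := \1_(box M) z.1 *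
  (xweight (s - 1) z.1 * xweight (s - 1) z.2 *
   enorm (z.1 - z.2) `^ (q - n.+1%:R - 2 * s)).
have hE z : majorantN z = h z + h (z.2, z.1).
  rewrite /majorantN /h /= mulrDl (enormB z.2 z.1).
  by rewrite [xweight (s - 1) z.2 * xweight (s - 1) z.1]mulrC.
have h0 z : 0 <= h z by rewrite /h !mulr_ge0 ?xweight_ge0 ?powR_ge0.
have hi : (leb n.+1 \x leb n.+1)%E.-integrable setT (fun z => (h z)%:E).
  have mh : measurable_fun setT (fun z => (h z)%:E).
    apply/measurable_EFinP; apply: measurable_funM.
      by apply: measurableT_comp measurable_fst; apply: measurable_indic; exact: measurable_box.
    apply: measurable_funM.
      apply: measurable_funM.
        exact: measurableT_comp (measurable_xweight _) measurable_fst.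
      exact: measurableT_comp (measurable_xweight _) measurable_snd.
    apply: (measurableT_comp (measurable_powR _)).
    exact: measurableT_comp (@measurable_enorm R n.+1) (@measurable_rVB R n.+1).
  apply/(integrable12ltyP _ _ mh).
  have [I I0 IE] := inner_kernel_const.
  have q21 : -1 < q - 2 by move: q1; lra.
  have := integrable_lty measurableT (integrableRZ measurableT I (integrable_weight_box q21)).
  apply: le_lt_trans; rewrite le_eqVlt; apply/orP; left; apply/eqP.
  apply: eq_integral => x _ /=.
  transitivity (\int[leb n.+1]_y ((\1_(box M) x * xweight (s - 1) x)%:E *
     (xweight (s - 1) y * enorm (x - y) `^ (q - n.+1%:R - 2 * s))%:E))%E.
    apply: eq_integral => y _; rewrite -EFinM ger0_norm//.
    by congr EFin; rewrite /h/=; ring.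
  rewrite ge0_integralZl_EFin//; last 3 first.
  - by move=> b _; rewrite lee_fin mulr_ge0 ?pospow_ge0 ?powR_ge0.
  - apply/measurable_EFinP.
    by apply: measurable_funM; [exact: measurable_xweight|exact: measurable_enormB_powR].
  - by rewrite mulr_ge0 ?xweight_ge0.
  have [a0|a0] := leP (xlast x) 0; first by rewrite /xweight !pospow_le0// !mulr0 mul0e.
  rewrite IE// -EFinM; congr EFin; rewrite /xweight !pospowE//.
  rewrite (_ : q - 2 = (s - 1) + (q - 1 - s)); last by ring.
  by rewrite (@powRD _ (xlast x) (s - 1)) ?(gt_eqF a0) ?implybT//; ring.
apply: eq_integrable (integrableRD measurableT hi (integrable_swap hi)) => // z _.
by rewrite hE.
Qed.

End domination.

(** * The substitution t = u / (1 + u) *)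

Section inversion.
Context {R : realType}.
Local Notation lam := (@lebesgue_measure R).

(** If [t = mobius u] then [1 - t] is the inverse of [1 + u]: powers of [1 - t]
    below 1 become powers of [1 + u] on the half line. *)
Definition mobius (t : R) : R := t / (1 + t).

Lemma mobiusE (t : R) : -1 < t -> mobius t = 1 - (1 + t)^-1.
Proof. by move=> t1; rewrite /mobius; field; rewrite gt_eqF//; lra. Qed.

Lemma is_derive_mobius (t : R) : -1 < t -> is_derive t (1 : R) mobius ((1 + t) ^- 2).
Proof.
move=> t1; have t0 : 1 + t != 0 by rewrite gt_eqF//; lra.
have h : is_derive t (1 : R) (fun x => 1 + x) 1.
  have h0 := is_deriveD (is_derive_cst (1 : R) t (1 : R)) (is_derive_id t (1 : R)).
  by apply: (is_derive_eq h0); rewrite add0r.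
have hV := @is_deriveV _ (fun x : R => 1 + x) t 1 1 t0 h.
have hM := is_deriveM (is_derive_id t 1) hV.
apply: (is_derive_eq hM).
rewrite /GRing.scale/= mulr1 mulrN -[(1 + t)^-1]mulr1; field.
by rewrite t0.
Qed.

Lemma mobius_derive1 (t : R) : -1 < t -> derive1 mobius t = (1 + t) ^- 2.
Proof. by move=> t1; rewrite derive1E; have h := is_derive_mobius t1; exact: derive_val. Qed.

Lemma cvg_mobius_derive1 (t : R) : -1 < t -> derive1 mobius x @[x --> t] --> (1 + t) ^- 2.
Proof.
move=> t1; apply: (@cvg_trans _ ((1 + x) ^- 2 @[x --> t])).
  apply: near_eq_cvg; near=> x; rewrite mobius_derive1//.
  by near: x; exact: lt_nbhsr.
have h : (1 + x) ^+ 2 @[x --> t] --> (1 + t) ^+ 2.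
  apply: (@cvg_comp _ _ _ (fun x => 1 + x) (fun x => x ^+ 2)).
    by apply: cvgD; [exact: cvg_cst|exact: cvg_id].
  exact: exprn_continuous.
by apply: cvgV h; rewrite expf_neq0// gt_eqF//; lra.
Unshelve. all: by end_near. Qed.

(** The substitution rule for compact intervals, and exhaustion of the ray by
    intervals [[d, d + k]]. *)
Lemma ge0_integral_mobius (G : R -> R) (d : R) : 0 < d ->
  (forall t, 0 < t < 1 -> 0 <= G t) ->
  (forall t, 0 < t < 1 -> {for t, continuous G}) ->
  (\int[lam]_(t in `[mobius d, 1%R[) (G t)%:E =
   \int[lam]_(t in `[d, +oo[) (G (mobius t) * (1 + t) ^- 2)%:E)%E.
Proof.
move=> d0 G0 cG.
have sq01 (t : R) : 0 < t -> 0 < mobius t < 1.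
  by move=> t0; rewrite /mobius divr_gt0 ?addr_gt0// ltr_pdivrMr ?addr_gt0//; lra.
have sq_homo (x y : R) : 0 < x -> x < y -> mobius x < mobius y.
  move=> x0 xy; rewrite !mobiusE; try lra.
  by rewrite ltrD2l ltrN2 ltf_pV2 ?posrE; lra.
pose b k : R := d + k.+1%:R.
have db k : d < b k by rewrite ltrDl.
have csq (t : R) : 0 < t -> {for t, continuous mobius}.
  move=> t0; apply: differentiable_continuous; apply/derivable1_diffP.
  by have [] := @is_derive_mobius t (ltac:(lra)).
have E k : (\int[lam]_(t in `[mobius d, mobius (b k)]) (G t)%:E =
    \int[lam]_(t in `[d, b k]) (G (mobius t) * (1 + t) ^- 2)%:E)%E.
  rewrite (@integration_by_substitution_increasing _ mobius G d (b k))//.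
  - apply: eq_integral => t; rewrite inE/= in_itv/= => /andP[dt _].
    transitivity (G (mobius t) * derive1 mobius t)%:E => //.
    by rewrite mobius_derive1//; lra.
  - exact: ltW.
  - by move=> x y; rewrite !in_itv/= => /andP[dx _] _; apply: sq_homo; lra.
  - move=> x; rewrite in_itv/= => /andP[dx _].
    by rewrite /continuous_at mobius_derive1; [apply: cvg_mobius_derive1|]; lra.
  - apply: cvgP; apply: cvg_at_right_filter; apply: cvg_mobius_derive1; lra.
  - apply: cvgP; apply: cvg_at_left_filter; apply: cvg_mobius_derive1.
    by have := db k; lra.
  - split.
    + move=> x; rewrite in_itv/= => /andP[dx _].
      by have [] := @is_derive_mobius x (ltac:(lra)).
    + by apply: cvg_at_right_filter; exact: csq.
    + by apply: cvg_at_left_filter; apply: csq; have := db k; lra.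
  - apply: continuous_in_subspaceT => t; rewrite inE/= in_itv/= => /andP[t1 t2].
    have /andP[h1 _] := sq01 d d0; have /andP[_ h2] := sq01 (b k) (lt_trans d0 (db k)).
    by apply: cG; rewrite (lt_le_trans h1 t1) (le_lt_trans t2 h2).
have /andP[e0 e1] := sq01 d d0.
have sub1 : `[mobius d, 1%R[%classic `<=` (`]0%R, 1%R[%classic : set R).
  by move=> t /=; rewrite !in_itv/= => /andP[h1 ->]; rewrite (lt_le_trans e0 h1).
have bhomo i j : (i <= j)%N -> b i <= b j by move=> ij; rewrite lerD2l ler_nat ltnS.
have cvg1 : (\int[lam]_(t in `[mobius d, mobius (b k)]) (G t)%:E @[k --> \oo] -->
    \int[lam]_(t in `[mobius d, 1%R[) (G t)%:E)%E.
  have U : \bigcup_k `[mobius d, mobius (b k)]%classic = `[mobius d, 1%R[%classic.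
    apply/seteqP; split=> [t [k _]|t]; rewrite /= !in_itv/= => /andP[t1 t2].
      have /andP[_ h2] := sq01 (b k) (lt_trans d0 (db k)).
      by rewrite t1 (le_lt_trans t2 h2).
    have [k kt] : exists k : nat, t / (1 - t) <= k%:R.
      exists (Num.truncn (t / (1 - t))).+1; exact/ltW/truncnS_gt.
    exists k => //=; rewrite in_itv/= t1/=.
    have t0 : 0 < t by exact: lt_le_trans t1.
    have h : t / (1 - t) <= b k.
      by rewrite (le_trans kt)// /b -natr1; lra.
    have hp : 0 < t / (1 - t) by rewrite divr_gt0// subr_gt0.
    have -> : t = mobius (t / (1 - t)).
      by rewrite /mobius; field; apply/andP; split; rewrite gt_eqF//; lra.
    by move: h; rewrite le_eqVlt => /orP[/eqP->//|h']; exact/ltW/sq_homo.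
  rewrite -U; apply: (@ge0_nondecreasing_set_cvg_integral _ (measurableTypeR R) R
    (fun k => `[mobius d, mobius (b k)]%classic) (fun t => (G t)%:E) lam).
  - move=> i j ij; rewrite subsetEset => t /=; rewrite !in_itv/= => /andP[-> h]/=.
    apply: le_trans h _; have [->//|bij] := eqVneq (b i) (b j).
    by apply/ltW/sq_homo; [have := db i; lra|rewrite lt_neqAle bij bhomo].
  - by move=> k; exact: measurable_itv.
  - move=> k; apply/measurable_EFinP.
    have mG : measurable_fun (`]0%R, 1%R[%classic : set R) G.
      apply: open_continuous_measurable_fun; first exact: interval_open.
      by move=> t; rewrite inE/= in_itv/=; exact: cG.
    apply: measurable_funS mG => //.
    by move=> t kt; apply: sub1; rewrite -U; exists k.
  - move=> k t kt; rewrite lee_fin; apply: G0.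
    have /sub1 : `[mobius d, 1%R[%classic t by rewrite -U; exists k.
    by rewrite /= in_itv.
have cvg2 : (\int[lam]_(t in `[d, b k]) (G (mobius t) * (1 + t) ^- 2)%:E @[k --> \oo] -->
    \int[lam]_(t in `[d, +oo[) (G (mobius t) * (1 + t) ^- 2)%:E)%E.
  have U : \bigcup_k `[d, b k]%classic = `[d, +oo[%classic.
    apply/seteqP; split=> [t [k _]|t]; rewrite /= !in_itv/=.
      by move=> /andP[->].
    rewrite andbT => dt; exists (Num.truncn t).+1 => //=; rewrite in_itv/= dt/=.
    have := truncnS_gt t; rewrite /b -[_.+2%:R]natr1 => h; move: (_.+1%:R) h => u h.
    lra.
  rewrite -U; apply: (@ge0_nondecreasing_set_cvg_integral _ (measurableTypeR R) R
    (fun k => `[d, b k]%classic) (fun t => (G (mobius t) * (1 + t) ^- 2)%:E) lam).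
  - move=> i j ij; rewrite subsetEset => t /=; rewrite !in_itv/= => /andP[-> h]/=.
    by apply: le_trans h _; exact: bhomo.
  - by move=> k; exact: measurable_itv.
  - move=> k; apply/measurable_EFinP.
    suff mG : measurable_fun (`]0%R, +oo[%classic : set R)
        (fun t => G (mobius t) * (1 + t) ^- 2).
      apply: measurable_funS mG => //.
      by move=> t /=; rewrite !in_itv/= andbT => /andP[h _]; exact: lt_le_trans h.
    apply: open_continuous_measurable_fun; first exact: interval_open.
    move=> t; rewrite inE/= in_itv/= andbT => t0.
    apply: cvgM.
      by apply: continuous_comp; [exact: csq|apply: cG; exact: sq01].
    have h : (1 + x) ^+ 2 @[x --> t] --> (1 + t) ^+ 2.
      apply: (@cvg_comp _ _ _ (fun x => 1 + x) (fun x => x ^+ 2)).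
        by apply: cvgD; [exact: cvg_cst|exact: cvg_id].
      exact: exprn_continuous.
    by apply: cvgV h; rewrite expf_neq0// gt_eqF//; lra.
  - move=> k t /=; rewrite in_itv/= => /andP[dt _]; rewrite lee_fin.
    have t0 : 0 < t by lra.
    by rewrite mulr_ge0 ?G0 ?sq01// invr_ge0 exprn_ge0//; lra.
have EE : (fun k => \int[lam]_(t in `[mobius d, mobius (b k)]) (G t)%:E)%E =
  (fun k => \int[lam]_(t in `[d, b k]) (G (mobius t) * (1 + t) ^- 2)%:E)%E.
  by apply/funext => k; exact: E.
rewrite EE in cvg1.
by apply: (cvg_unique _ cvg1 cvg2).
Unshelve. all: by end_near. Qed.

End inversion.

(** * Integrals over rays *)

Section harmonicity_on_the_line.
Context {R : realType}.
Local Notation lam := (@lebesgue_measure R).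
Local Notation ray a := (`[a, +oo[%classic : set R).

Lemma integral_powR_ay (p a : R) : p < -1 -> 0 < a ->
  (\int[lam]_(x in ray a) (x `^ p)%:E = (- ((p + 1)^-1 * a `^ (p + 1)))%:E)%E.
Proof.
move=> p1 a0; have p10 : p + 1 < 0 by lra.
pose F (x : R) := (p + 1)^-1 * x `^ (p + 1).
rewrite (@ge0_continuous_FTC2y _ _ F _ 0)//.
- by rewrite sub0e.
- by move=> x _; exact: powR_ge0.
- apply: continuous_in_subspaceT => x; rewrite inE/= in_itv/= andbT => x1.
  by apply: powR_continuous_gt0; lra.
- rewrite -[X in _ --> X](mulr0 (p + 1)^-1); apply: cvgMr.
  exact: powR_cvgy0.
- move=> x x1; apply: derivableM => //.
  by apply: derivable_powR; rewrite in_itv/= andbT; lra.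
- apply: cvgMr; apply: cvg_at_right_filter; exact: powR_continuous_gt0.
- move=> x; rewrite in_itv/= andbT => x1; rewrite derive1E.
  have x0 : 0 < x by lra.
  have h := is_derive1_powR (p + 1) x0.
  apply: derive_val.
  apply: is_derive_eq.
  by rewrite addrK /GRing.scale/= mulrA mulVf ?mul1r// lt_eqF.
Qed.

Lemma integrable_powR_ay (p a : R) : p < -1 -> 0 < a ->
  lam.-integrable (ray a) (fun x => (x `^ p)%:E).
Proof.
move=> p1 a0; apply: ge0_integrable => //.
- by apply: measurable_funTS; exact: measurable_powR.
- by move=> x _; exact: powR_ge0.
- by rewrite integral_powR_ay// ltry.
Qed.

(** Dominated convergence along a sequence of rays that fills the half line. *)
Lemma integral_eq0_tails (g : R -> R) (C r : R) : 0 < r ->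
  lam.-integrable setT (fun t => (g t)%:E) -> (forall t, t <= 0 -> g t = 0) ->
  (forall e, 0 < e < 2^-1 -> `|\int[lam]_(t in ray e) g t| <= C * e `^ r) ->
  (\int[lam]_t (g t)%:E = 0)%E.
Proof.
move=> r0 gi g0 tail.
pose e k : R := k.+3%:R^-1.
have e0 k : 0 < e k < 2^-1.
  by rewrite invr_gt0 ltr0n/= ltf_pV2 ?posrE// ltr_nat.
have me k : measurable (ray (e k)) by exact: measurable_itv.
have ecvg : e k @[k --> \oo] --> (0 : R).
  apply/cvgrPdist_lt => x x0; have [k _ hk] := near_infty_natSinv_lt (PosNum x0).
  near=> m; rewrite sub0r normrN gtr0_norm ?invr_gt0//.
  have /hk /= : (k <= m.+2)%N.
    by near: m; exists k => // m /= km; rewrite (leq_trans km)// ltnW// ltnW.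
  by [].
have mg := measurable_int _ gi.
pose f k (t : R) := (\1_(ray (e k)) t * g t)%:E.
have [] := @dominated_convergence _ (measurableTypeR R) R lam setT measurableT
  f (fun t => (g t)%:E) (fun t => `|g t|%:E).
- move=> k; apply/measurable_EFinP; apply: measurable_funM.
    by apply: measurable_indic.
  exact/measurable_EFinP.
- exact: mg.
- apply: aeW => t _; have [t0|t0] := leP t 0.
    by rewrite /f g0//; under eq_fun do rewrite mulr0; exact: cvg_cst.
  apply: (@cvg_trans _ (cst (g t)%:E @ \oo)); last exact: cvg_cst.
  apply: near_eq_cvg; near=> k; rewrite /f/= indicE mem_set ?mul1r//= in_itv/= andbT.
  apply: ltW; near: k.
  have /cvgrPdist_lt/(_ _ t0) := ecvg; apply: filterS => k.
  by rewrite sub0r normrN gtr0_norm//; case/andP: (e0 k).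
- by have := integrable_abse gi; apply: eq_integrable.
- apply: aeW => t k _; rewrite lee_fin normrM indicE.
  by case: (t \in _); rewrite ?normr1 ?mul1r// normr0 mul0r.
move=> _ _ cv.
have cv0 : (\int[lam]_t f k t @[k --> \oo] --> (0 : \bar R))%E.
  have E k : (\int[lam]_t f k t = (\int[lam]_(t in ray (e k)) g t)%:E)%E.
    rewrite /Rintegral fineK; last first.
      apply: integrable_fin_num => //; apply: (integrableS measurableT) => //.
    rewrite [RHS]integral_mkcond; apply: eq_integral => t _.
    by rewrite /f patchE indicE; case: (t \in _); rewrite ?mul1r ?mul0r.
  under eq_fun do rewrite E.
  apply: cvg_EFin; first by near=> k.
  apply: norm_cvg0.
  apply: (@squeeze_cvgr _ _ _ _ (cst 0) (fun k => C * e k `^ r)).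
  - by near=> k; rewrite normr_ge0/=; exact: tail.
  - exact: cvg_cst.
  - rewrite -[X in _ --> X](mulr0 C); apply: cvgMr.
    have /cvg_at_rightP := @powR_cvg0 R r r0; apply; split=> // k.
    by case/andP: (e0 k).
exact: cvg_unique cv cv0.
Unshelve. all: by end_near. Qed.

Variable s : R.
Hypothesis s01 : 0 < s < 1.

Lemma pow_1Dr_le1 (p t : R) : p <= 0 -> 0 <= t -> (1 + t) `^ p <= 1.
Proof.
by move=> p0 t0; rewrite -[leRHS](powRr0 (1 + t)); apply: ler_powR => //; lra.
Qed.

Lemma pow_1Br_ge1 (p t : R) : p <= 0 -> 0 <= t < 1 -> 1 <= (1 - t) `^ p.
Proof.
move=> p0 /andP[t0 t1]; rewrite -[leLHS](powRr0 (1 - t)); apply: ger_powR => //.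
by apply/andP; split; lra.
Qed.

Lemma integral_ray_split (f : R -> R) (a b : R) : a <= b ->
  lam.-integrable (ray a) (fun t => (f t)%:E) ->
  \int[lam]_(t in ray a) f t =
  \int[lam]_(t in `[a, b[) f t + \int[lam]_(t in ray b) f t.
Proof.
move=> ab fi.
have U : ray a = `[a, b[%classic `|` ray b.
  apply/seteqP; split=> t /=; rewrite !in_itv/= !andbT.
    by move=> ->/=; case: (ltP t b) => ?; [left|right].
  by move=> [/andP[]//|bt]; exact: le_trans bt.
rewrite {1}U Rintegral_setU// -?U//.
by apply/disj_setPS => t /=; rewrite !in_itv/= andbT => -[/andP[_ tb] bt]; lra.
Qed.

Lemma Rintegral_bounded (f : R -> R) (a b c : R) : a <= b ->
  lam.-integrable `[a, b[ (fun t => (f t)%:E) ->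
  (forall t, a <= t < b -> `|f t| <= c) ->
  `|\int[lam]_(t in `[a, b[) f t| <= c * (b - a).
Proof.
move=> ab fi fc; apply: le_trans (le_normr_Rintegral _ fi) _ => //.
have mab : measurable (`[a, b[%classic : set R) by exact: measurable_itv.
have lab : lam `[a, b[ = (b - a)%:E.
  rewrite lebesgue_measure_itv/= lte_fin; case: ltP => // ba.
  by congr EFin; lra.
apply: (@le_trans _ _ (\int[lam]_(t in `[a, b[) cst c t)).
  apply: le_Rintegral => //.
  - exact: integrable_norm.
  - apply/integrableP; split; first exact/measurable_EFinP/measurable_cst.
    by under eq_integral do rewrite /=; rewrite integral_cst//= lab -EFinM ltry.
suff -> : \int[lam]_(t in `[a, b[) cst c t = c * (b - a) by [].
by transitivity (c * fine (lam `[a, b[)); [exact: Rintegral_cst|rewrite lab].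
Qed.

Lemma Rintegral_mobius (G H : R -> R) (e : R) : 0 < e < 1 ->
  (forall t, 0 < t < 1 -> 0 <= G t) ->
  (forall t, 0 < t < 1 -> {for t, continuous G}) ->
  (forall u, 0 < u -> G (mobius u) * (1 + u) ^- 2 = H u) ->
  (\int[lam]_(t in `[e, 1%R[) (G t)%:E =
  \int[lam]_(t in ray (e / (1 - e))%R) (H t)%:E)%E.
Proof.
move=> /andP[e0 e1] G0 cG GH.
have d0 : 0 < e / (1 - e) by rewrite divr_gt0//; lra.
have ed : mobius (e / (1 - e)) = e.
  by rewrite /mobius; field; apply/andP; split; rewrite gt_eqF//; lra.
rewrite -[in LHS]ed ge0_integral_mobius//; apply: eq_integral => t.
by rewrite inE/= in_itv/= andbT => dt; rewrite GH//; exact: lt_le_trans dt.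
Qed.

Lemma mobius_powR (r u : R) : 0 < u -> mobius u `^ r = u `^ r * (1 + u) `^ (- r).
Proof.
move=> u0; rewrite /mobius powRM ?invr_ge0 ?ltW ?addr_gt0//.
by rewrite -powR_inv1 ?ltW ?addr_gt0// -powRrM mulN1r.
Qed.

Lemma oneB_mobius (u : R) : 0 < u -> 1 - mobius u = (1 + u) `^ (- 1).
Proof.
move=> u0; rewrite mobiusE; last lra.
by rewrite powR_inv1; [ring|lra].
Qed.

End harmonicity_on_the_line.

(** * First and second differences of t_+^(s-1) at 1 *)

Section half_line_identities.
Context {R : realType}.
Local Notation lam := (@lebesgue_measure R).
Local Notation ray a := (`[a, +oo[%classic : set R).
Variable s : R.
Hypothesis s01 : 0 < s < 1.
Let s0 : 0 < s. Proof. by case/andP: s01. Qed.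
Let s1 : s < 1. Proof. by case/andP: s01. Qed.

(** The differences of the weight at the point 1 with step [t], multiplied by the
    kernels [t `^ (-2s)] and [t `^ (-1-2s)]. As [t > 0] is intended, [1 + t] is
    positive and its truncation is dropped. *)
Definition first_diff (t : R) : R := (pospow (1 - t) (s - 1) - (1 + t) `^ (s - 1)) * t `^ (- (2 * s)).
Definition second_diff (t : R) : R :=
  (2 - pospow (1 - t) (s - 1) - (1 + t) `^ (s - 1)) * t `^ (- 1 - 2 * s).

Lemma bernoulli_le (P t : R) : 0 < P < 1 -> -1 < t -> (1 + t) `^ P <= 1 + P * t.
Proof.
move=> /andP[P0 P1] t1.
have := @conjugate_powR R ((1 + t) `^ P) 1 P^-1 (1 - P)^-1.
rewrite mulr1 powR1 !invrK -powRrM mulfV ?gt_eqF// powRr1; last lra.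
move=> H; apply: le_trans (H _ _ _ _ _) _; rewrite ?powR_ge0 ?invr_gt0//; try lra.
Qed.

Lemma measurable_first_diff : measurable_fun setT first_diff.
Proof.
apply: measurable_funM; last exact: measurable_powR.
apply: measurable_funB.
  apply: (measurableT_comp (measurable_pospow _)).
  by apply: measurable_funB => //; exact: measurable_id.
apply: (measurableT_comp (measurable_powR _)).
by apply: measurable_funD => //; exact: measurable_id.
Qed.

Lemma measurable_second_diff : measurable_fun setT second_diff.
Proof.
apply: measurable_funM; last exact: measurable_powR.
apply: measurable_funB; first apply: measurable_funB => //.
  apply: (measurableT_comp (measurable_pospow _)).
  by apply: measurable_funB => //; exact: measurable_id.
apply: (measurableT_comp (measurable_powR _)).
by apply: measurable_funD => //; exact: measurable_id.
Qed.

Let g01 r (x : R) : R := \1_(`]0, 1[%classic : set R) x * x `^ r.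
Let k1y r (x : R) : R := \1_(`[1, +oo[%classic : set R) x * x `^ r.

(** The four terms bound the differences for small [t], for bounded [t], for
    large [t], and near the singularity [t = 1]. *)
Definition diff_majorant (t : R) : R :=
  16 * (g01 (1 - 2 * s) t + (g01 0 t + (k1y (- 1 - s) t + g01 (s - 1) (-1 * t + 1)))).

Lemma integrable_diff_majorant : lam.-integrable setT (fun t => (diff_majorant t)%:E).
Proof.
have N1 : -1 != 0 :> R by rewrite oppr_eq0.
have i1 : lam.-integrable setT (fun t => (g01 (s - 1) t)%:E).
  by apply: integrable_powR_01; move: s0; lra.
have [i2 _] := lam_affine 1 N1 i1.
apply: integrableRZ => //; apply: integrableRD => //.
  by apply: integrable_powR_01; move: s1; lra.
apply: integrableRD => //; first by apply: integrable_powR_01; lra.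
by apply: integrableRD => //; apply: integrable_powR_1y; move: s0; lra.
Qed.

Let g01_ge0 r x : 0 <= g01 r x. Proof. by rewrite mulr_ge0 ?powR_ge0. Qed.
Let k1y_ge0 r x : 0 <= k1y r x. Proof. by rewrite mulr_ge0 ?powR_ge0. Qed.
Let g01E r x : 0 < x < 1 -> g01 r x = x `^ r.
Proof. by move=> x01; rewrite /g01 indicE mem_set ?mul1r//= in_itv. Qed.
Let k1yE r x : 1 <= x -> k1y r x = x `^ r.
Proof. by move=> x01; rewrite /k1y indicE mem_set ?mul1r//= in_itv/= x01. Qed.

(** With [x = (1-t)^(1-s)] and [y = (1+t)^(1-s)], Bernoulli's inequality bounds
    [x] and [y], and [x y = (1-t^2)^(1-s)] is within [t^2] of 1: this replaces
    Taylor's formula. *)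
Lemma diffs_near0 (t : R) : 0 < t < 2^-1 ->
  `|(1 - t) `^ (s - 1) - (1 + t) `^ (s - 1)| <= 4 * t /\
  `|2 - (1 - t) `^ (s - 1) - (1 + t) `^ (s - 1)| <= 4 * t ^+ 2.
Proof.
move=> /andP[t0 t12].
have P01 : 0 < 1 - s < 1 by move: s0 s1; lra.
pose x := (1 - t) `^ (1 - s); pose y := (1 + t) `^ (1 - s).
have x0 : 0 < x by rewrite powR_gt0; lra.
have y0 : 0 < y by rewrite powR_gt0; lra.
have -> : (1 - t) `^ (s - 1) = x^-1 by rewrite -powRN opprB.
have -> : (1 + t) `^ (s - 1) = y^-1 by rewrite -powRN opprB.
have xle : x <= 1 - (1 - s) * t.
  by rewrite -mulrN; apply: bernoulli_le => //; lra.
have yle : y <= 1 + (1 - s) * t by apply: bernoulli_le => //; lra.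
have xge : 1 - t <= x.
  by apply: ger1_powR; [apply/andP; split|case/andP: P01 => _ /ltW]; lra.
have y1 : 1 <= y.
  by rewrite -[leLHS](powRr0 (1 + t)); apply: ler_powR; [lra|case/andP: P01 => /ltW].
have st : 0 < (1 - s) * t < t.
  by case/andP: P01 => P0 P1; rewrite mulr_gt0//= gtr_pMl.
have xyE : x * y = (1 - t ^+ 2) `^ (1 - s).
  by rewrite -powRM; [congr (_ `^ _); ring|lra|lra].
have t2 : 0 < t ^+ 2 < 4^-1.
  rewrite exprn_gt0//= expr2 (_ : 4^-1 = 2^-1 * 2^-1 :> R); last by field.
  by rewrite ltr_pM// ltW.
have xyge : 1 - t ^+ 2 <= x * y.
  rewrite xyE; apply: ger1_powR; [apply/andP; split|case/andP: P01 => _ /ltW]; lra.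
have xyle : x * y <= 1.
  rewrite xyE -[leRHS](powRr0 (1 - t ^+ 2)); apply: ger_powR; last by case/andP: P01 => /ltW.
  by apply/andP; split; lra.
have xy0 : 0 < x * y by rewrite mulr_gt0.
split.
  have -> : x^-1 - y^-1 = (y - x) / (x * y) by field; rewrite !gt_eqF.
  rewrite normrM normfV (gtr0_norm xy0) ler_pdivrMr// ger0_norm; last by lra.
  by nra.
have -> : 2 - x^-1 - y^-1 = - ((x + y - 2 * (x * y)) / (x * y)).
  by field; rewrite !gt_eqF.
rewrite normrN normrM normfV (gtr0_norm xy0) ler_pdivrMr// ger0_norm; last by nra.
by nra.
Qed.

Lemma powR_half_le (r m t : R) : 2^-1 <= t -> 0 <= r -> r <= m -> t `^ (- r) <= 2 `^ m.
Proof.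
move=> t2 r0 rm; have t0 : 0 < t by lra.
apply: (@le_trans _ _ (2 `^ r)); last by apply: ler_powR => //; lra.
have -> : t `^ (- r) = (t^-1) `^ r by rewrite -powR_inv1 ?(ltW t0)// -powRrM mulN1r.
apply: ge0_ler_powR => //; rewrite ?nnegrE ?invr_ge0 ?(ltW t0)//.
by rewrite -[leRHS]invrK lef_pV2 ?posrE ?invr_gt0.
Qed.

Lemma first_diff_le (t : R) : 0 < t -> `|first_diff t| <= diff_majorant t.
Proof.
move=> t0; rewrite /first_diff normrM (ger0_norm (powR_ge0 _ _)) /diff_majorant.
have [t12|t12] := ltP t 2^-1.
  have [h _] : _ := diffs_near0 (ltac:(by rewrite t0 t12) : 0 < t < 2^-1).
  apply: (@le_trans _ _ (16 * g01 (1 - 2 * s) t)); last first.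
    by rewrite ler_wpM2l// lerDl !addr_ge0.
  rewrite g01E; last by lra.
  rewrite pospowE; last by lra.
  apply: (@le_trans _ _ (4 * t * t `^ (- (2 * s)))); first by rewrite ler_wpM2r ?powR_ge0.
  rewrite powRB ?(gt_eqF t0) ?implybT// powRr1 ?(ltW t0)// -powRN.
  by have := mulr_ge0 (ltW t0) (powR_ge0 t (- (2 * s))); lra.
have [t1|t1] := ltP t 1.
  apply: (@le_trans _ _ (16 * (g01 0 t + g01 (s - 1) (-1 * t + 1)))); last first.
    by have := g01_ge0 (1 - 2 * s) t; have := k1y_ge0 (- 1 - s) t; lra.
  rewrite !g01E ?powRr0; try lra.
  rewrite (_ : -1 * t + 1 = 1 - t); last by ring.
  rewrite pospowE; last lra.
  have h1 : 0 <= (1 + t) `^ (s - 1) <= 1.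
    by rewrite powR_ge0/=; apply: pow_1Dr_le1; [move: s1|]; lra.
  have h2 : t `^ (- (2 * s)) <= 4.
    rewrite (_ : 4 = 2 `^ 2%:R); last by rewrite powR_mulrn//; ring.
    by apply: powR_half_le => //; move: s0 s1; lra.
  rewrite mulrC; apply: ler_pM; rewrite ?powR_ge0//; first lra.
  have := powR_ge0 (1 - t) (s - 1); case/andP: h1 => ? ? ?.
  by rewrite ler_norml; apply/andP; split; lra.
apply: (@le_trans _ _ (16 * k1y (- 1 - s) t)); last first.
  have := g01_ge0 (1 - 2 * s) t; have := g01_ge0 0 t.
  by have := g01_ge0 (s - 1) (-1 * t + 1); lra.
rewrite k1yE// pospow_le0; last lra.
rewrite sub0r normrN ger0_norm ?powR_ge0//.
apply: (@le_trans _ _ (t `^ (s - 1) * t `^ (- (2 * s)))).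
  rewrite ler_wpM2r ?powR_ge0// -[s - 1]opprB !powRN lef_pV2 ?posrE ?powR_gt0//; try lra.
  by apply: ge0_ler_powR; rewrite ?nnegrE; move: s1; lra.
rewrite -powRD ?(gt_eqF t0) ?implybT//.
rewrite (_ : s - 1 + - (2 * s) = - 1 - s); last by ring.
by have := powR_ge0 t (- 1 - s); lra.
Qed.

Lemma second_diff_le (t : R) : 0 < t -> `|second_diff t| <= diff_majorant t.
Proof.
move=> t0; rewrite /second_diff normrM (ger0_norm (powR_ge0 t _)) /diff_majorant.
have h1 : 0 <= (1 + t) `^ (s - 1) <= 1.
  by rewrite powR_ge0/=; apply: pow_1Dr_le1; [move: s1|]; lra.
have [t12|t12] := ltP t 2^-1.
  have [_ h] : _ := diffs_near0 (ltac:(by rewrite t0 t12) : 0 < t < 2^-1).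
  apply: (@le_trans _ _ (16 * g01 (1 - 2 * s) t)); last first.
    by rewrite ler_wpM2l// lerDl !addr_ge0.
  rewrite g01E; last by lra.
  rewrite pospowE; last by lra.
  apply: (@le_trans _ _ (4 * t ^+ 2 * t `^ (- 1 - 2 * s))); first by rewrite ler_wpM2r ?powR_ge0.
  rewrite -mulrA -powR_mulrn ?(ltW t0)// -powRD ?(gt_eqF t0) ?implybT//.
  rewrite (_ : 2 + (- 1 - 2 * s) = 1 - 2 * s); last by ring.
  by have := powR_ge0 t (1 - 2 * s); lra.
have [t1|t1] := ltP t 1.
  apply: (@le_trans _ _ (16 * (g01 0 t + g01 (s - 1) (-1 * t + 1)))); last first.
    by have := g01_ge0 (1 - 2 * s) t; have := k1y_ge0 (- 1 - s) t; lra.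
  rewrite !g01E ?powRr0; try lra.
  rewrite (_ : -1 * t + 1 = 1 - t); last by ring.
  rewrite pospowE; last lra.
  have h2 : t `^ (- 1 - 2 * s) <= 8.
    rewrite (_ : - 1 - 2 * s = - (1 + 2 * s)); last by ring.
    rewrite (_ : 8 = 2 `^ 3%:R); last by rewrite powR_mulrn//; ring.
    by apply: powR_half_le => //; move: s0 s1; lra.
  rewrite (_ : 16 * _ = (2 * (1 + (1 - t) `^ (s - 1))) * 8); last by ring.
  apply: ler_pM; rewrite ?powR_ge0//.
  have := powR_ge0 (1 - t) (s - 1); case/andP: h1 => ? ? ?.
  by rewrite ler_norml; apply/andP; split; lra.
apply: (@le_trans _ _ (16 * k1y (- 1 - s) t)); last first.
  have := g01_ge0 (1 - 2 * s) t; have := g01_ge0 0 t.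
  by have := g01_ge0 (s - 1) (-1 * t + 1); lra.
rewrite k1yE// pospow_le0; last lra.
apply: ler_pM; rewrite ?powR_ge0//.
  by case/andP: h1 => ? ?; rewrite ler_norml; apply/andP; split; lra.
by apply: ler_powR => //; move: s0; lra.
Qed.

Lemma ray_gt0 (a t : R) : 0 < a -> ray a t -> 0 < t.
Proof. by move=> a0 /=; rewrite in_itv/= andbT; exact: lt_le_trans. Qed.

Let uB (t : R) := (1 + t) `^ (s - 1) * t `^ (- (2 * s)).

Lemma measurable_1D_powR (r : R) : measurable_fun setT (fun t : R => (1 + t) `^ r).
Proof.
apply: (measurableT_comp (measurable_powR _)).
by apply: measurable_funD => //; exact: measurable_id.
Qed.

Lemma uB_integrable (a : R) : 0 < a -> lam.-integrable (ray a) (fun t => (uB t)%:E).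
Proof.
move=> a0; apply: (@le_integrableR _ _ _ lam _ _ _ (fun t => t `^ (- 1 - s))) => //.
- apply: measurable_funTS; apply: measurable_funM; last exact: measurable_powR.
  exact: measurable_1D_powR.
- move=> t /(ray_gt0 a0) t0; rewrite ger0_norm ?mulr_ge0 ?powR_ge0// /uB.
  apply: (@le_trans _ _ (t `^ (s - 1) * t `^ (- (2 * s)))).
    rewrite ler_wpM2r ?powR_ge0// -[s - 1]opprB !powRN lef_pV2 ?posrE ?powR_gt0//; try lra.
    by apply: ge0_ler_powR; rewrite ?nnegrE; move: s1; lra.
  rewrite -powRD ?(gt_eqF t0) ?implybT//.
  by rewrite (_ : s - 1 + - (2 * s) = - 1 - s)//; ring.
- by apply: integrable_powR_ay => //; move: s0; lra.
Qed.

Lemma cont_1B_powR (r t : R) : t < 1 -> {for t, continuous (fun x : R => (1 - x) `^ r)}.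
Proof.
move=> t1; apply: (@continuous_comp _ _ _ (fun x : R => 1 - x) (fun y => y `^ r)).
  by apply: cvgB; [exact: cvg_cst|exact: cvg_id].
by apply: powR_continuous_gt0; lra.
Qed.

Lemma cont_1D_powR (r t : R) : -1 < t -> {for t, continuous (fun x : R => (1 + x) `^ r)}.
Proof.
move=> t1; apply: (@continuous_comp _ _ _ (fun x : R => 1 + x) (fun y => y `^ r)).
  by apply: cvgD; [exact: cvg_cst|exact: cvg_id].
by apply: powR_continuous_gt0; lra.
Qed.

Lemma gap_bound (e : R) : 0 < e < 2^-1 ->
  e <= e / (1 - e) /\ e `^ (- (2 * s)) * (e / (1 - e) - e) <= 2 * e `^ (2 - 2 * s).
Proof.
move=> /andP[e0 e2]; have e1 : 0 < 1 - e by lra.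
have dE : e / (1 - e) - e = e ^+ 2 / (1 - e) by field; rewrite gt_eqF.
split; first by rewrite ler_pdivlMr// ler_piMr ?ltW//; lra.
rewrite dE powRD; last by rewrite (gt_eqF e0) implybT.
rewrite powR_mulrn ?(ltW e0)// mulrC mulrA ler_wpM2r ?powR_ge0//.
by rewrite ler_pdivrMr//; have := sqr_ge0 e; nra.
Qed.

(** The substitution [t = u / (1 + u)] turns [(1-t)^(s-1) t^(-2s) dt] on ]e, 1[
    into [(1+u)^(s-1) u^(-2s) du] on ]d, +oo[ with [d = e / (1 - e)], that is,
    into the function subtracted from it. Hence the integral over the ray is,
    up to sign, the integral of this function over the interval from [e] to [d],
    of length of order [e^2]. *)
Lemma first_diff_tail (e : R) : 0 < e < 2^-1 ->
  `|\int[lam]_(t in ray e) first_diff t| <= 2 * e `^ (2 - 2 * s).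
Proof.
move=> e02; have /andP[e0 e2] := e02; pose d := e / (1 - e).
have d0 : 0 < d by rewrite divr_gt0//; lra.
have [ed gap] := gap_bound e02.
pose c (t : R) := pospow (1 - t) (s - 1) * t `^ (- (2 * s)).
have cE : (\int[lam]_(t in ray e) (c t)%:E = \int[lam]_(t in ray d) (uB t)%:E)%E.
  rewrite -(@Rintegral_mobius R (fun t => (1 - t) `^ (s - 1) * t `^ (- (2 * s))) uB e).
  - rewrite integral_mkcond [RHS]integral_mkcond; apply: eq_integral => t _.
    rewrite !patchE !mem_setE !in_itv/= andbT; case: ifPn => //= et.
    case: (ltP t 1) => t1; first by rewrite /c pospowE//; lra.
    by rewrite /c pospow_le0 ?mul0r//; lra.
  - by apply/andP; split; lra.
  - by move=> t _; rewrite mulr_ge0 ?powR_ge0.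
  - move=> t /andP[t0 t1]; apply: cvgM; first exact: cont_1B_powR.
    exact: powR_continuous_gt0.
  - move=> u u0; rewrite oneB_mobius// mobius_powR// /uB.
    have u1 : 0 < 1 + u by lra.
    have u1n : 1 + u != 0 by rewrite gt_eqF.
    rewrite -powR_invn ?(ltW u1)// -powRrM opprK.
    rewrite (_ : _ * _ * _ = (1 + u) `^ (-1 * (s - 1)) * (1 + u) `^ (2 * s) *
      (1 + u) `^ (- 2%:R) * u `^ (- (2 * s))); last by ring.
    rewrite -!powRD ?u1n ?implybT//; congr (_ `^ _ * _); ring.
have ui := uB_integrable e0; have ui' := uB_integrable d0.
have ci : lam.-integrable (ray e) (fun t => (c t)%:E).
  apply: ge0_integrable => //.
  - apply: measurable_funTS; apply: measurable_funM; last exact: measurable_powR.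
    apply: (measurableT_comp (measurable_pospow _)).
    by apply: measurable_funB => //; exact: measurable_id.
  - by move=> t _; rewrite mulr_ge0 ?pospow_ge0 ?powR_ge0.
  - by rewrite cE; exact: integrable_lty.
have -> : \int[lam]_(t in ray e) first_diff t = - \int[lam]_(t in `[e, d[) uB t.
  transitivity (\int[lam]_(t in ray e) (c t - uB t)).
    by apply: eq_Rintegral => t _; rewrite /first_diff mulrBl.
  rewrite RintegralB//.
  have -> : \int[lam]_(t in ray e) c t = \int[lam]_(t in ray d) uB t by rewrite /Rintegral cE.
  by rewrite (integral_ray_split ed ui); ring.
rewrite normrN; apply: le_trans gap.
apply: Rintegral_bounded => //.
- apply: integrableS ui => //; exact: subset_itvl.
- move=> t /andP[et td]; have t0 : 0 < t by exact: lt_le_trans et.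
  rewrite ger0_norm ?mulr_ge0 ?powR_ge0//.
  rewrite -[leRHS]mul1r; apply: ler_pM; rewrite ?powR_ge0//.
    by apply: pow_1Dr_le1; [move: s1|]; lra.
  rewrite !powRN lef_pV2 ?posrE ?powR_gt0//.
  by apply: ge0_ler_powR; rewrite ?nnegrE ?(ltW t0) ?(ltW e0)//; move: s0; lra.
Qed.

End half_line_identities.

(** * Second differences: a primitive *)

Section second_difference_tail.
Context {R : realType}.
Local Notation lam := (@lebesgue_measure R).
Local Notation ray a := (`[a, +oo[%classic : set R).
Variable s : R.
Hypothesis s01 : 0 < s < 1.
Let s0 : 0 < s. Proof. by case/andP: s01. Qed.
Let s1 : s < 1. Proof. by case/andP: s01. Qed.

(* [hA1] is the image of [((1-t)^(s-1) - 1) t^(-1-2s)] under t = u / (1 + u),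
   [hA2] comes from the other half [1 - (1+t)^(s-1)] of the second difference,
   and [FA] is, up to sign, a primitive of their difference. *)
Let hA2 (t : R) := (1 - (1 + t) `^ (s - 1)) * t `^ (- 1 - 2 * s).
Let hA1 (t : R) := ((1 + t) `^ s - (1 + t) `^ (2 * s - 1)) * t `^ (- 1 - 2 * s).
Let FA (t : R) := (2 * s)^-1 * (((1 + t) `^ s - 1) ^+ 2 * t `^ (- (2 * s))).

Lemma hA2_integrable (a : R) : 0 < a -> lam.-integrable (ray a) (fun t => (hA2 t)%:E).
Proof.
move=> a0; apply: (@le_integrableR _ _ _ lam _ _ _ (fun t => t `^ (- 1 - 2 * s))) => //.
- apply: measurable_funTS; apply: measurable_funM; last exact: measurable_powR.
  by apply: measurable_funB => //; exact: measurable_1D_powR.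
- move=> t /(ray_gt0 a0) t0.
  have h : (1 + t) `^ (s - 1) <= 1 by apply: pow_1Dr_le1; [move: s1|]; lra.
  have h' := powR_ge0 (1 + t) (s - 1).
  rewrite normrM (ger0_norm (powR_ge0 t _)) ler_piMl ?powR_ge0//.
  by rewrite ler_norml; apply/andP; split; lra.
- by apply: integrable_powR_ay => //; move: s0; lra.
Qed.

Lemma hA1_ge0 (t : R) : 0 < t -> 0 <= hA1 t.
Proof.
move=> t0; rewrite mulr_ge0 ?powR_ge0// subr_ge0.
by apply: ler_powR; [|move: s1]; lra.
Qed.

Lemma hA1_integrable (a : R) : 0 < a -> lam.-integrable (ray a) (fun t => (hA1 t)%:E).
Proof.
move=> a0; apply: (@le_integrableR _ _ _ lam _ _ _ 
    (fun t => (1 + a^-1) `^ s * t `^ (- 1 - s))) => //.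
- apply: measurable_funTS; apply: measurable_funM; last exact: measurable_powR.
  by apply: measurable_funB; exact: measurable_1D_powR.
- move=> t ta; have t0 := ray_gt0 a0 ta.
  rewrite ger0_norm ?hA1_ge0//.
  apply: (@le_trans _ _ ((1 + t) `^ s * t `^ (- 1 - 2 * s))).
    by rewrite ler_wpM2r ?powR_ge0// gerBl powR_ge0.
  rewrite (_ : - 1 - s = s + (- 1 - 2 * s)); last by ring.
  rewrite (@powRD _ t s) ?(gt_eqF t0) ?implybT// mulrA ler_wpM2r ?powR_ge0//.
  have aV0 : 0 < a^-1 by rewrite invr_gt0.
  rewrite -powRM ?(ltW t0)//; last lra.
  apply: ge0_ler_powR; rewrite ?nnegrE ?(ltW s0)//.
  + by lra.
  + by rewrite mulr_ge0 ?(ltW t0)//; lra.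
  + rewrite mulrDl mul1r addrC lerD2l mulrC ler_pdivlMr// mul1r.
    by move: ta; rewrite /= in_itv/= andbT.
- by apply: integrableRZ => //; apply: integrable_powR_ay => //; move: s0; lra.
Qed.

(** The key computation: with [g = (1+t)^s - 1], the function [hA1 - hA2] equals
    [g (1 - (1+t)^(s-1)) t^(-1-2s)], and [t g' - s g = s (1 - (1+t)^(s-1))] makes
    it the derivative of [g^2 t^(-2s) / (2s)]. *)
Lemma is_derive_FA (t : R) : 0 < t -> is_derive t (1 : R) (fun x => - FA x) (hA2 t - hA1 t).
Proof.
move=> t0; have t1 : 0 < 1 + t by lra.
have h0 := is_deriveD (is_derive_cst (1 : R) t (1 : R)) (is_derive_id t (1 : R)).
have h0' : is_derive t (1 : R) (fun x : R => 1 + x) 1.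
  by apply: (is_derive_eq h0); rewrite add0r.
have h1 : is_derive t (1 : R) (fun x : R => (1 + x) `^ s) (s * (1 + t) `^ (s - 1)).
  have := @is_derive1_comp R (@powR R ^~ s) (fun x => 1 + x) t _ _
    (is_derive1_powR s t1) h0'.
  by rewrite mulr1.
have h2 : is_derive t (1 : R) (fun x : R => (1 + x) `^ s - 1) (s * (1 + t) `^ (s - 1)).
  have h := is_deriveB h1 (is_derive_cst (1 : R) t (1 : R)).
  by apply: (is_derive_eq h); rewrite subr0.
have h3 := is_deriveM (is_deriveM h2 h2) (@is_derive1_powR R (- (2 * s)) t t0).
have h4 := is_deriveM (is_derive_cst (- (2 * s)^-1) t (1 : R)) h3.
have -> : (fun x => - FA x) = (fun x => - (2 * s)^-1 *
    ((((1 + x) `^ s - 1) * ((1 + x) `^ s - 1)) * x `^ (- (2 * s)))).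
  by apply/funext => x; rewrite /FA expr2 mulNr.
apply: (is_derive_eq h4); rewrite !mulrfctE /GRing.scale/= mulr0 addr0.
have sn : s != 0 by rewrite gt_eqF.
have e1 : t `^ (- (2 * s)) = t * t `^ (- 1 - 2 * s).
  rewrite -{2}(powRr1 (ltW t0)) -powRD ?(gt_eqF t0) ?implybT//.
  by congr (_ `^ _); ring.
have e2 : t `^ (- (2 * s) - 1) = t `^ (- 1 - 2 * s) by congr (_ `^ _); ring.
have e3 : (1 + t) `^ s = (1 + t) * (1 + t) `^ (s - 1).
  rewrite -{2}(powRr1 (ltW t1)) -powRD ?(gt_eqF t1) ?implybT//.
  by congr (_ `^ _); ring.
have e4 : (1 + t) `^ (2 * s - 1) = (1 + t) `^ s * (1 + t) `^ (s - 1).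
  rewrite -powRD ?(gt_eqF t1) ?implybT//.
  by congr (_ `^ _); ring.
rewrite /hA2 /hA1 e4 e1 e2 e3; set X := t `^ _; set Y := (1 + t) `^ _.
by field.
Qed.

Lemma cvg_FA : - FA x @[x --> +oo] --> - (2 * s)^-1.
Proof.
apply: cvgN; rewrite -[X in _ --> X]mulr1; apply: cvgMr.
apply: (@cvg_trans _ (((1 + x `^ (-1)) `^ s - x `^ (- s)) ^+ 2 @[x --> +oo])).
  apply: near_eq_cvg; near=> x.
  have x0 : 0 < x by near: x; exact: nbhs_pinfty_gt.
  have xn : x != 0 by rewrite gt_eqF.
  rewrite powR_inv1 ?(ltW x0)//.
  have -> : 1 + x^-1 = (1 + x) * x^-1 by field.
  rewrite powRM; [|lra|by rewrite invr_ge0 ltW].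
  rewrite -powR_inv1 ?(ltW x0)// -powRrM mulN1r.
  have -> : x `^ (- (2 * s)) = x `^ (- s) * x `^ (- s).
    by rewrite -powRD ?xn ?implybT//; congr (_ `^ _); ring.
  ring.
have h1 : (1 + x `^ (-1)) `^ s @[x --> +oo] --> ((1 + 0) `^ s : R).
  apply: (@cvg_comp _ _ _ (fun x => x `^ (-1)) (fun y => (1 + y) `^ s)).
    by apply: powR_cvgy0; rewrite oppr_lt0.
  by apply: cont_1D_powR; lra.
have h2 : x `^ (- s) @[x --> +oo] --> (0 : R) by apply: powR_cvgy0; rewrite oppr_lt0.
have h3 : (1 + x `^ (-1)) `^ s - x `^ (- s) @[x --> +oo] --> (1 : R).
  rewrite [X in _ --> X](_ : 1 = (1 + 0) `^ s - 0); last by rewrite addr0 powR1 subr0.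
  exact: cvgB h1 h2.
have h4 : ((1 + x `^ (-1)) `^ s - x `^ (- s)) * ((1 + x `^ (-1)) `^ s - x `^ (- s))
    @[x --> +oo] --> (1 * 1 : R) by apply: cvgM.
rewrite mulr1 in h4; apply: cvg_trans h4; apply: near_eq_cvg; near=> x.
by rewrite expr2.
Unshelve. all: by end_near. Qed.

Lemma FA_le (d : R) : 0 < d -> 0 <= FA d <= (2 * s)^-1 * d `^ (2 - 2 * s).
Proof.
move=> d0; have sV : 0 < (2 * s)^-1 by rewrite invr_gt0; move: s0; lra.
apply/andP; split; first exact: mulr_ge0 (ltW sV) (mulr_ge0 (sqr_ge0 _) (powR_ge0 _ _)).
rewrite /FA ler_pM2l//.
rewrite (@powRD _ d 2%:R) ?(gt_eqF d0) ?implybT// powR_mulrn ?(ltW d0)//.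
rewrite ler_wpM2r ?powR_ge0//.
have h1 : 1 <= (1 + d) `^ s.
  by rewrite -[leLHS](powRr0 (1 + d)); apply: ler_powR; [|move: s0]; lra.
have h2 : (1 + d) `^ s <= 1 + d.
  by apply: ler1_powR; [|move: s1]; lra.
by rewrite lerXn2r ?nnegrE; lra.
Qed.

Lemma integral_hA21 (d : R) : 0 < d ->
  \int[lam]_(t in ray d) (hA2 t - hA1 t) = FA d - (2 * s)^-1.
Proof.
move=> d0; rewrite /Rintegral.
rewrite (@le0_continuous_FTC2y _ _ (fun x => - FA x) _ (- (2 * s)^-1))//.
- by rewrite -EFinB/=; ring.
- move=> t dt; have t0 : 0 < t by lra.
  have u1 : 0 < 1 + t by lra.
  rewrite (_ : _ - _ = - (((1 + t) `^ s - 1) * (1 - (1 + t) `^ (s - 1)) * t `^ (- 1 - 2 * s))).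
    rewrite oppr_le0 !mulr_ge0 ?powR_ge0// subr_ge0.
      by rewrite -[leLHS](powRr0 (1 + t)); apply: ler_powR; [|move: s0]; lra.
    by apply: pow_1Dr_le1; [move: s1|]; lra.
  rewrite /hA2 /hA1 (_ : 2 * s - 1 = s + (s - 1)); last by ring.
  by rewrite (@powRD _ (1 + t) s (s - 1)) ?(gt_eqF u1) ?implybT//; ring.
- apply: continuous_in_subspaceT => t; rewrite inE/= in_itv/= andbT => dt.
  have t0 : 0 < t by lra.
  have cp r : {for t, continuous (fun x : R => x `^ r)} by exact: powR_continuous_gt0.
  have c1 r : {for t, continuous (fun x : R => (1 + x) `^ r)} by apply: cont_1D_powR; lra.
  apply: cvgB; apply: cvgM; try exact: cp; apply: cvgB; try exact: c1; exact: cvg_cst.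
- exact: cvg_FA.
- apply: (@cvg_at_right_filter _ _ (fun x => - FA x)).
  have [h _] := is_derive_FA d0.
  by have /derivable1_diffP/differentiable_continuous := h.
- by move=> t dt; have [] := @is_derive_FA t (lt_trans d0 dt).
- move=> t; rewrite in_itv/= andbT => dt; rewrite derive1E.
  by have h := @is_derive_FA t (lt_trans d0 dt); exact: derive_val.
Qed.

(** Split the second difference into its parts below and above 1. The part below
    is carried by t = u / (1 + u) to the ray starting at [d = e / (1 - e)], where
    the difference [hA2 - hA1] has the primitive [- FA]; the value [1 / (2s)] of
    [FA] at infinity cancels the integral of [t^(-1-2s)] over [[1, +oo[]. There
    remain [FA d] and the integral of [hA2] over the interval from [e] to [d],
    both of order [e^(2-2s)]. *)
Lemma second_diff_tail (e : R) : 0 < e < 2^-1 ->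
  `|\int[lam]_(t in ray e) second_diff s t| <= (2 + 2 / s) * e `^ (2 - 2 * s).
Proof.
move=> e02; have /andP[e0 e2] := e02; pose d := e / (1 - e).
have d0 : 0 < d by rewrite divr_gt0//; lra.
have [ed gap] := gap_bound s e02.
pose al (t : R) := if t < 1 then ((1 - t) `^ (s - 1) - 1) * t `^ (- 1 - 2 * s) else 0.
pose be (t : R) := if t < 1 then 0 else t `^ (- 1 - 2 * s).
(* below 1: the substitution t = u / (1 + u) *)
have alE : (\int[lam]_(t in ray e) (al t)%:E = \int[lam]_(t in ray d) (hA1 t)%:E)%E.
  rewrite -(@Rintegral_mobius R (fun t => ((1 - t) `^ (s - 1) - 1) * t `^ (- 1 - 2 * s)) hA1 e).
  - rewrite integral_mkcond [RHS]integral_mkcond; apply: eq_integral => t _.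
    rewrite !patchE !mem_setE !in_itv/= andbT; case: ifPn => //= et.
    by rewrite /al; case: (ltP t 1).
  - by apply/andP; split; lra.
  - move=> t t01; rewrite mulr_ge0 ?powR_ge0// subr_ge0; apply: pow_1Br_ge1.
      by move: s1; lra.
    by case/andP: t01 => /ltW -> ->.
  - move=> t /andP[t0 t1]; apply: cvgM; last exact: powR_continuous_gt0.
    apply: cvgB; last exact: cvg_cst.
    exact: cont_1B_powR.
  - move=> u u0; rewrite oneB_mobius// mobius_powR// /hA1.
    have u1 : 0 < 1 + u by lra.
    have u1n : 1 + u != 0 by rewrite gt_eqF.
    rewrite -powR_invn ?(ltW u1)// -powRrM.
    rewrite (_ : _ * _ * _ = ((1 + u) `^ (-1 * (s - 1)) * ((1 + u) `^ (- (- 1 - 2 * s)) *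
      (1 + u) `^ (- 2%:R)) - (1 + u) `^ (- (- 1 - 2 * s)) *
      (1 + u) `^ (- 2%:R)) * u `^ (- 1 - 2 * s)); last by ring.
    rewrite -!powRD ?u1n ?implybT//; congr ((_ `^ _ - _ `^ _) * _); ring.
(* above 1: the constant that [FA] has at infinity *)
have beE : (\int[lam]_(t in ray e) (be t)%:E = ((2 * s)^-1)%:E)%E.
  transitivity (\int[lam]_(t in ray 1%R) (t `^ (- 1 - 2 * s))%:E)%E.
    rewrite integral_mkcond [RHS]integral_mkcond; apply: eq_integral => t _.
    rewrite !patchE !mem_setE !in_itv/= !andbT /be.
    case: (ltP t 1) => t1; first by case: ifP.
    by rewrite ifT//; lra.
  rewrite integral_powR_ay//; last by move: s0; lra.
  rewrite powR1 mulr1 -invrN; congr (_^-1)%:E; ring.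
have hi1 := hA1_integrable d0; have hi2 := hA2_integrable e0.
have hi2' := hA2_integrable d0.
have mp : measurable_fun setT (fun t : R => t `^ (- 1 - 2 * s)) by exact: measurable_powR.
have ml : measurable_fun setT (fun t : R => t < 1).
  by apply: measurable_fun_ltr => //; exact: measurable_id.
have ali : lam.-integrable (ray e) (fun t => (al t)%:E).
  apply: ge0_integrable => //.
  - apply: measurable_funTS; apply: measurable_fun_ifT => //.
    apply: measurable_funM => //; apply: measurable_funB => //.
    apply: (measurableT_comp (measurable_powR _)).
    by apply: measurable_funB => //; exact: measurable_id.
  - move=> t /(ray_gt0 e0) t0; rewrite /al; case: ifP => // t1.
    rewrite mulr_ge0 ?powR_ge0// subr_ge0; apply: pow_1Br_ge1; first by move: s1; lra.
    by rewrite (ltW t0) t1.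
  - by rewrite alE; exact: integrable_lty.
have bei : lam.-integrable (ray e) (fun t => (be t)%:E).
  apply: ge0_integrable => //.
  - by apply: measurable_funTS; apply: measurable_fun_ifT.
  - by move=> t _; rewrite /be; case: ifP => // _; exact: powR_ge0.
  - by rewrite beE ltry.
have -> : \int[lam]_(t in ray e) second_diff s t = FA d + \int[lam]_(t in `[e, d[) hA2 t.
  transitivity (\int[lam]_(t in ray e) ((be t + hA2 t) - al t)).
    apply: eq_Rintegral => t; rewrite inE => /(ray_gt0 e0) t0; rewrite /second_diff /be /hA2 /al.
    case: (ltP t 1) => t1; first by rewrite pospowE; [ring|lra].
    by rewrite pospow_le0; [ring|lra].
  rewrite RintegralB//; last exact: integrableRD.
  rewrite RintegralD//.
  have -> : \int[lam]_(t in ray e) al t = \int[lam]_(t in ray d) hA1 t by rewrite /Rintegral alE.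
  have -> : \int[lam]_(t in ray e) be t = (2 * s)^-1 by rewrite /Rintegral beE.
  rewrite (integral_ray_split ed hi2).
  by have := integral_hA21 d0; rewrite RintegralB// => H; lra.
have /andP[FA0 FA1] := FA_le d0.
apply: le_trans (ler_normD _ _) _; rewrite (ger0_norm FA0) mulrDl addrC; apply: lerD.
  apply: le_trans gap; apply: Rintegral_bounded => //.
  - apply: integrableS hi2 => //; exact: subset_itvl.
  - move=> t /andP[et td]; have t0 : 0 < t by exact: lt_le_trans et.
    have h2 : (1 + t)^-1 <= (1 + t) `^ (s - 1).
      rewrite -powR_inv1; last lra.
      by apply: ler_powR; [|move: s0]; lra.
    have h3 : (1 + t) `^ (s - 1) <= 1 by apply: pow_1Dr_le1; [move: s1|]; lra.
    rewrite ger0_norm; last by rewrite mulr_ge0 ?powR_ge0//; lra.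
    apply: (@le_trans _ _ (t * t `^ (- 1 - 2 * s))).
      rewrite ler_wpM2r ?powR_ge0//.
      have : 1 - (1 + t)^-1 <= t.
        rewrite (_ : 1 - (1 + t)^-1 = t / (1 + t)); last by field; rewrite gt_eqF//; lra.
        by rewrite ler_pdivrMr; [nra|lra].
      by lra.
    rewrite -{1}(powRr1 (ltW t0)) -powRD ?(gt_eqF t0) ?implybT//.
    rewrite (_ : 1 + (- 1 - 2 * s) = - (2 * s)); last by ring.
    rewrite !powRN lef_pV2 ?posrE ?powR_gt0//.
    by apply: ge0_ler_powR; rewrite ?nnegrE ?(ltW t0) ?(ltW e0)//; move: s0; lra.
apply: le_trans FA1 _.
apply: (@le_trans _ _ ((2 * s)^-1 * (2 * e) `^ (2 - 2 * s))).
  rewrite ler_pM2l; last by rewrite invr_gt0; move: s0; lra.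
  apply: ge0_ler_powR; rewrite ?nnegrE ?(ltW d0)//; try (move: s1 => ?; lra).
  by rewrite /d ler_pdivrMr; [nra|lra].
rewrite powRM ?(ltW e0)// mulrA ler_wpM2r ?powR_ge0//.
have h : 2 `^ (2 - 2 * s) <= 4 :> R.
  rewrite (_ : 4 = 2 `^ 2%:R); last by rewrite powR_mulrn//; ring.
  by apply: ler_powR => //; move: s0; lra.
rewrite (_ : 2 / s = (2 * s)^-1 * 4); last by field; rewrite gt_eqF.
by rewrite ler_pM2l// invr_gt0; move: s0; lra.
Qed.

End second_difference_tail.

(** * The weight on the line is harmonic *)

Section full_line_identities.
Context {R : realType}.
Local Notation lam := (@lebesgue_measure R).
Local Notation ray a := (`[a, +oo[%classic : set R).
Variable s : R.
Hypothesis s01 : 0 < s < 1.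

Let pos : set R := `]0, +oo[%classic.

Lemma half_line_zero (G : R -> R) (C : R) : measurable_fun setT G ->
  (forall t, 0 < t -> `|G t| <= diff_majorant s t) ->
  (forall e, 0 < e < 2^-1 -> `|\int[lam]_(t in ray e) G t| <= C * e `^ (2 - 2 * s)) ->
  lam.-integrable setT (fun t => (\1_pos t * G t)%:E) /\
  (\int[lam]_t (\1_pos t * G t)%:E = 0)%E.
Proof.
move=> mG Gdom tail.
have posP t : (t \in pos) = (0 < t) by rewrite mem_setE in_itv/= andbT.
have gi : lam.-integrable setT (fun t => (\1_pos t * G t)%:E).
  have hd0 (t : R) : 0 <= diff_majorant s t.
    by rewrite /diff_majorant mulr_ge0// !addr_ge0// mulr_ge0 ?powR_ge0.
  apply: le_integrableR (integrable_diff_majorant s01) => //.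
    by apply: measurable_funM => //; apply: measurable_indic; exact: measurable_itv.
  move=> t _; rewrite /= indicE posP; case: ltP => t0; last by rewrite mul0r normr0.
  by rewrite mul1r; exact: Gdom.
split=> //; apply: (@integral_eq0_tails R _ C (2 - 2 * s)) => //.
- by case/andP: s01 => ? ?; lra.
- by move=> t t0; rewrite indicE posP ltNge t0 mul0r.
- move=> e e02; have /andP[e0 _] := e02.
  rewrite (@eq_Rintegral _ _ _ lam (ray e) G); first exact: tail.
  by move=> t; rewrite inE => /(ray_gt0 e0) t0; rewrite indicE posP t0 mul1r.
Qed.

(** Both differences, times their kernels, are even in [t]. *)
Lemma whole_line_zero (G f : R -> R) : f 0 = 0 ->
  lam.-integrable setT (fun t => (\1_pos t * G t)%:E) ->
  (\int[lam]_t (\1_pos t * G t)%:E = 0)%E ->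
  (forall t, 0 < t -> f t = G t /\ f (- t) = G t) ->
  lam.-integrable setT (fun t => (f t)%:E) /\ (\int[lam]_t (f t)%:E = 0)%E.
Proof.
move=> f0 gi g0 fG; have N1 : -1 != 0 :> R by rewrite oppr_eq0.
have posP t : (t \in pos) = (0 < t) by rewrite mem_setE in_itv/= andbT.
have [gNi gN0] := @lam_affine R (-1) 0 (fun t => \1_pos t * G t) N1 gi.
have fE t : f t = \1_pos t * G t + \1_pos (-1 * t + 0) * G (-1 * t + 0).
  rewrite !indicE !posP mulN1r addr0 oppr_gt0.
  have [t0|t0|->] := ltgtP t 0; last by rewrite f0 !mul0r addr0.
    have [_] := fG (- t) (ltac:(by rewrite oppr_gt0)).
    by rewrite opprK => ->; rewrite mul0r add0r mul1r.
  by have [-> _] := fG t t0; rewrite mul0r mul1r addr0.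
have fi := integrableRD measurableT gi gNi.
split; first by apply: eq_integrable fi => // t _; rewrite fE.
under eq_integral do rewrite fE EFinD.
by rewrite integralD_EFin// g0 gN0 g0 mule0 adde0.
Qed.

Let normr_powR_scale (a t r : R) : 0 < a -> `|t| `^ r = a `^ r * `|a^-1 * t + 0| `^ r.
Proof.
move=> a0; rewrite addr0 -powRM ?(ltW a0)//; congr (_ `^ _).
by rewrite normrM normfV (gtr0_norm a0) mulrA mulfV ?mul1r// gt_eqF.
Qed.

Let pospow_scaleB (a t p : R) : 0 < a -> pospow (a - t) p = a `^ p * pospow (1 - (a^-1 * t + 0)) p.
Proof. by move=> a0; rewrite -pospowM//; congr pospow; field; rewrite gt_eqF. Qed.

Let pospow_scaleD (a t p : R) : 0 < a -> pospow (a + t) p = a `^ p * pospow (1 + (a^-1 * t + 0)) p.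
Proof. by move=> a0; rewrite -pospowM//; congr pospow; field; rewrite gt_eqF. Qed.

Let rescale (a c : R) (f F : R -> R) : 0 < a ->
  lam.-integrable setT (fun t => (f t)%:E) /\ (\int[lam]_t (f t)%:E = 0)%E ->
  (forall t, F t = c * f (a^-1 * t + 0)) ->
  lam.-integrable setT (fun t => (F t)%:E) /\ (\int[lam]_t (F t)%:E = 0)%E.
Proof.
move=> a0 [fi f0] FE; have aV0 : a^-1 != 0 by rewrite invr_eq0 gt_eqF.
have [fai fa0] := lam_affine 0 aV0 fi.
split; first by apply: eq_integrable (integrableRZ measurableT c fai) => // t _; rewrite FE.
under eq_integral do rewrite FE EFinM.
by rewrite integralZl// fa0 f0 !mule0.
Qed.

(** The case [a = 1] follows from the tails, the general one by scaling. *)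
Lemma pospow_harmonic (a : R) : 0 < a ->
  lam.-integrable setT (fun t => ((2 * pospow a (s - 1) - pospow (a - t) (s - 1) -
    pospow (a + t) (s - 1)) * `|t| `^ (- 1 - 2 * s))%:E) /\
  (\int[lam]_t ((2 * pospow a (s - 1) - pospow (a - t) (s - 1) -
    pospow (a + t) (s - 1)) * `|t| `^ (- 1 - 2 * s))%:E = 0)%E.
Proof.
move=> a0; have [gi g0] := half_line_zero (measurable_second_diff s) (second_diff_le s01) (second_diff_tail s01).
pose f (t : R) := (2 - pospow (1 - t) (s - 1) - pospow (1 + t) (s - 1)) * `|t| `^ (- 1 - 2 * s).
have Hf := @whole_line_zero (second_diff s) f _ gi g0.
apply: (@rescale a (a `^ (s - 1) * a `^ (- 1 - 2 * s)) f) => //.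
  apply: Hf.
    by rewrite /f normr0 powR0 ?mulr0// lt_eqF//; case/andP: s01 => ? ?; lra.
  move=> t t0; rewrite /f /second_diff normrN opprK (gtr0_norm t0).
  by rewrite (@pospowE _ (1 + t)); [split => //; ring|lra].
move=> t; rewrite /f (normr_powR_scale t _ a0) pospow_scaleB// pospow_scaleD//.
by rewrite pospowE//; ring.
Qed.

Lemma pospow_antisym (a : R) : 0 < a ->
  lam.-integrable setT (fun t => ((pospow (a - t) (s - 1) -
    pospow (a + t) (s - 1)) * (t * `|t| `^ (- 1 - 2 * s)))%:E) /\
  (\int[lam]_t ((pospow (a - t) (s - 1) -
    pospow (a + t) (s - 1)) * (t * `|t| `^ (- 1 - 2 * s)))%:E = 0)%E.
Proof.
move=> a0; have [gi g0] := half_line_zero (measurable_first_diff s) (first_diff_le s01) (@first_diff_tail R s s01).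
pose f (t : R) := (pospow (1 - t) (s - 1) - pospow (1 + t) (s - 1)) * (t * `|t| `^ (- 1 - 2 * s)).
have Hf := @whole_line_zero (first_diff s) f _ gi g0.
apply: (@rescale a (a `^ (s - 1) * (a * a `^ (- 1 - 2 * s))) f) => //.
  apply: Hf; first by rewrite /f mul0r mulr0.
  move=> t t0; rewrite /f /first_diff normrN opprK (gtr0_norm t0).
  have -> : t `^ (- (2 * s)) = t * t `^ (- 1 - 2 * s).
    rewrite -{2}(powRr1 (ltW t0)) -powRD ?(gt_eqF t0) ?implybT//.
    by congr (_ `^ _); ring.
  by rewrite (@pospowE _ (1 + t)); [split => //; ring|lra].
move=> t; rewrite /f (normr_powR_scale t _ a0) pospow_scaleB// pospow_scaleD//.
have tE : t = a * (a^-1 * t + 0) by field; rewrite gt_eqF.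
by set T := a^-1 * t + 0 in tE *; rewrite tE; ring.
Qed.

End full_line_identities.

(** * Principal values and slicing of homogeneous kernels *)

Section principal_values.
Context {R : realType}.
Local Notation lam := (@lebesgue_measure R).

Lemma integrable_cut d (T : measurableType d) (mu : {measure set T -> \bar R})
    (S : set T) (f : T -> R) : measurable S ->
  mu.-integrable setT (fun x => (f x)%:E) ->
  mu.-integrable setT (fun x => (\1_S x * f x)%:E).
Proof.
move=> mS fi; apply: integrable_indicM => //.
exact: integrableS fi.
Qed.

Lemma Rintegral_indic d (T : measurableType d) (mu : {measure set T -> \bar R})
    (S : set T) (f : T -> R) :
  \int[mu]_(x in S) f x = \int[mu]_x (\1_S x * f x).
Proof.
rewrite Rintegral_mkcond; apply: eq_Rintegral => x _.
by rewrite patchE indicE; case: (x \in S); rewrite ?mul1r ?mul0r.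
Qed.

Lemma indic_iff (T U : Type) (A : set T) (B : set U) x y :
  (A x <-> B y) -> \1_A x = \1_B y :> R.
Proof.
move=> AB; rewrite !indicE; suff -> : (x \in A) = (y \in B) by [].
by apply/idP/idP; rewrite !inE => /AB.
Qed.

Lemma measurable_outsideB n (eps : R) (x : 'rV[R]_n) :
  measurable [set y : 'rV[R]_n | eps < enorm (x - y)].
Proof.
rewrite -[X in measurable X]setTI; apply: measurable_fun_ltr => //.
exact: measurableT_comp (@measurable_enorm R n) (measurable_subl x).
Qed.

(** The indicators tend to 1 off the point [x], where [f] vanishes. *)
Lemma cut_cvg n (x : 'rV[R]_n) (f : 'rV[R]_n -> R) :
  (leb n).-integrable setT (fun h => (f h)%:E) -> f x = 0 ->
  \int[leb n]_h (\1_[set h | eps < enorm (x - h)] h * f h) @[eps --> 0^'+] -->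
  \int[leb n]_h f h.
Proof.
move=> fi fx0; apply/cvg_at_rightP => u [u0 ucvg].
have mf := measurable_int _ fi.
pose F k (h : 'rV[R]_n) := (\1_[set h | u k < enorm (x - h)] h * f h)%:E.
have Fi k : (leb n).-integrable setT (F k).
  by apply: integrable_cut => //; exact: measurable_outsideB.
have [] := @dominated_convergence _ _ R (leb n) setT measurableT
  F (fun h => (f h)%:E) (fun h => `|f h|%:E).
- by move=> k; exact: measurable_int (Fi k).
- exact: mf.
- apply: aeW => h _; have [->|hx] := eqVneq h x.
    by rewrite /F fx0; under eq_fun do rewrite mulr0; exact: cvg_cst.
  apply: (@cvg_trans _ (cst (f h)%:E @ \oo)); last exact: cvg_cst.
  apply: near_eq_cvg; near=> k; rewrite /F/= indicE mem_set ?mul1r//=.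
  near: k; have h0 : 0 < enorm (x - h) by rewrite enorm_gt0 subr_eq0 eq_sym.
  have /cvgrPdist_lt/(_ _ h0) := ucvg; apply: filterS => k.
  by rewrite sub0r normrN gtr0_norm.
- by have := integrable_abse fi; apply: eq_integrable.
- apply: aeW => h k _; rewrite /F lee_fin normrM indicE.
  by case: (h \in _); rewrite ?normr1 ?mul1r// normr0 mul0r.
move=> _ _ cv; apply: fine_cvg.
by rewrite fineK//; exact: integrable_fin_num.
Unshelve. all: by end_near. Qed.

(** The truncation region is symmetric about [x], so that the truncated integral
    of [P] is half that of its symmetrization [f]; the latter is integrable
    although [P] is not. *)
Lemma pv_cvg0 n (x : 'rV[R]_n) (P f : 'rV[R]_n -> R) :
  (forall eps, 0 < eps -> (leb n).-integrable setT
     (fun y => (\1_[set y | eps < enorm (x - y)] y * P y)%:E)) ->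
  (leb n).-integrable setT (fun h => (f h)%:E) -> f 0 = 0 ->
  (\int[leb n]_h (f h)%:E = 0)%E ->
  (forall h, P (x - h) + P (x + h) = f h) ->
  \int[leb n]_y (\1_[set y | eps < enorm (x - y)] y * P y) @[eps --> 0^'+] --> (0 : R).
Proof.
move=> Pi fi f0 fI0 Pf.
have := cut_cvg fi f0.
have -> : \int[leb n]_h f h = 0 by rewrite /Rintegral fI0.
move=> cv.
have : 2^-1 * \int[leb n]_h (\1_[set h | eps < enorm (0 - h)] h * f h)
    @[eps --> 0^'+] --> (2^-1 * 0 : R) by apply: cvgMr; exact: cv.
rewrite mulr0; apply: cvg_trans.
apply: near_eq_cvg; near=> eps.
have eps0 : 0 < eps by near: eps; exact: nbhs_right_gt.
have {}Pi := Pi _ eps0.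
have N1 : -1 != 0 :> R by rewrite oppr_eq0.
have n1 : 1 != 0 :> R by [].
have [i1] := leb_affine x N1 Pi.
have [i2] := leb_affine x n1 Pi.
rewrite normrN1 normr1 (expr1n R n) invr1 mul1e => E2 E1.
pose S : set 'rV[R]_n := [set h | eps < enorm (0 - h)].
have c1 h : \1_[set y | eps < enorm (x - y)] (-1 *: h + x) = \1_S h :> R.
  have e1 : enorm (x - (-1 *: h + x)) = enorm (0 - h).
    by rewrite scaleN1r opprD opprK addrCA subrr addr0 sub0r enormN.
  by apply: indic_iff; rewrite /S/= e1.
have c2 h : \1_[set y | eps < enorm (x - y)] (1 *: h + x) = \1_S h :> R.
  have e1 : enorm (x - (1 *: h + x)) = enorm (0 - h).
    by rewrite scale1r opprD addrCA subrr addr0 sub0r.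
  by apply: indic_iff; rewrite /S/= e1.
have E : (\int[leb n]_h (\1_S h * f h)%:E = 2%:E *
    \int[leb n]_y (\1_[set y | eps < enorm (x - y)] y * P y)%:E)%E.
  rewrite -[2%:E]/(1 + 1)%:E EFinD ge0_muleDl// !mul1e -{1}E1 -E2 -integralD_EFin//.
  apply: eq_integral => h _; rewrite /= c1 c2 -EFinD -mulrDr -Pf.
  by rewrite scaleN1r scale1r ![_ + x]addrC.
rewrite /Rintegral E fineM//; last exact: integrable_fin_num.
by rewrite /= mulrA mulVf ?mul1r.
Unshelve. all: by end_near. Qed.

(** Fubini along the last coordinate: the slice of [Q] at height [t] integrates
    to [`|t| ^+ n * c t] times the slice at height 1. The factor [c] is a general
    function, to cover even kernels and kernels multiplied by a coordinate. *)
Lemma tensor_integral n (D c : R -> R) (Q : 'rV[R]_n.+1 -> R) (Lam r : R) :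
  measurable_fun setT D -> D 0 = 0 -> measurable_fun setT Q -> r < - n%:R -> 0 <= Lam ->
  (forall h, `|Q h| <= Lam * enorm h `^ r) ->
  (forall t h, t != 0 -> Q (t *: h) = c t * Q h) ->
  (forall t, t != 0 -> `|t| ^+ n * `|c t| = `|t| `^ (n%:R + r)) ->
  lam.-integrable setT (fun t => (D t * (`|t| ^+ n * c t))%:E) ->
  (leb n.+1).-integrable setT (fun h => (D (xlast h) * Q h)%:E) /\
  (\int[leb n.+1]_h (D (xlast h) * Q h)%:E =
   \int[leb n]_z (Q (rsnoc z 1))%:E * \int[lam]_t (D t * (`|t| ^+ n * c t))%:E)%E.
Proof.
move=> mD D0 mQ rn Lam0 Qle Qc cE Di.
have Qi1 : (leb n).-integrable setT (fun z => (Q (rsnoc z 1))%:E).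
  apply: (le_integrableR measurableT _ _ (integrableRZ measurableT Lam (integrable_slice1 rn))).
    exact: measurableT_comp mQ (measurable_rsnocl 1).
  by move=> z _; exact: Qle.
have sl t (t0 : t != 0) := slice_integral t0 (fun z => Qc t (rsnoc z 1) t0) Qi1.
have mf : measurable_fun setT (fun h : 'rV[R]_n.+1 => D (xlast h) * Q h).
  by apply: measurable_funM => //; exact: (measurableT_comp mD (@measurable_xlast R n)).
pose A := (\int[leb n]_z `|(Q (rsnoc z 1))%:E|)%E.
have Afin : A \is a fin_num.
  by apply: integrable_fin_num => //; exact: integrable_abse.
have fi : (leb n.+1).-integrable setT (fun h => (D (xlast h) * Q h)%:E).
  apply/integrableP; split; first exact/measurable_EFinP.
  rewrite (@ge0_lebSr R n (fun h => `|(D (xlast h) * Q h)%:E|)%E) => [||h]; last 2 first.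
  - by apply: measurableT_comp => //; exact/measurable_EFinP.
  - exact: abse_ge0.
  apply: (@le_lt_trans _ _ (A * \int[lam]_t `|(D t * (`|t| ^+ n * c t))%:E|)%E); last first.
    rewrite lte_mul_pinfty//; first exact: integral_ge0.
    by case/integrableP : Di.
  rewrite -ge0_integralZl//; last 2 first.
  - by apply: measurableT_comp => //; exact: measurable_int Di.
  - exact: integral_ge0.
  rewrite le_eqVlt; apply/orP; left; apply/eqP; apply: eq_integral => t _.
  have [->|t0] := eqVneq t 0.
    rewrite D0 mul0r /= normr0 mule0.
    by apply: integral0_eq => z _; rewrite xlast_rsnoc D0 mul0r normr0.
  have aQi : (leb n).-integrable setT (fun z => (`|Q (rsnoc z 1)|)%:E).
    by have := integrable_abse Qi1; apply: eq_integrable.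
  have aQc z : `|Q (t *: rsnoc z 1)| = `|c t| * `|Q (rsnoc z 1)| by rewrite Qc// normrM.
  have [_ aE] := @slice_integral R n (fun h => `|Q h|) t `|c t| t0 aQc aQi.
  transitivity (\int[leb n]_z (`|D t|%:E * (`|Q (rsnoc z t)|)%:E))%E.
    by apply: eq_integral => z _; rewrite xlast_rsnoc /= normrM.
  rewrite ge0_integralZl_EFin//; last by apply/measurable_EFinP;
    apply: measurableT_comp => //; exact: measurableT_comp mQ (measurable_rsnocl t).
  rewrite aE muleA muleC; congr (_ * _)%E.
  rewrite -EFinM; congr EFin; rewrite !normrM normrX normr_id; ring.
split=> //; rewrite lebSr//.
have Kfin : (\int[leb n]_z (Q (rsnoc z 1))%:E)%E \is a fin_num by exact: integrable_fin_num.
rewrite -(fineK Kfin) -integralZl//; apply: eq_integral => t _; rewrite fineK//.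
have [->|t0] := eqVneq t 0.
  rewrite D0 mul0r mule0.
  by apply: integral0_eq => z _; rewrite xlast_rsnoc D0 mul0r.
transitivity (\int[leb n]_z ((D t)%:E * (Q (rsnoc z t))%:E))%E.
  by apply: eq_integral => z _; rewrite xlast_rsnoc.
have [si sE] := sl t t0.
by rewrite integralZl// sE muleA muleC -EFinM.
Qed.

End principal_values.

(** * The operator on weighted functions *)

Lemma Rintegral_sum d (T : measurableType d) (R : realType)
    (mu : {measure set T -> \bar R}) (D : set T) (m : nat) (f : 'I_m -> T -> R) :
  measurable D -> (forall i, mu.-integrable D (fun x => (f i x)%:E)) ->
  \int[mu]_(x in D) (\sum_i f i x) = \sum_i \int[mu]_(x in D) f i x.
Proof.
move=> mD fi; rewrite /Rintegral.
under eq_integral do rewrite -sumEFin.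
rewrite integral_sum//.
rewrite (eq_bigr (fun i => (fine (\int[mu]_(x in D) (f i x)%:E))%:E)) ?sumEFin// => i _.
by rewrite fineK//; exact: integrable_fin_num.
Qed.

Section operator_on_weighted_functions.
Context {R : realType}.
Variables (n : nat) (s q Lam : R) (K : 'rV[R]_n.+1 -> R).
Hypotheses (s01 : 0 < s < 1) (q1 : 1 < q) (q2s : 2 * s < q) (qs1 : q < 1 + s).
Hypotheses (mK : measurable_fun setT K) (Lam0 : 0 <= Lam).
Hypothesis K_le : forall h, `|K h| <= Lam * enorm h `^ (- n.+1%:R - 2 * s).
Hypothesis K_hom : forall t h, t != 0 -> K (t *: h) = `|t| `^ (- n.+1%:R - 2 * s) * K h.

Local Notation lam := (@lebesgue_measure R).
Local Notation w := (@xweight R n (s - 1)).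
Let k0 : R := - n.+1%:R - 2 * s.

Lemma powR_exprn_mul (x r : R) (m : nat) : 0 <= x -> r < 0 -> r + m%:R != 0 ->
  x ^+ m * x `^ r = x `^ (m%:R + r).
Proof.
move=> x0 r0 rm; have [->|xn] := eqVneq x 0.
  by rewrite (@powR0 _ r) ?lt_eqF// mulr0 powR0// addrC.
by rewrite -powR_mulrn// -powRD// xn implybT.
Qed.

(** Homogeneity is assumed for all nonzero factors, so it contains evenness. *)
Lemma even_kernel h : K (- h) = K h.
Proof.
by rewrite -scaleN1r K_hom ?oppr_eq0// normrN1 powR1 mul1r.
Qed.

Lemma kernel_powR_mul (x r : R) : 0 <= x -> 0 < r -> r + k0 != 0 ->
  x `^ r * x `^ k0 = x `^ (r + k0).
Proof.
move=> x0 r0 rk; have [->|xn] := eqVneq x 0; last by rewrite -powRD// xn implybT.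
by rewrite (powR0 (lt0r_neq0 r0)) mul0r powR0.
Qed.

Let q0 : 0 < q. Proof. by move: q1; lra. Qed.
Let exp0 : q + k0 = q - n.+1%:R - 2 * s. Proof. by rewrite /k0; ring. Qed.
Let exp0_neq : q + k0 != 0.
Proof. by rewrite lt_eqF// /k0 -natr1; have := ler0n R n; move: qs1 s01 => ? /andP[? ?]; lra. Qed.

Variables (x : 'rV[R]_n.+1) (x0 : 0 < xlast x).
Variables (eta : 'rV[R]_n.+1 -> R) (g : 'I_n.+1 -> R) (C : R).
Hypothesis meta : measurable_fun setT eta.

(** The vector [g] stands for the gradient of [eta] at [x]; it is tied to [eta] by
    the bound on the remainder. *)
Definition taylor_rem (y : 'rV[R]_n.+1) : R :=
  eta x - eta y + \sum_i g i * (y 0 i - x 0 i).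
Hypothesis rem_le : forall y, `|taylor_rem y| <= C * enorm (x - y) `^ q.

Let out eps : set 'rV[R]_n.+1 := [set y | eps < enorm (x - y)].

Lemma measurable_Kx : measurable_fun setT (fun y : 'rV[R]_n.+1 => K (x - y)).
Proof. exact: measurableT_comp mK (measurable_subl x). Qed.

Lemma measurable_taylor_rem : measurable_fun setT taylor_rem.
Proof.
apply: measurable_funD; first exact: measurable_funB.
apply: measurable_sum => i; apply: measurable_funM => //.
by apply: measurable_funB => //; exact: measurable_coord.
Qed.

Lemma remainder_integrable :
  (leb n.+1).-integrable setT (fun y => (w y * taylor_rem y * K (x - y))%:E).
Proof.
have C0 : 0 <= C.
  have := rem_le (x + const_mx 1); rewrite opprD addrA subrr sub0r enormN.
  have e0 : 0 < enorm (const_mx 1 : 'rV[R]_n.+1) `^ q.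
    rewrite powR_gt0// enorm_gt0; apply/eqP => /rowP/(_ ord0).
    by rewrite !mxE => /eqP; rewrite oner_eq0.
  by move=> /(le_trans (normr_ge0 _)); rewrite pmulr_lge0.
apply: (le_integrableR measurableT _ _ (integrableRZ measurableT (C * Lam)
  (kernel_integrable s01 q2s qs1 x0))).
- apply: measurable_funM; last exact: measurable_Kx.
  by apply: measurable_funM; [exact: measurable_xweight|exact: measurable_taylor_rem].
- move=> y _; rewrite !normrM (ger0_norm (xweight_ge0 _ _)).
  rewrite -exp0 -kernel_powR_mul ?enorm_ge0//.
  rewrite [leRHS](_ : _ = w y * (C * enorm (x - y) `^ q) * (Lam * enorm (x - y) `^ k0)); last by ring.
  apply: ler_pM => //; first by rewrite mulr_ge0 ?xweight_ge0.
  by apply: ler_wpM2l => //; exact: xweight_ge0.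
Qed.

(** Away from [x], the exponent [p] may be raised to [q] at the cost of a
    constant. *)
Lemma cut_weight_integrable (p eps : R) (P : 'rV[R]_n.+1 -> R) :
  0 < eps -> 0 <= p <= 1 -> measurable_fun setT P ->
  (forall y, `|P y| <= Lam * (w y * enorm (x - y) `^ (p + k0))) ->
  (leb n.+1).-integrable setT (fun y => (\1_(out eps) y * P y)%:E).
Proof.
move=> eps0 /andP[p0 p1] mP Ple.
apply: (le_integrableR measurableT _ _ (integrableRZ measurableT (Lam * eps `^ (p - q))
  (kernel_integrable s01 q2s qs1 x0))).
- apply: measurable_funM => //; apply: measurable_indic; exact: measurable_outsideB.
- move=> y _; rewrite normrM indicE.
  case: (boolP (y \in _)); last first.
    by rewrite normr0 mul0r !mulr_ge0 ?powR_ge0 ?xweight_ge0.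
  rewrite inE/= normr1 mul1r => ey; apply: le_trans (Ple y) _.
  have e0 : 0 < enorm (x - y) by exact: lt_trans ey.
  rewrite -mulrA ler_wpM2l// mulrCA ler_wpM2l ?xweight_ge0//.
  rewrite (_ : p + k0 = (p - q) + (q + k0)); last by ring.
  rewrite powRD ?(gt_eqF e0) ?implybT// exp0 ler_wpM2r ?powR_ge0//.
  rewrite -(opprB q p) !powRN lef_pV2 ?posrE ?powR_gt0//.
  by apply: ge0_ler_powR; rewrite ?nnegrE ?(ltW eps0) ?(ltW e0) ?(ltW ey)//; move: q1; lra.
Qed.

(* Integrands of the zeroth order term and of the i-th first order term in the
   expansion of [eta] at [x]. *)
Let harmonic_part y := (w x - w y) * K (x - y).
Let moment_part i y := w y * (x 0 i - y 0 i) * K (x - y).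

Lemma harmonic_part_integrable eps : 0 < eps ->
  (leb n.+1).-integrable setT (fun y => (\1_(out eps) y * harmonic_part y)%:E).
Proof.
move=> eps0.
have i1 : (leb n.+1).-integrable setT (fun y => (\1_(out eps) y * (w y * K (x - y)))%:E).
  apply: (@cut_weight_integrable 0) => //.
  - by rewrite lexx ler01.
  - by apply: measurable_funM; [exact: measurable_xweight|exact: measurable_Kx].
  - move=> y; rewrite normrM (ger0_norm (xweight_ge0 _ _)) mulrCA ler_wpM2l ?xweight_ge0//.
    by rewrite add0r.
have kN : k0 < - n.+1%:R by rewrite /k0; case/andP: s01 => ? ?; lra.
have N1 : -1 != 0 :> R by rewrite oppr_eq0.
have [i2 _] := leb_affine x N1 (integrable_away eps0 kN).
have i3 : (leb n.+1).-integrable setT (fun y => (\1_(out eps) y * K (x - y))%:E).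
  apply: (le_integrableR measurableT _ _ (integrableRZ measurableT Lam i2)).
  - apply: measurable_funM; last exact: measurable_Kx.
    by apply: measurable_indic; exact: measurable_outsideB.
  - move=> y _; rewrite (_ : -1 *: y + x = x - y); last by rewrite scaleN1r addrC.
    rewrite normrM ger0_norm// mulrCA.
    rewrite (@indic_iff _ _ _ (out eps) [set h | eps < enorm h] y (x - y))//.
    by rewrite ler_wpM2l.
apply: eq_integrable (integrableRB measurableT (integrableRZ measurableT (w x) i3) i1) => // y _.
by congr EFin; rewrite /harmonic_part; ring.
Qed.

Lemma moment_part_integrable i eps : 0 < eps ->
  (leb n.+1).-integrable setT (fun y => (\1_(out eps) y * moment_part i y)%:E).
Proof.
move=> eps0; apply: (@cut_weight_integrable 1) => //.
- by rewrite ler01 lexx.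
- apply: measurable_funM; last exact: measurable_Kx.
  apply: measurable_funM; first exact: measurable_xweight.
  by apply: measurable_funB => //; exact: measurable_coord.
- move=> y; rewrite !normrM (ger0_norm (xweight_ge0 _ _)).
  have k1 : 1 + k0 != 0.
    by rewrite lt_eqF// /k0 -natr1; have := ler0n R n; move: s01 => /andP[? ?]; lra.
  rewrite -kernel_powR_mul ?enorm_ge0// powRr1 ?enorm_ge0//.
  rewrite [leRHS](_ : _ = w y * enorm (x - y) * (Lam * enorm (x - y) `^ k0)); last by ring.
  apply: ler_pM => //; first by rewrite mulr_ge0 ?xweight_ge0.
  apply: ler_wpM2l; first exact: xweight_ge0.
  by have := coord_le_enorm (x - y) i; rewrite !mxE.
Qed.

Let a := xlast x.
Let DA (t : R) := 2 * pospow a (s - 1) - pospow (a - t) (s - 1) - pospow (a + t) (s - 1).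
Let DB (t : R) := pospow (a - t) (s - 1) - pospow (a + t) (s - 1).

Let m1 : measurable_fun setT (fun t : R => pospow (a - t) (s - 1)).
Proof.
apply: (measurableT_comp (measurable_pospow _)).
by apply: measurable_funB => //; exact: measurable_id.
Qed.
Let m2 : measurable_fun setT (fun t : R => pospow (a + t) (s - 1)).
Proof.
apply: (measurableT_comp (measurable_pospow _)).
by apply: measurable_funD => //; exact: measurable_id.
Qed.

Let xlast_sub h : xlast (x - h) = a - xlast h. Proof. exact: xlastB. Qed.
Let xlast_add h : xlast (x + h) = a + xlast h. Proof. by rewrite /a /xlast !mxE. Qed.

Lemma weight_harmonic : (leb n.+1).-integrable setT (fun h => (DA (xlast h) * K h)%:E) /\
  (\int[leb n.+1]_h (DA (xlast h) * K h)%:E = 0)%E.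
Proof.
have [hi h0] := pospow_harmonic s01 x0.
have cE (t : R) : `|t| ^+ n * `|t| `^ k0 = `|t| `^ (- 1 - 2 * s).
  rewrite powR_exprn_mul//.
  - by congr (_ `^ _); rewrite /k0 -natr1; ring.
  - by rewrite /k0 -natr1; have := ler0n R n; move: s01 => /andP[? ?]; lra.
  - by rewrite lt_eqF// /k0 -natr1; move: s01 => /andP[? ?]; lra.
have [] := @tensor_integral R n DA (fun t => `|t| `^ k0) K Lam k0.
- by apply: measurable_funB => //; apply: measurable_funB.
- by rewrite /DA subr0 addr0; ring.
- exact: mK.
- by rewrite /k0 -natr1; move: s01 => /andP[? ?]; lra.
- exact: Lam0.
- exact: K_le.
- exact: K_hom.
- move=> t t0; rewrite (ger0_norm (powR_ge0 `|t| k0)) powR_exprn_mul//.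
  + by rewrite /k0 -natr1; have := ler0n R n; move: s01 => /andP[? ?]; lra.
  + by rewrite lt_eqF// /k0 -natr1; move: s01 => /andP[? ?]; lra.
- by apply: eq_integrable hi => // t _; rewrite cE.
move=> Ki ->; split => //.
under [X in (_ * X)%E]eq_integral do rewrite cE.
by rewrite h0 mule0.
Qed.

Lemma weight_antisym i :
  (leb n.+1).-integrable setT (fun h => (DB (xlast h) * (h 0 i * K h))%:E) /\
  (\int[leb n.+1]_h (DB (xlast h) * (h 0 i * K h))%:E = 0)%E.
Proof.
have [hi h0] := pospow_antisym s01 x0.
have cE (t : R) : `|t| ^+ n * (t * `|t| `^ k0) = t * `|t| `^ (- 1 - 2 * s).
  rewrite mulrCA powR_exprn_mul//.
  - by congr (_ * _ `^ _); rewrite /k0 -natr1; ring.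
  - by rewrite /k0 -natr1; have := ler0n R n; move: s01 => /andP[? ?]; lra.
  - by rewrite lt_eqF// /k0 -natr1; move: s01 => /andP[? ?]; lra.
have k1 : 1 + k0 != 0.
  by rewrite lt_eqF// /k0 -natr1; have := ler0n R n; move: s01 => /andP[? ?]; lra.
have [] := @tensor_integral R n DB (fun t => t * `|t| `^ k0) (fun h => h 0 i * K h) Lam (1 + k0).
- exact: measurable_funB.
- by rewrite /DB subr0 addr0 subrr.
- by apply: measurable_funM => //; exact: measurable_coord.
- by rewrite /k0 -natr1; move: s01 => /andP[? ?]; lra.
- exact: Lam0.
- move=> h; rewrite normrM -kernel_powR_mul ?enorm_ge0// powRr1 ?enorm_ge0//.
  by rewrite mulrCA; apply: ler_pM => //; exact: coord_le_enorm.
- by move=> t h t0; rewrite mxE K_hom//; rewrite -/k0; ring.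
- move=> t t0; rewrite normrM (ger0_norm (powR_ge0 _ _)).
  rewrite -powR_mulrn// -{2}(powRr1 (normr_ge0 t)) -!powRD ?normr_eq0 ?t0 ?implybT//.
- by apply: eq_integrable hi => // t _; rewrite cE.
move=> Ki ->; split => //.
under [X in (_ * X)%E]eq_integral do rewrite cE.
by rewrite h0 mule0.
Qed.

Lemma harmonic_part_cvg0 : \int[leb n.+1]_y (\1_(out eps) y * harmonic_part y) @[eps --> 0^'+] --> (0 : R).
Proof.
have [fi f0] := weight_harmonic.
apply: (pv_cvg0 harmonic_part_integrable fi) => //.
- by rewrite /DA /xlast mxE subr0 addr0 (_ : _ - _ - _ = 0) ?mul0r//; ring.
- move=> h; rewrite /harmonic_part (_ : x - (x - h) = h); last by rewrite opprD opprK addrA subrr add0r.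
  rewrite (_ : x - (x + h) = - h); last by rewrite opprD addrA subrr sub0r.
  by rewrite even_kernel /xweight xlast_sub xlast_add /DA -/a; ring.
Qed.

Lemma moment_part_cvg0 i : \int[leb n.+1]_y (\1_(out eps) y * moment_part i y) @[eps --> 0^'+] --> (0 : R).
Proof.
have [fi f0] := weight_antisym i.
apply: (pv_cvg0 (moment_part_integrable i) fi) => //.
- by rewrite mxE mul0r mulr0.
- move=> h; rewrite /moment_part (_ : x - (x - h) = h); last by rewrite opprD opprK addrA subrr add0r.
  rewrite (_ : x - (x + h) = - h); last by rewrite opprD addrA subrr sub0r.
  by rewrite even_kernel /xweight xlast_sub xlast_add /DB !mxE; ring.
Qed.

(** Write [w(x) eta(x) - w(y) eta(y)] as [eta(x) (w(x) - w(y))] plus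
    [w(y) (eta(x) - eta(y))] and expand [eta] at [x]. The truncated integrals of
    the zeroth and first order terms tend to zero, and the remainder is
    integrable. *)
Lemma Lop_remainder : Lop_defined K (fun y => w y * eta y) x /\
  Lop K (fun y => w y * eta y) x = 2 * \int[leb n.+1]_y (w y * taylor_rem y * K (x - y)).
Proof.
pose u y := w y * eta y.
have ri := remainder_integrable.
have split_u y : (u x - u y) * K (x - y) =
    w y * taylor_rem y * K (x - y) + (eta x * harmonic_part y + \sum_i g i * moment_part i y).
  have -> : \sum_i g i * moment_part i y = - (\sum_i g i * (y 0 i - x 0 i)) * (w y * K (x - y)).
    rewrite -sumrN mulr_suml; apply: eq_bigr => i _; rewrite /moment_part; ring.
  by rewrite /u /taylor_rem /harmonic_part; ring.
have cutR eps := integrable_cut (measurable_outsideB eps x) ri.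
have cutA eps (e0 : 0 < eps) := integrableRZ measurableT (eta x) (harmonic_part_integrable e0).
have cutB eps (e0 : 0 < eps) : (leb n.+1).-integrable setT
    (fun y => (\sum_i g i * (\1_(out eps) y * moment_part i y))%:E).
  by apply: integrableR_sum => // i; apply: integrableRZ => //; exact: moment_part_integrable.
have cutE eps y : \1_(out eps) y * ((u x - u y) * K (x - y)) =
    \1_(out eps) y * (w y * taylor_rem y * K (x - y)) +
    (eta x * (\1_(out eps) y * harmonic_part y) + \sum_i g i * (\1_(out eps) y * moment_part i y)).
  have -> : \sum_i g i * (\1_(out eps) y * moment_part i y) = \1_(out eps) y * \sum_i g i * moment_part i y.
    by rewrite mulr_sumr; apply: eq_bigr => i _; rewrite mulrCA.
  by rewrite split_u; ring.
have LE eps : 0 < eps -> L_trunc K u x eps =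
    \int[leb n.+1]_y (\1_(out eps) y * (w y * taylor_rem y * K (x - y))) +
    (eta x * \int[leb n.+1]_y (\1_(out eps) y * harmonic_part y) +
     \sum_i g i * \int[leb n.+1]_y (\1_(out eps) y * moment_part i y)).
  move=> e0; rewrite /L_trunc Rintegral_indic.
  under eq_Rintegral do rewrite cutE.
  rewrite RintegralD//; [|exact: cutR|by apply: integrableRD => //; [exact: cutA|exact: cutB]].
  rewrite RintegralD//; [|exact: cutA|exact: cutB].
  rewrite RintegralZl//; last exact: harmonic_part_integrable.
  congr (_ + (_ + _)).
  rewrite Rintegral_sum//; last by move=> i; apply: integrableRZ => //; exact: moment_part_integrable.
  by apply: eq_bigr => i _; rewrite RintegralZl//; exact: moment_part_integrable.
have cv : L_trunc K u x eps @[eps --> 0^'+] -->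
    \int[leb n.+1]_y (w y * taylor_rem y * K (x - y)).
  have r0 : w x * taylor_rem x * K (x - x) = 0.
    by rewrite /taylor_rem subrr add0r big1 ?mulr0 ?mul0r// => i _; rewrite subrr mulr0.
  have cR := cut_cvg ri r0.
  have cA : eta x * \int[leb n.+1]_y (\1_(out eps) y * harmonic_part y) @[eps --> 0^'+] --> eta x * 0.
    by apply: cvgMr; exact: harmonic_part_cvg0.
  have cB : \sum_i g i * \int[leb n.+1]_y (\1_(out eps) y * moment_part i y) @[eps --> 0^'+] -->
      \sum_(i < n.+1) g i * (0 : R).
    apply: (@cvg_big _ _ +%R 0 xpredT) => [|i _].
      exact: add_continuous.
    by apply: cvgMr; exact: moment_part_cvg0.
  rewrite mulr0 in cA.
  have cB0 : \sum_(i < n.+1) g i * (0 : R) = 0 by rewrite big1// => i _; rewrite mulr0.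
  rewrite cB0 in cB.
  have cv : (\int[leb n.+1]_y (\1_(out eps) y * (w y * taylor_rem y * K (x - y))) +
      (eta x * \int[leb n.+1]_y (\1_(out eps) y * harmonic_part y) +
       \sum_i g i * \int[leb n.+1]_y (\1_(out eps) y * moment_part i y))) @[eps --> 0^'+] -->
      \int[leb n.+1]_y (w y * taylor_rem y * K (x - y)) + (0 + 0).
    by apply: cvgD => //; apply: cvgD.
  rewrite !addr0 in cv.
  apply: cvg_trans cv; apply: near_eq_cvg; near=> eps.
  by rewrite LE//; near: eps; exact: nbhs_right_gt.
split; last by rewrite /Lop (cvg_lim _ cv).
split; last by apply/cvg_ex; eexists; exact: cv.
move=> eps e0; apply/integrable_mkcond; first exact: measurable_outsideB.
have := integrableRD measurableT (cutR eps) (integrableRD measurableT (cutA _ e0) (cutB _ e0)).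
apply: eq_integrable => // y _; rewrite -cutE patchE indicE.
by case: (y \in _); rewrite ?mul1r ?mul0r.
Unshelve. all: by end_near. Qed.

End operator_on_weighted_functions.

(** * Frullani integrals and the constant c_s *)

Section fibrewise_substitution.
Context {R : realType}.

(** A change of variables in the second variable whose form depends on the first:
    used for [y = x - h] and for [b = a r]. The hypothesis on nonnegative
    functions is transferred by Tonelli and by splitting into positive and
    negative parts. *)
Lemma integral_fiber d (T : measurableType d) (m : {sigma_finite_measure set T -> \bar R})
    (c : T -> R) (phi : T -> T -> T) :
  measurable_fun setT c -> (forall x, 0 <= c x) ->
  measurable_fun setT (fun z : T * T => phi z.1 z.2) ->
  (forall x (F : T -> R), measurable_fun setT F -> (forall y, 0 <= F y) ->
    (\int[m]_y (F y)%:E = \int[m]_y (c x * F (phi x y))%:E)%E) ->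
  forall f : T * T -> R, (m \x m)%E.-integrable setT (fun z => (f z)%:E) ->
  (m \x m)%E.-integrable setT (fun z => (c z.1 * f (z.1, phi z.1 z.2))%:E) /\
  (\int[(m \x m)%E]_z (f z)%:E = \int[(m \x m)%E]_z (c z.1 * f (z.1, phi z.1 z.2))%:E)%E.
Proof.
move=> mc c0 mphi phi_inv f fi.
have mf : measurable_fun setT f by have /measurable_EFinP := measurable_int _ fi.
have mP : measurable_fun setT (fun z : T * T => (z.1, phi z.1 z.2)).
  by apply: measurable_fun_pair => //; exact: measurable_fst.
have mcP (g : T * T -> R) : measurable_fun setT g ->
    measurable_fun setT (fun z => c z.1 * g (z.1, phi z.1 z.2)).
  move=> mg; apply: measurable_funM; first exact: measurableT_comp mc measurable_fst.
  exact: measurableT_comp mg mP.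
have ge0E (g : T * T -> R) : measurable_fun setT g -> (forall z, 0 <= g z) ->
    (\int[(m \x m)%E]_z (g z)%:E = \int[(m \x m)%E]_z (c z.1 * g (z.1, phi z.1 z.2))%:E)%E.
  move=> mg g0.
  have mgE : measurable_fun setT (fun z => (g z)%:E) by exact/measurable_EFinP.
  have mgcE : measurable_fun setT (fun z => (c z.1 * g (z.1, phi z.1 z.2))%:E).
    by apply/measurable_EFinP; exact: mcP.
  have gE0 z : (0 <= (g z)%:E)%E by rewrite lee_fin.
  have gcE0 z : (0 <= (c z.1 * g (z.1, phi z.1 z.2))%:E)%E by rewrite lee_fin mulr_ge0.
  rewrite (@fubini_tonelli1 _ _ _ _ _ m m _ mgE gE0).
  rewrite (@fubini_tonelli1 _ _ _ _ _ m m _ mgcE gcE0); apply: eq_integral => x _.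
  rewrite /fubini_F/=; apply: (phi_inv x (fun y => g (x, y))) => //.
  exact: measurableT_comp mg (measurable_pair1 x).
split.
  apply/integrableP; split; first by apply/measurable_EFinP; exact: mcP.
  have ma : measurable_fun setT (fun z => `|f z|) by exact: measurableT_comp.
  have := ge0E _ ma (fun z => normr_ge0 _).
  under [X in _ = X -> _]eq_integral do rewrite -[c _]ger0_norm// -normrM.
  move=> E; under eq_integral do rewrite abse_EFin.
  by rewrite -E; case/integrableP: fi.
have maxE (x : R) : (maxe x%:E 0 = (Num.max x 0)%:E)%E by rewrite -EFin_max.
rewrite integralE [RHS]integralE; congr (_ - _)%E.
  have mp : measurable_fun setT (fun z => Num.max (f z) 0) by exact: measurable_maxr.
  have p0 z : 0 <= Num.max (f z) 0 by rewrite le_max lexx orbT.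
  under eq_integral do rewrite funeposE maxE.
  under [RHS]eq_integral do rewrite funeposE maxE.
  rewrite (ge0E _ mp p0); apply: eq_integral => z _; congr EFin.
  by rewrite maxr_pMr// mulr0.
have mp : measurable_fun setT (fun z => Num.max (- f z) 0).
  by apply: measurable_maxr => //; exact: measurable_funN.
have p0 z : 0 <= Num.max (- f z) 0 by rewrite le_max lexx orbT.
under eq_integral do rewrite funenegE -EFinN maxE.
under [RHS]eq_integral do rewrite funenegE -EFinN maxE.
rewrite (ge0E _ mp p0); apply: eq_integral => z _; congr EFin.
by rewrite maxr_pMr// mulr0 mulrN.
Qed.

End fibrewise_substitution.

Section frullani.
Context {R : realType}.
Local Notation lam := (@lebesgue_measure R).

(** The integrand of [int_1^(1/r) dt/t = - log r], written as a function of both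
    variables in order to be used under Tonelli. *)
Definition log_kernel (r t : R) : R :=
  \1_(`[1, +oo[%classic : set R) t * (\1_(`]-oo, 1[%classic : set R) (r * t) * pospow t (-1)).

Definition log_length (r : R) : R := \int[lam]_t log_kernel r t.

Lemma log_kernel_ge0 r t : 0 <= log_kernel r t.
Proof. by rewrite !mulr_ge0// pospow_ge0. Qed.

Lemma measurable_log_kernel : measurable_fun setT (fun z : R * R => log_kernel z.1 z.2).
Proof.
apply: measurable_funM.
  by apply: (measurableT_comp _ measurable_snd); exact: measurable_indic.
apply: measurable_funM; last first.
  exact: (measurableT_comp (measurable_pospow _) measurable_snd).
apply: (@measurableT_comp _ _ _ _ _ _ (\1_(`]-oo, 1[%classic : set R) : R -> R)).
  exact: measurable_indic.
by apply: measurable_funM; [exact: measurable_fst|exact: measurable_snd].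
Qed.

Lemma measurable_log_kernelr (r : R) : measurable_fun setT (log_kernel r).
Proof. exact: (measurableT_comp measurable_log_kernel (measurable_pair1 r)). Qed.

Lemma log_kernel_integrable (r : R) : 0 < r ->
  lam.-integrable setT (fun t => (log_kernel r t)%:E).
Proof.
move=> r0; apply: (le_integrableR measurableT _ _ (@integrable_pospow_box R r^-1 0 _)).
- exact: measurable_log_kernelr.
- move=> t _; rewrite ger0_norm ?log_kernel_ge0// /log_kernel.
  rewrite !indicE; case: (boolP (_ \in _)); rewrite ?mul0r ?mulr_ge0 ?pospow_ge0//.
  rewrite inE/= in_itv/= andbT mul1r => t1.
  have t0 : 0 < t by exact: lt_le_trans t1.
  case: (boolP (_ \in _)); rewrite ?mul0r ?mulr_ge0 ?pospow_ge0//.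
  rewrite inE/= in_itv/= => rt; rewrite mem_set ?pospowE// ?powRr0 ?mul1r//=.
    by rewrite powRN powRr1 ?(ltW t0)// invf_le1.
  have tr : t <= r^-1 by rewrite -(mulr1 r^-1) ler_pdivlMl// ltW.
  by rewrite in_itv/= tr andbT (le_trans _ (ltW t0))// oppr_le0 invr_ge0 ltW.
- lra.
Qed.

Lemma log_lengthE (r : R) : 0 < r ->
  (\int[lam]_t (log_kernel r t)%:E = (log_length r)%:E)%E.
Proof.
move=> r0; rewrite /log_length /Rintegral fineK//.
exact: integrable_fin_num (log_kernel_integrable r0).
Qed.

Lemma log_length_scale (r M : R) : 0 < r -> 0 < M ->
  lam.-integrable setT (fun a => (M^-1 * log_kernel r (M^-1 * a))%:E) /\
  (\int[lam]_a (M^-1 * log_kernel r (M^-1 * a))%:E = (log_length r)%:E)%E.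
Proof.
move=> r0 M0; have li := log_kernel_integrable r0.
have MN0 : M^-1 != 0 by rewrite invr_eq0 gt_eqF.
have [i1 E1] := @lam_affine _ M^-1 0 (log_kernel r) MN0 li.
have E a : M^-1 * log_kernel r (M^-1 * a) = M^-1 * log_kernel r (M^-1 * a + 0) by rewrite addr0.
split; first by apply: eq_integrable (integrableRZ measurableT M^-1 i1) => // a _; rewrite E.
under eq_integral do rewrite E EFinM.
rewrite (integralZl measurableT i1) E1 muleA -EFinM ger0_norm ?invr_ge0 ?(ltW M0)//.
by rewrite (mulfV MN0) mul1e log_lengthE.
Qed.

Variables (f : R -> R) (M C d : R).
Hypotheses (mf : measurable_fun setT f) (M0 : 0 < M) (d0 : 0 < d).
Hypothesis f_holder : forall a b, `|f a - f b| <= C * `|a - b| `^ d.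
Hypothesis f_supp : forall a, M <= `|a| -> f a = 0.

(* Subtracting the constant [f 0] on ]0, M[ removes the singularity at 0. *)
Let fz (a : R) := pospow a (-1) * (f a - f 0 * \1_(`]-oo, M[%classic : set R) a).

Let fzi : lam.-integrable setT (fun a => (fz a)%:E).
Proof.
apply: (le_integrableR measurableT _ _ (integrableRZ measurableT C (@integrable_pospow_box R M (d - 1) _))).
- apply: measurable_funM; first exact: measurable_pospow.
  by apply: measurable_funB => //; apply: measurable_funM => //; exact: measurable_indic.
- have C0 : 0 <= C.
    have := f_holder 1 0; rewrite subr0 normr1 powR1 mulr1; exact: le_trans.
  have p0 a : 0 <= C * (\1_(`[- M, M]%classic : set R) a * pospow a (d - 1)).
    by rewrite !mulr_ge0 ?pospow_ge0.
  move=> a _; rewrite /fz.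
  have [a0|a0] := leP a 0; first by rewrite pospow_le0// mul0r normr0.
  rewrite indicE; case: (boolP (_ \in _)).
    rewrite inE/= in_itv/= => aM; rewrite mulr1 normrM (ger0_norm (pospow_ge0 _ _)) mulrC.
    rewrite indicE mem_set ?mul1r ?pospowE//=; last first.
      by rewrite in_itv/= (ltW aM) andbT; lra.
    rewrite ?pospowE// powRD ?(gt_eqF a0) ?implybT// mulrA.
    rewrite ler_wpM2r ?powR_ge0//.
    by have := f_holder a 0; rewrite subr0 (gtr0_norm a0).
  rewrite notin_setE/= in_itv/= => /negP; rewrite -leNgt => Ma.
  by rewrite mulr0 subr0 f_supp ?mulr0 ?normr0//; rewrite (gtr0_norm a0).
- by move: d0; lra.
Qed.

(** After subtraction of [f 0] on ]0, M[, the integrals of [f a / a] and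
    [f (r a) / a] converge and coincide, by dilation. The subtracted terms differ
    exactly for [M <= a < M / r], where they leave [- f 0 / a]. *)
Lemma frullani (r : R) : 0 < r < 1 ->
  lam.-integrable setT (fun a => (pospow a (-1) * (f a - f (r * a)))%:E) /\
  (\int[lam]_a (pospow a (-1) * (f a - f (r * a)))%:E =
   (- f 0 * log_length r)%:E)%E.
Proof.
move=> /andP[r0 r1]; have rN0 : r != 0 by rewrite gt_eqF.
have [sci scE] := lam_affine 0 rN0 fzi.
have [li lE] := log_length_scale r0 M0.
have E a : pospow a (-1) * (f a - f (r * a)) =
    fz a - r * fz (r * a + 0) - f 0 * (M^-1 * log_kernel r (M^-1 * a)).
  rewrite addr0 /fz /log_kernel.
  rewrite pospowM// pospowM ?invr_gt0// !powRN !powRr1 ?invr_ge0 ?(ltW M0) ?(ltW r0)// invrK.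
  rewrite (@indic_iff R _ _ _ (`]-oo, M[%classic : set R) (r * (M^-1 * a)) (r * a)); last first.
    by rewrite /= !in_itv/= mulrCA ltr_pdivrMl// mulr1.
  rewrite (@indic_iff R _ _ _ (`[M, +oo[%classic : set R) (M^-1 * a) a); last first.
    by rewrite /= !in_itv/= !andbT ler_pdivlMl// mulr1.
  have -> : \1_(`[M, +oo[%classic : set R) a = (M <= a)%R%:R :> R.
    by rewrite indicE mem_setE/= in_itv/= andbT.
  rewrite [\1_(`]-oo, M[) a]indicE mem_setE/= in_itv/=.
  rewrite [\1_(`]-oo, M[) (r * a)]indicE mem_setE/= in_itv/=.
  case: (leP a 0) => a0; first by rewrite pospow_le0//; ring.
  have MN : M != 0 by rewrite gt_eqF.
  have ra : r * a < a by rewrite gtr_pMl.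
  rewrite (leNgt M a); case: (ltP a M) => aM/=.
    by rewrite (lt_trans ra aM)/=; field; rewrite ?rN0 ?MN.
  by case: (ltP (r * a) M) => raM/=; field; rewrite ?rN0 ?MN.
have sci' := integrableRZ measurableT r sci.
have lfi := integrableRZ measurableT (f 0) li.
split.
  apply: eq_integrable (integrableRB measurableT (integrableRB measurableT fzi sci') lfi) => // a _.
  by rewrite E.
under eq_integral do rewrite E.
rewrite (_ : (fun a => _) = (fun a => ((fz a - r * fz (r * a + 0))%:E - (f 0 * (M^-1 * log_kernel r (M^-1 * a)))%:E)%E)); last first.
  by apply/funext => a; rewrite EFinB.
rewrite integralB//; last exact: (integrableRB measurableT fzi sci').
under [X in (X - _)%E]eq_integral do rewrite EFinB.
rewrite integralB//.
under [X in (_ - X - _)%E]eq_integral do rewrite EFinM.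
under [X in (_ - _ - X)%E]eq_integral do rewrite EFinM.
rewrite integralZl// scE integralZl// lE muleA -EFinM gtr0_norm// mulfV// mul1e.
rewrite subee; last exact: integrable_fin_num.
by rewrite sub0e -EFinM -EFinN mulNr.
Qed.

End frullani.

Lemma ge0_integral_dilate (R : realType) (t : R) (f : R -> R) :
  0 < t -> measurable_fun setT f -> (forall x, 0 <= f x) ->
  (\int[lebesgue_measure]_x (f x)%:E =
   \int[lebesgue_measure]_x (t * f (t * x + 0)%R)%:E)%E.
Proof.
move=> t0 mf f0; have tN : t != 0 by rewrite gt_eqF.
have mfE : measurable_fun setT (fun x => (f x)%:E) by exact/measurable_EFinP.
have fE0 (x : R) : (0 <= (f x)%:E)%E by rewrite lee_fin.
have mft : measurable_fun setT (fun x => (f (t * x + 0))%:E).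
  exact: (measurableT_comp mfE (measurable_affine t 0)).
under [RHS]eq_integral do rewrite EFinM.
rewrite (ge0_integralZl_EFin lebesgue_measure measurableT (fun x _ => fE0 _) mft (ltW t0)).
rewrite (@ge0_integral_affine R t 0 (fun x => (f x)%:E) tN mfE fE0).
by rewrite muleA -EFinM (gtr0_norm t0) mulfV// mul1e.
Qed.

Section the_constant.
Context {R : realType}.
Local Notation lam := (@lebesgue_measure R).
Variable s : R.
Hypothesis s01 : 0 < s < 1.

(** The part of the double integral [c_s] that does not involve [t] once [r] has
    been replaced by [t r]. *)
Definition beta_density (r : R) : R :=
  \1_(`]0, 1[%classic : set R) r * (r `^ (s - 1) * `|1 - r| `^ (- (2 * s))).

Lemma beta_density_ge0 r : 0 <= beta_density r.
Proof. by rewrite !mulr_ge0 ?powR_ge0. Qed.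

Lemma measurable_beta_density : measurable_fun setT beta_density.
Proof.
apply: measurable_funM; first exact: measurable_indic.
apply: measurable_funM; first exact: measurable_powR.
apply: (measurableT_comp (measurable_powR _)).
apply: (measurableT_comp (@normr_measurable R setT)).
exact: measurable_funB.
Qed.

(* the integrand of [c_s] *)
Let A (z : R * R) : R := \1_(`]0, 1[%classic : set R) z.1 * z.1 `^ (s - 1) *
  (\1_(`[1, +oo[%classic : set R) z.2 * (z.2 `^ (s - 1) * `|z.1 - z.2| `^ (- (2 * s)))).

Let A0 z : 0 <= A z. Proof. by rewrite !mulr_ge0 ?powR_ge0. Qed.

Let mA : measurable_fun setT A.
Proof.
have m1 := @measurable_fst _ _ R R. have m2 := @measurable_snd _ _ R R.
apply: measurable_funM; first apply: measurable_funM.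
- by apply: (measurableT_comp _ m1); exact: measurable_indic.
- exact: (measurableT_comp (measurable_powR (s - 1)) m1).
apply: measurable_funM.
- by apply: (measurableT_comp _ m2); exact: measurable_indic.
apply: measurable_funM.
- exact: (measurableT_comp (measurable_powR (s - 1)) m2).
apply: (measurableT_comp (measurable_powR _)).
apply: (measurableT_comp (@normr_measurable R setT)).
by apply: measurable_funB; [exact: m1|exact: m2].
Qed.

Let inner (r : R) : 0 < r < 1 ->
  ((\int[lam]_(t in `]1, +oo[%classic) (t `^ (s - 1) * `|r - t| `^ (- (2 * s))))%:E =
   \int[lam]_t (\1_(`[1, +oo[%classic : set R) t * (t `^ (s - 1) * `|r - t| `^ (- (2 * s))))%:E)%E.
Proof.
move=> /andP[r0 r1].
pose k t := t `^ (s - 1) * `|r - t| `^ (- (2 * s)).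
have mk : measurable_fun setT k.
  apply: measurable_funM; first exact: measurable_powR.
  apply: (measurableT_comp (measurable_powR _)).
  apply: (measurableT_comp (@normr_measurable R setT)).
  exact: measurable_funB.
have p1 : - s - 1 < -1 :> R by move: s01 => /andP[? ?]; lra.
have ki : lam.-integrable setT (fun t => (\1_(`[1, +oo[%classic : set R) t * k t)%:E).
  apply: (le_integrableR measurableT _ _ (integrableRZ measurableT ((1 - r) `^ (- (2 * s)))
    (integrable_powR_1y p1))).
  - by apply: measurable_funM => //; exact: measurable_indic.
  - move=> t _; rewrite ger0_norm ?mulr_ge0 ?powR_ge0// indicE.
    case: (boolP (_ \in _)); rewrite ?mul0r ?mulr0// inE/= in_itv/= andbT !mul1r => t1.
    have t0 : 0 < t by exact: lt_le_trans t1.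
    have r10 : 0 < 1 - r by rewrite subr_gt0.
    rewrite (_ : - s - 1 = (s - 1) + - (2 * s)); last by ring.
    rewrite powRD ?(gt_eqF t0) ?implybT// mulrCA ler_wpM2l ?powR_ge0//.
    rewrite -powRM ?(ltW r10) ?(ltW t0)// !powRN.
    have st0 : 0 < (1 - r) * t by rewrite mulr_gt0.
    have tr : 0 < t - r by rewrite subr_gt0 (lt_le_trans r1).
    rewrite distrC (gtr0_norm tr) lef_pV2 ?posrE ?powR_gt0//.
    have s2 : 0 <= 2 * s by move: s01 => /andP[? ?]; lra.
    apply: ge0_ler_powR; rewrite ?nnegrE ?(ltW st0) ?(ltW tr)//.
    rewrite mulrBl mul1r lerD2l lerN2 -[leLHS]mulr1 ler_wpM2l ?(ltW r0)//.
have oE : \int[lam]_(t in `]1, +oo[%classic) k t = \int[lam]_(t in `[1, +oo[%classic) k t.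
  apply: (@Rintegral_itv_obnd_cbnd R 1 (BInfty R false) k).
  apply/integrable_mkcond => //.
  have := @integrable_cut R _ _ lam (`]1, +oo[%classic) _ (measurable_itv _) ki.
  apply: eq_integrable => // t _; rewrite patchE !indicE.
  case: (boolP (t \in `]1, +oo[%classic)); rewrite ?mul0r//.
  rewrite inE/= in_itv/= andbT => t1.
  by rewrite mem_set ?mul1r//= in_itv/= (ltW t1).
rewrite [X in X%:E = _]oE Rintegral_indic /Rintegral fineK//; exact: integrable_fin_num.
Qed.

Let beta_le0 (r : R) : r <= 0 -> beta_density r = 0.
Proof.
move=> r0; rewrite /beta_density indicE memNset ?mul0r//.
by rewrite /= in_itv/= ltNge r0.
Qed.

Let A_lt1 (r t : R) : t < 1 -> A (r, t) = beta_density r * log_kernel r t.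
Proof.
move=> t1; rewrite /A /log_kernel indicE.
have -> : \1_(`[1, +oo[%classic : set R) t = 0 :> R.
  by rewrite indicE memNset//= in_itv/= andbT leNgt t1.
by rewrite !mul0r !mulr0.
Qed.

Let A_scale (r t : R) : 1 <= t -> t * A (t * r + 0, t) = beta_density r * log_kernel r t.
Proof.
move=> t1; have t0 : 0 < t by exact: lt_le_trans t1.
rewrite addr0 /A /beta_density /log_kernel/=.
rewrite [\1_(`[1, +oo[) t]indicE mem_set ?mul1r/=; last by rewrite in_itv/= andbT.
rewrite [\1_(`]0, 1[) (t * r)]indicE [\1_(`]0, 1[) r]indicE [\1_(`]-oo, 1[) (r * t)]indicE.
rewrite !mem_setE/= !in_itv/= pmulr_rgt0// (mulrC r t).
have [r0|r0] := ltP 0 r; last by rewrite !mul0r ?mulr0.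
have [tr|tr] := ltP (t * r) 1; rewrite /= ?mul0r ?mulr0//.
have r1 : r < 1 by rewrite (le_lt_trans _ tr)// ler_peMl// ltW.
rewrite r1/= !mul1r powRM ?(ltW t0) ?(ltW r0)// pospowE//.
have -> : t * r - t = t * (r - 1) by rewrite mulrBr mulr1.
rewrite normrM (gtr0_norm t0) powRM ?(ltW t0)// (distrC r 1).
have -> : t `^ (-1) = t * t `^ (s - 1) * (t `^ (s - 1) * t `^ (- (2 * s))).
  rewrite -{2}(powRr1 (ltW t0)) -!powRD ?(gt_eqF t0) ?implybT//.
  by congr (_ `^ _); ring.
ring.
Qed.

(** Exchange the integrals, substitute [r = t r'] in the inner one, and exchange
    them again; the constraint [t r' < 1] becomes [t < 1 / r']. *)
Lemma c_sE : c_s s = \int[lam]_r (beta_density r * log_length r).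
Proof.
rewrite /c_s Rintegral_indic; congr fine.
transitivity (\int[lam]_r \int[lam]_t (A (r, t))%:E)%E.
  apply: eq_integral => r _; rewrite /A/=.
  rewrite indicE; case: (boolP (_ \in _)) => [|_]; last first.
    by rewrite mul0r; under eq_integral do rewrite mul0r mul0r; rewrite integral0.
  rewrite inE/= in_itv/= => r01; rewrite EFinM mul1r EFinM inner// -ge0_integralZl_EFin ?powR_ge0//.
  - by rewrite mul1e; apply: eq_integral => t _; rewrite -EFinM.
  - by move=> t _; rewrite lee_fin !mulr_ge0 ?powR_ge0.
  - apply/measurable_EFinP; apply: measurable_funM; first exact: measurable_indic.
    apply: measurable_funM; first exact: measurable_powR.
    apply: (measurableT_comp (measurable_powR _)).
    apply: (measurableT_comp (@normr_measurable R setT)).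
    exact: measurable_funB.
pose B (z : R * R) := beta_density z.1 * log_kernel z.1 z.2.
have B0 z : 0 <= B z by rewrite mulr_ge0 ?beta_density_ge0 ?log_kernel_ge0.
have mB : measurable_fun setT B.
  apply: measurable_funM; last exact: measurable_log_kernel.
  exact: measurableT_comp measurable_beta_density measurable_fst.
have tonA : (\int[lam]_r \int[lam]_t (A (r, t))%:E = \int[lam]_t \int[lam]_r (A (r, t))%:E)%E.
  apply: (@fubini_tonelli _ _ _ _ _ lam lam (fun z => (A z)%:E)).
    exact/measurable_EFinP.
  by move=> z; rewrite lee_fin.
have tonB : (\int[lam]_r \int[lam]_t (B (r, t))%:E = \int[lam]_t \int[lam]_r (B (r, t))%:E)%E.
  apply: (@fubini_tonelli _ _ _ _ _ lam lam (fun z => (B z)%:E)).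
    exact/measurable_EFinP.
  by move=> z; rewrite lee_fin.
rewrite tonA; transitivity (\int[lam]_t \int[lam]_r (B (r, t))%:E)%E; last first.
  rewrite -tonB; apply: eq_integral => r _; rewrite /B/=.
  under eq_integral do rewrite EFinM.
  have mlr : measurable_fun setT (fun t => (log_kernel r t)%:E).
    by have /measurable_EFinP := measurable_log_kernelr r.
  have l0 t : setT t -> (0 <= (log_kernel r t)%:E)%E by rewrite lee_fin log_kernel_ge0.
  rewrite (ge0_integralZl_EFin lam measurableT l0 mlr (beta_density_ge0 r)).
  have [r0|r0] := ltP 0 r.
    by rewrite (log_lengthE r0) -EFinM.
  by rewrite (beta_le0 r0) mul0e mul0r.
apply: eq_integral => t _; have [t1|t1] := leP 1 t; last first.
  by apply: eq_integral => r _; rewrite (A_lt1 r t1).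
have t0 : 0 < t by exact: lt_le_trans t1.
rewrite (ge0_integral_dilate t0 (measurableT_comp mA (measurable_pair2 t)) (fun r => A0 _)).
by apply: eq_integral => r _; rewrite (A_scale r t1).
Qed.

End the_constant.

(** * The boundary term on the line *)

(** The larger of the points [a] and [a - t] is at distance at least [`|t|] from
    the origin, and the weight decreases. *)
Lemma shifted_weights_le (R : realType) (s a t : R) : s < 1 -> t != 0 ->
  pospow a (s - 1) * pospow (a - t) (s - 1) <=
  `|t| `^ (s - 1) * (pospow a (s - 1) + pospow (a - t) (s - 1)).
Proof.
move=> s1 t0; have tp : 0 < `|t| by rewrite normr_gt0.
have p0 : s - 1 <= 0 by lra.
have dec (x y : R) : 0 < x -> x <= y -> y `^ (s - 1) <= x `^ (s - 1).
  move=> x0 xy; have y0 := lt_le_trans x0 xy.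
  rewrite -(opprB 1 s) !powRN lef_pV2 ?posrE ?powR_gt0//.
  by apply: ge0_ler_powR; rewrite ?nnegrE ?(ltW x0) ?(ltW y0)// -oppr_le0 opprB.
have R0 x : 0 <= pospow x (s - 1) by exact: pospow_ge0.
have [a0|a0] := leP a 0; first by rewrite (pospow_le0 _ a0) mul0r !mulr_ge0 ?addr_ge0 ?powR_ge0.
have [b0|b0] := leP (a - t) 0.
  by rewrite (pospow_le0 _ b0) mulr0 mulr_ge0 ?addr_ge0 ?powR_ge0.
rewrite !pospowE// mulrDr.
have [tn|tn] := leP t 0.
  have at' : `|t| <= a - t by rewrite ler0_norm//; lra.
  apply: (@le_trans _ _ (`|t| `^ (s - 1) * a `^ (s - 1))); last by rewrite lerDl mulr_ge0 ?powR_ge0.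
  by rewrite mulrC ler_wpM2r ?powR_ge0//; exact: dec.
have at' : `|t| <= a by rewrite gtr0_norm//; lra.
apply: (@le_trans _ _ (`|t| `^ (s - 1) * (a - t) `^ (s - 1))); last by rewrite lerDr mulr_ge0 ?powR_ge0.
by rewrite ler_wpM2r ?powR_ge0//; exact: dec.
Qed.

Section half_line_form.
Context {R : realType}.
Local Notation lam := (@lebesgue_measure R).
Variables (s q M C : R) (f : R -> R).
Hypotheses (s01 : 0 < s < 1) (q1 : 1 < q) (q2s : 2 * s < q) (qs1 : q < 1 + s).
Hypotheses (mf : measurable_fun setT f) (M0 : 0 < M).
Hypothesis f_holder : forall a b, `|f a - f b| <= C * `|a - b| `^ (q - 1).
Hypothesis f_supp : forall a, M <= `|a| -> f a = 0.

Let C0 : 0 <= C.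
Proof. by have := f_holder 1 0; rewrite subr0 normr1 powR1 mulr1; exact: le_trans. Qed.

(** The kernel is the odd function [sgn(t) |t|^(-2s)], written in the form which
    is homogeneous at [t = 0] as well. *)
Definition half_form (z : R * R) : R :=
  pospow z.1 (s - 1) * pospow z.2 (s - 1) * (f z.1 - f z.2) *
  ((z.1 - z.2) * `|z.1 - z.2| `^ (- 1 - 2 * s)).

Let ker_norm (t : R) : `|t| * `|t| `^ (- 1 - 2 * s) = `|t| `^ (- (2 * s)).
Proof.
have [->|t0] := eqVneq t 0.
  by rewrite normr0 mul0r powR0//; move: s01 => /andP[? ?]; rewrite oppr_eq0; lra.
rewrite -{1}(powRr1 (normr_ge0 t)) -powRD ?normr_eq0 ?t0 ?implybT//.
by congr (_ `^ _); ring.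
Qed.

Let m_shift : measurable_fun setT (fun z : R * R => z.1 - z.2).
Proof. by apply: measurable_funB; [exact: measurable_fst|exact: measurable_snd]. Qed.

Let m_ker (D : R * R -> R) : measurable_fun setT D ->
  measurable_fun setT (fun z => D z * `|D z| `^ (- 1 - 2 * s)).
Proof.
move=> mD; apply: measurable_funM => //; apply: (measurableT_comp (measurable_powR _)).
exact: (measurableT_comp (@normr_measurable R setT)).
Qed.

Lemma half_form_integrable : (lam \x lam)%E.-integrable setT (fun z => (half_form z)%:E).
Proof.
have m1 := @measurable_fst _ _ R R. have m2 := @measurable_snd _ _ R R.
apply: (le_integrableR measurableT _ _ (integrableRZ measurableT C (majorant1_integrable M s01 q1 q2s qs1))).
- apply: measurable_funM; last exact: m_ker.
  apply: measurable_funM; last first.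
    by apply: measurable_funB; [exact: measurableT_comp mf m1|exact: measurableT_comp mf m2].
  by apply: measurable_funM;
    [exact: (measurableT_comp (measurable_pospow (s - 1)) m1)
    |exact: (measurableT_comp (measurable_pospow (s - 1)) m2)].
- move=> z _; rewrite /half_form /majorant1 !normrM !(ger0_norm (pospow_ge0 _ _)).
  rewrite (ger0_norm (powR_ge0 _ _)) ker_norm.
  set W := pospow z.1 _ * pospow z.2 _.
  have W0 : 0 <= W by rewrite mulr_ge0 ?pospow_ge0.
  set S := \1_(`[- M, M]%classic : set R) z.1 + \1_(`[- M, M]%classic : set R) z.2.
  have fS : `|f z.1 - f z.2| <= C * `|z.1 - z.2| `^ (q - 1) * S.
    have S0 : 0 <= C * `|z.1 - z.2| `^ (q - 1) by rewrite mulr_ge0 ?powR_ge0.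
    have [|z1M] := leP M `|z.1|; last first.
      apply: le_trans (f_holder z.1 z.2) _; rewrite ler_peMr// /S indicE mem_set ?lerDl//=.
      by rewrite in_itv/= -ler_norml ltW.
    have [|z2M] := leP M `|z.2|; last first.
      move=> _; apply: le_trans (f_holder z.1 z.2) _; rewrite ler_peMr// /S addrC indicE mem_set ?lerDl//=.
      by rewrite in_itv/= -ler_norml ltW.
    by move=> z2M z1M; rewrite !f_supp// subrr normr0 !mulr_ge0 ?addr_ge0.
  have kE : `|z.1 - z.2| `^ (q - 1) * `|z.1 - z.2| `^ (- (2 * s)) = `|z.1 - z.2| `^ (q - 1 - 2 * s).
    have [->|n0] := eqVneq (z.1 - z.2) 0.
      rewrite normr0 (@powR0 _ (q - 1)) ?mul0r ?powR0//; move: q1 qs1 s01 => ? ? /andP[? ?].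
        by rewrite lt_eqF//; lra.
      by rewrite gt_eqF//; lra.
    by rewrite -powRD// normr_eq0 n0 implybT.
  rewrite -kE; apply: (@le_trans _ _ (W * (C * `|z.1 - z.2| `^ (q - 1) * S) * `|z.1 - z.2| `^ (- (2 * s)))).
    by rewrite ler_wpM2r ?powR_ge0// ler_wpM2l.
  by rewrite le_eqVlt; apply/orP; left; apply/eqP; ring.
Qed.

Let half_form_sym (a b : R) : half_form (b, a) = half_form (a, b).
Proof. by rewrite /half_form/= (distrC b a); ring. Qed.

(* the half of [half_form] on [z.2 < z.1]; the other half is its mirror image *)
Let below (z : R * R) : R := \1_(`]0, +oo[%classic : set R) (z.1 - z.2) * half_form z.

Let m_below_indic : measurable_fun setT
  (fun z : R * R => \1_(`]0, +oo[%classic : set R) (z.1 - z.2) : R).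
Proof.
apply: (@measurableT_comp _ _ _ _ _ _ (\1_(`]0, +oo[%classic : set R) : R -> R)) => //.
Qed.

Let below_integrable : (lam \x lam)%E.-integrable setT (fun z => (below z)%:E).
Proof.
apply: (le_integrableR measurableT _ _ (integrable_abse half_form_integrable)).
- apply: measurable_funM; first exact: m_below_indic.
  by have /measurable_EFinP := measurable_int _ half_form_integrable.
- move=> z _; rewrite normrM ler_piMl// indicE.
  by case: (_ \in _); rewrite ?normr0 ?normr1.
Qed.

Let half_form_below (a b : R) : half_form (a, b) = below (a, b) + below (b, a).
Proof.
rewrite /below/= half_form_sym -mulrDl; have [->|ab] := eqVneq a b.
  by rewrite /half_form /= subrr mulr0 mul0r mulr0.
rewrite !indicE !mem_setE/= !in_itv/= !andbT !subr_gt0.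
by case: (ltgtP a b) ab => //= _ _; rewrite ?addr0 ?add0r mul1r.
Qed.

Lemma integral_prod_swap d (T : measurableType d) (m : {sigma_finite_measure set T -> \bar R})
    (h : T * T -> R) : (m \x m)%E.-integrable setT (fun z => (h z)%:E) ->
  (\int[(m \x m)%E]_z (h (z.2, z.1))%:E = \int[(m \x m)%E]_z (h z)%:E)%E.
Proof.
move=> hi; rewrite -(integral12_prod_meas1 hi).
by rewrite -(integral21_prod_meas1 (integrable_swap hi)).
Qed.

Let half_form_two : (\int[(lam \x lam)%E]_z (half_form z)%:E =
  2%:E * \int[(lam \x lam)%E]_z (below z)%:E)%E.
Proof.
have sw := integrable_swap below_integrable.
transitivity (\int[(lam \x lam)%E]_z ((below z)%:E + (below (z.2, z.1))%:E))%E.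
  by apply: eq_integral => -[a b] _; rewrite -EFinD half_form_below.
rewrite (integralD measurableT below_integrable sw) (integral_prod_swap below_integrable).
by rewrite -[X in (X + _)%E]mul1e -[X in (_ + X)%E]mul1e -ge0_muleDl// -EFinD.
Qed.

(* [below] is supported in [0 < a]; the value 1 elsewhere makes
   b = stretch a * r a genuine substitution for every [a]. *)
Let stretch (a : R) : R := if 0 < a then a else 1.

Let stretch_gt0 a : 0 < stretch a.
Proof. by rewrite /stretch; case: ifP. Qed.

Let m_stretch : measurable_fun setT stretch.
Proof.
by apply: measurable_fun_ifT => //; exact: measurable_fun_ltr.
Qed.

(* The powers of [a] in [a^(s-1) (r a)^(s-1) (a - r a)^(-2s)] times the Jacobian
   [a] add up to [a^(-1)]: this is what makes the Frullani integral appear. *)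
Let below_stretch (a r : R) : stretch a * below (a, stretch a * r) =
  beta_density s r * (pospow a (-1) * (f a - f (r * a))).
Proof.
rewrite /stretch; case: ifPn => [a0|]; last first.
  by rewrite -leNgt => a0; rewrite /below /half_form/= !(pospow_le0 _ a0) !mul0r !mulr0.
have aN : a != 0 by rewrite gt_eqF.
rewrite /below /half_form/= /beta_density.
have -> : a - a * r = a * (1 - r) by ring.
rewrite normrM (gtr0_norm a0) powRM ?(ltW a0)// pospowM// (mulrC r a) !(pospowE _ a0).
rewrite !indicE !mem_setE/= !in_itv/= andbT pmulr_rgt0// subr_gt0.
have [r0|r0] := leP r 0; first by rewrite (pospow_le0 _ r0) /= !mul0r !mulr0 !mul0r !mulr0.
rewrite (pospowE _ r0); have [r1|r1] := ltP r 1; last by rewrite !mul0r ?mulr0.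
rewrite /= !mul1r -ker_norm (gtr0_norm (_ : 0 < 1 - r)) ?subr_gt0//.
have -> : a `^ (-1) = a * a * a `^ (s - 1) * a `^ (s - 1) * a `^ (- 1 - 2 * s).
  rewrite -{2 3}(powRr1 (ltW a0)) -!powRD ?aN ?implybT//.
  by congr (_ `^ _); ring.
ring.
Qed.

Let scaled_integrable : (lam \x lam)%E.-integrable setT
    (fun z => (beta_density s z.2 * (pospow z.1 (-1) * (f z.1 - f (z.2 * z.1))))%:E) /\
  (\int[(lam \x lam)%E]_z (below z)%:E =
   \int[(lam \x lam)%E]_z (beta_density s z.2 * (pospow z.1 (-1) * (f z.1 - f (z.2 * z.1))))%:E)%E.
Proof.
have mphi : measurable_fun setT (fun z : R * R => stretch z.1 * z.2).
  apply: measurable_funM; last exact: measurable_snd.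
  exact: measurableT_comp m_stretch measurable_fst.
have [|i1 E1] := @integral_fiber R _ _ lam stretch (fun a r => stretch a * r)
    m_stretch (fun a => ltW (stretch_gt0 a)) mphi _ below below_integrable.
  move=> a F mF F0; rewrite (ge0_integral_dilate (stretch_gt0 a) mF F0).
  by apply: eq_integral => r _; rewrite addr0.
split; first by apply: eq_integrable i1 => // -[a r] _; rewrite below_stretch.
by rewrite E1; apply: eq_integral => -[a r] _; rewrite below_stretch.
Qed.

Let inner_frullani (r : R) :
  (\int[lam]_a (beta_density s r * (pospow a (-1) * (f a - f (r * a))))%:E =
   (- f 0 * (beta_density s r * log_length r))%:E)%E.
Proof.
have [r01|rN] := boolP (0 < r < 1); last first.
  have b0 : beta_density s r = 0.
    by rewrite /beta_density indicE memNset ?mul0r//= in_itv/=; exact/negP.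
  under eq_integral do rewrite b0 mul0r.
  by rewrite integral0 b0 mul0r mulr0.
have d0 : 0 < q - 1 by move: q1; lra.
have [fi fE] := frullani mf M0 d0 f_holder f_supp r01.
under eq_integral do rewrite EFinM.
by rewrite (integralZl measurableT fi) fE -EFinM; congr EFin; ring.
Qed.

(** Fubini, the Frullani integral for each ratio [r], and the form of [c_s] found
    above. *)
Lemma half_formE :
  (\int[(lam \x lam)%E]_z (half_form z)%:E = (- (2 * c_s s * f 0))%:E)%E.
Proof.
have [hi hE] := scaled_integrable.
rewrite half_form_two hE -(integral21_prod_meas1 hi).
have bi : lam.-integrable setT (fun r => (- f 0 * (beta_density s r * log_length r))%:E).
  apply: eq_integrable (integrable_fubini_F (integrable_swap hi)) => // r _.
  by rewrite /fubini_F/= inner_frullani.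
transitivity (2%:E * \int[lam]_r (- f 0 * (beta_density s r * log_length r))%:E)%E.
  by congr (_ * _)%E; apply: eq_integral => r _; rewrite /fubini_G/= inner_frullani.
(* integrability of the density in [r] is read off from Fubini, which gives
   it only up to the factor [f 0] *)
rewrite (c_sE s01); have [f0|f0] := eqVneq (f 0) 0.
  under eq_integral do rewrite f0 oppr0 mul0r.
  by rewrite integral0 mule0 f0 mulr0 oppr0.
have fN0 : - f 0 != 0 by rewrite oppr_eq0.
have bi' : lam.-integrable setT (fun r => (beta_density s r * log_length r)%:E).
  apply: eq_integrable (integrableRZ measurableT (- f 0)^-1 bi) => // r _.
  by rewrite mulrA mulVf// mul1r.
rewrite -[X in (_ * X)%E]fineK; last exact: (integrable_fin_num measurableT bi).
rewrite -EFinM; congr EFin.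
rewrite -[X in 2 * X]/(\int[lam]_r (- f 0 * (beta_density s r * log_length r))).
by rewrite RintegralZl//; ring.
Qed.

(** The form [half_form] integrated at a fixed difference [t] of its arguments. *)
Definition shift_corr (t : R) : R :=
  \int[lam]_a (pospow a (s - 1) * pospow (a - t) (s - 1) * (f a - f (a - t))).

Lemma shift_corr_integrable (t : R) : t != 0 -> lam.-integrable setT
  (fun a => (pospow a (s - 1) * pospow (a - t) (s - 1) * (f a - f (a - t)))%:E).
Proof.
move=> t0; have p1 : -1 < s - 1 by move: s01 => /andP[? ?]; lra.
pose I := `[- (M + `|t|), M + `|t|]%classic : set R.
have i1 := @integrable_pospow_box R (M + `|t|) (s - 1) p1.
have [i2 _] := lam_affine (- t) (oner_neq0 R) i1.
apply: (le_integrableR measurableT _ _ (integrableRZ measurableT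
  (C * `|t| `^ (q - 1) * `|t| `^ (s - 1)) (integrableRD measurableT i1 i2))).
- have msh : measurable_fun setT (fun a : R => a - t) by exact: measurable_funB.
  apply: measurable_funM; last by apply: measurable_funB => //; exact: measurableT_comp mf msh.
  apply: measurable_funM; first exact: measurable_pospow.
  exact: measurableT_comp (measurable_pospow _) msh.
- move=> a _; rewrite mul1r normrM ger0_norm ?mulr_ge0 ?pospow_ge0//.
  have fh : `|f a - f (a - t)| <= C * `|t| `^ (q - 1).
    by have := f_holder a (a - t); rewrite (_ : a - (a - t) = t)//; ring.
  have Ct0 : 0 <= C * `|t| `^ (q - 1) by exact: le_trans (normr_ge0 _) fh.
  have RHS0 : 0 <= C * `|t| `^ (q - 1) * `|t| `^ (s - 1) *
    (\1_I a * pospow a (s - 1) + \1_I (a - t) * pospow (a - t) (s - 1)).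
    rewrite mulr_ge0//; first by rewrite mulr_ge0// powR_ge0.
    by rewrite addr_ge0// mulr_ge0 ?pospow_ge0.
  have [|aM] := leP M `|a|; have [|bM] := leP M `|a - t|.
  + by move=> h1 h2; rewrite !f_supp// subrr normr0 mulr0.
  + move=> _; have aI : `|a| <= M + `|t|.
      by have := ler_normD (a - t) t; rewrite subrK; move: bM; lra.
    have bI : `|a - t| <= M + `|t| by have := normr_ge0 t; move: bM; lra.
    rewrite !indicE !mem_set ?mul1r/=; [|by rewrite in_itv/= -ler_norml..].
    rewrite -[C * _ * _]mulrA [C * (_ * _)]mulrA -[C * _ * _ * _]mulrA mulrC.
    by apply: ler_pM => //; rewrite ?mulr_ge0 ?pospow_ge0// shifted_weights_le//; case/andP: s01.
  + move=> _; have aI : `|a| <= M + `|t| by have := normr_ge0 t; move: aM; lra.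
    have bI : `|a - t| <= M + `|t|.
      by have := ler_normB a t; move: aM; lra.
    rewrite !indicE !mem_set ?mul1r/=; [|by rewrite in_itv/= -ler_norml..].
    rewrite -[C * _ * _]mulrA [C * (_ * _)]mulrA -[C * _ * _ * _]mulrA mulrC.
    by apply: ler_pM => //; rewrite ?mulr_ge0 ?pospow_ge0// shifted_weights_le//; case/andP: s01.
  + have aI : `|a| <= M + `|t| by have := normr_ge0 t; move: aM; lra.
    have bI : `|a - t| <= M + `|t| by have := normr_ge0 t; move: bM; lra.
    rewrite !indicE !mem_set ?mul1r/=; [|by rewrite in_itv/= -ler_norml..].
    rewrite -[C * _ * _]mulrA [C * (_ * _)]mulrA -[C * _ * _ * _]mulrA mulrC.
    by apply: ler_pM => //; rewrite ?mulr_ge0 ?pospow_ge0// shifted_weights_le//; case/andP: s01.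
Qed.

Lemma shift_corr0 : shift_corr 0 = 0.
Proof.
rewrite /shift_corr /Rintegral (_ : (fun _ => _) = cst 0%E) ?integral0//.
by apply/funext => a /=; rewrite subr0 subrr mulr0.
Qed.

Let sheared (z : R * R) : R := half_form (z.1, z.1 - z.2).

Let sheared_inner (t : R) : (\int[lam]_a (sheared (a, t))%:E =
  (shift_corr t * (t * `|t| `^ (- 1 - 2 * s)))%:E)%E.
Proof.
have E a : sheared (a, t) = (t * `|t| `^ (- 1 - 2 * s)) *
    (pospow a (s - 1) * pospow (a - t) (s - 1) * (f a - f (a - t))).
  by rewrite /sheared /half_form/= (_ : a - (a - t) = t); [rewrite mulrC|ring].
have [->|t0] := eqVneq t 0.
  rewrite shift_corr0 mul0r (_ : (fun _ => _) = cst 0%E) ?integral0//.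
  by apply/funext => a /=; rewrite /sheared /half_form/= subr0 subrr !mulr0 mul0r.
have ti := shift_corr_integrable t0.
under eq_integral do rewrite E EFinM.
rewrite (integralZl measurableT ti) muleC [RHS]EFinM /shift_corr /Rintegral fineK//.
exact: (integrable_fin_num measurableT ti).
Qed.

Let sheared_integrable : (lam \x lam)%E.-integrable setT (fun z => (sheared z)%:E) /\
  (\int[(lam \x lam)%E]_z (half_form z)%:E = \int[(lam \x lam)%E]_z (sheared z)%:E)%E.
Proof.
have [|i1 E1] := @integral_fiber R _ _ lam (fun=> 1) (fun a b => a - b)
    (@measurable_cst _ _ _ _ setT (1 : R)) (fun _ => ler01) m_shift _ half_form half_form_integrable.
  move=> a F mF F0.
  have mFE : measurable_fun setT (fun x => (F x)%:E) by exact/measurable_EFinP.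
  have N1 : -1 != 0 :> R by rewrite oppr_eq0 oner_neq0.
  have := @ge0_integral_affine R (-1) a (fun x => (F x)%:E) N1 mFE (fun x => ltac:(by rewrite lee_fin)).
  rewrite normrN1 invr1 mul1e => <-; apply: eq_integral => b _.
  by rewrite mul1r mulN1r addrC.
split; first by apply: eq_integrable i1 => // z _; rewrite mul1r.
by rewrite E1; apply: eq_integral => z _; rewrite mul1r.
Qed.

Lemma shift_corrE :
  lam.-integrable setT (fun t => (shift_corr t * (t * `|t| `^ (- 1 - 2 * s)))%:E) /\
  (\int[lam]_t (shift_corr t * (t * `|t| `^ (- 1 - 2 * s)))%:E = (- (2 * c_s s * f 0))%:E)%E.
Proof.
have [si sE] := sheared_integrable; split.
  apply: eq_integrable (integrable_fubini_F (integrable_swap si)) => // t _.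
  by rewrite /fubini_F/= sheared_inner.
rewrite -half_formE sE -(integral21_prod_meas1 si).
by apply: eq_integral => t _; rewrite /fubini_G/= sheared_inner.
Qed.

(** Fubini gives the measurability of the product with the kernel, and the kernel
    can be divided out. *)
Lemma measurable_shift_corr : measurable_fun setT shift_corr.
Proof.
have [ci _] := shift_corrE.
have mc : measurable_fun setT (fun t => shift_corr t * (t * `|t| `^ (- 1 - 2 * s))).
  by have /measurable_EFinP := measurable_int _ ci.
rewrite (_ : shift_corr = (fun t => shift_corr t * (t * `|t| `^ (- 1 - 2 * s)) *
    (t * `|t| `^ (2 * s - 1)))).
  apply: measurable_funM => //; apply: measurable_funM => //.
  apply: (measurableT_comp (measurable_powR _)); exact: normr_measurable.
apply/funext => t; have [->|t0] := eqVneq t 0; first by rewrite shift_corr0 !mul0r.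
rewrite -mulrA [X in _ * X](_ : _ = 1) ?mulr1//.
have tp : 0 < `|t| by rewrite normr_gt0.
rewrite mulrACA -expr2 -real_normK ?num_real// -powR_mulrn// -!powRD ?(gt_eqF tp) ?implybT//.
by rewrite (_ : _ + _ = 0) ?powRr0//; ring.
Qed.

End half_line_form.

(** * The boundary term *)

Section boundary_term.
Context {R : realType}.
Local Notation lam := (@lebesgue_measure R).
Variables (n : nat) (s q M C Lam : R) (K F : 'rV[R]_n.+1 -> R) (i : 'I_n.+1).
Hypotheses (s01 : 0 < s < 1) (q1 : 1 < q) (q2s : 2 * s < q) (qs1 : q < 1 + s).
Hypotheses (mK : measurable_fun setT K) (Lam0 : 0 <= Lam).
Hypothesis K_le : forall h, `|K h| <= Lam * enorm h `^ (- n.+1%:R - 2 * s).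
Hypothesis K_hom : forall t h, t != 0 -> K (t *: h) = `|t| `^ (- n.+1%:R - 2 * s) * K h.
Hypotheses (mF : measurable_fun setT F) (M0 : 0 < M).
Hypothesis F_holder : forall x y, `|F x - F y| <= C * enorm (x - y) `^ (q - 1).
Hypothesis F_supp : forall x, ~ box M x -> F x = 0.

Local Notation w := (@xweight R n (s - 1)).
Let k0 : R := - n.+1%:R - 2 * s.

Lemma integrable_box m (A : R) : (leb m).-integrable setT
  (fun x : 'rV[R]_m => (\1_(box A) x)%:E).
Proof.
under eq_fun do rewrite indic_box.
apply: (@leb_integrable_prod R m (fun=> \1_(`[- A, A]%classic))) => _.
- exact: measurable_indic.
- by [].
- exact: (@integrable_indic_itv R (- A) A true false).
Qed.

Lemma ae_xlast_neq0 : {ae leb n.+1, forall h : 'rV[R]_n.+1, xlast h != 0}.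
Proof.
exists [set h | xlast h = 0]; split.
- rewrite -[X in measurable X]setTI.
  exact: (measurable_xlast measurableT (measurable_set1 0)).
- have -> : leb n.+1 [set h : 'rV[R]_n.+1 | xlast h = 0] = (leb n \x lam)%E
      ((fun p : 'rV[R]_n * R => rsnoc p.1 p.2) @^-1` [set h | xlast h = 0]) by [].
  rewrite (_ : _ @^-1` _ = setT `*` [set 0]).
    by rewrite product_measure1E//= lebesgue_measure_set1 mule0.
  by apply/seteqP; split => -[x' a] /=; rewrite xlast_rsnoc//; case.
- by move=> h /= /negP; rewrite negbK => /eqP.
Qed.

Lemma holder_continuous (f : R -> R) (D d : R) : 0 < d ->
  (forall a b, `|f a - f b| <= D * `|a - b| `^ d) -> continuous f.
Proof.
move=> d0 fh a; have D0 : 0 <= D.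
  by have := fh 1 0; rewrite subr0 normr1 powR1 mulr1; exact: le_trans.
apply/cvgrPdist_lt => e e0.
have D1 : 0 < D + 1 by lra.
pose r := (e / (D + 1)) `^ d^-1.
have r0 : 0 < r by rewrite powR_gt0// divr_gt0.
apply/nbhs_ballP; exists r => //= b /= ab; apply: le_lt_trans (fh a b) _.
have : `|a - b| `^ d <= e / (D + 1).
  rewrite (_ : e / (D + 1) = r `^ d); last first.
    by rewrite /r -powRrM mulVf ?gt_eqF// powRr1// ltW// divr_gt0.
  by apply: ge0_ler_powR; rewrite ?nnegrE ?(ltW d0) ?(ltW r0) ?(ltW ab).
rewrite ler_pdivlMr// mulrDr mulr1 mulrC => h.
have [p0|p0] := eqVneq (`|a - b| `^ d) 0; first by rewrite p0 mulr0.
have : 0 < `|a - b| `^ d by rewrite lt_neqAle eq_sym p0 powR_ge0.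
by move: h; lra.
Qed.

Let C0 : 0 <= C.
Proof.
have := F_holder (const_mx 1) 0; rewrite subr0.
have e0 : 0 < enorm (const_mx 1 : 'rV[R]_n.+1) `^ (q - 1).
  rewrite powR_gt0// enorm_gt0; apply/eqP => /rowP/(_ ord0).
  by rewrite !mxE => /eqP; rewrite oner_eq0.
by move=> /(le_trans (normr_ge0 _)); rewrite pmulr_lge0.
Qed.

Definition slice_mass (a : R) : R := \int[leb n]_x' F (rsnoc x' a).

Let enorm_rsnoc0 (t : R) : enorm (rsnoc (0 : 'rV[R]_n) t) = `|t|.
Proof.
rewrite /enorm (bigD1 ord_max)//= mxE unlift_none big1 ?addr0 ?sqrtr_sqr// => j jm.
rewrite mxE; case: unliftP => [k _|jE]; first by rewrite mxE expr0n.
by rewrite jE eqxx in jm.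
Qed.

Let box_rsnoc (x' : 'rV[R]_n) a : box M (rsnoc x' a) <-> box M x' /\ `|a| <= M.
Proof.
split=> [xM|[xM aM] j].
  split=> [j|]; first by have := xM (lift ord_max j); rewrite mxE liftK.
  by have := xM ord_max; rewrite mxE unlift_none.
by rewrite mxE; case: unliftP => [k _|_].
Qed.

Lemma F_slice_diff (x' : 'rV[R]_n) (a b : R) :
  `|F (rsnoc x' a) - F (rsnoc x' b)| <= C * `|a - b| `^ (q - 1) * \1_(box M) x'.
Proof.
have [xM|xM] := pselect (box M x').
  rewrite indicE mem_set// mulr1; apply: le_trans (F_holder _ _) _.
  by rewrite rsnocB subrr enorm_rsnoc0.
rewrite !F_supp ?subrr ?normr0; [|by case/box_rsnoc..].
by rewrite !mulr_ge0 ?powR_ge0.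
Qed.

Let mFl (a : R) : measurable_fun setT (fun x' : 'rV[R]_n => F (rsnoc x' a)).
Proof. exact: measurableT_comp mF (measurable_rsnocl a). Qed.

Lemma F_slice_integrable (a : R) : (leb n).-integrable setT (fun x' => (F (rsnoc x' a))%:E).
Proof.
apply: (le_integrableR measurableT (mFl a) _ (integrableRZ measurableT
  (C * `|a - (`|M| + 1)| `^ (q - 1)) (integrable_box n M))) => x' _.
have := F_slice_diff x' a (`|M| + 1); rewrite [F (rsnoc x' (`|M| + 1))]F_supp ?subr0//.
case/box_rsnoc => _; rewrite ger0_norm; last by rewrite addr_ge0.
by have := ler_norm M; lra.
Qed.

Lemma slice_mass_holder : exists D, forall a b,
  `|slice_mass a - slice_mass b| <= D * `|a - b| `^ (q - 1).
Proof.
exists (C * \int[leb n]_x' \1_(box M) x') => a b.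
rewrite /slice_mass -RintegralB//; [|exact: F_slice_integrable..].
have di := integrableRB measurableT (F_slice_integrable a) (F_slice_integrable b).
apply: le_trans (le_normr_Rintegral _ di) _ => //.
rewrite [leRHS](_ : _ = \int[leb n]_x' (C * `|a - b| `^ (q - 1) * \1_(box M) x')); last first.
  by rewrite RintegralZl//; [ring|exact: integrable_box].
apply: le_Rintegral => //.
- exact: integrable_norm.
- by apply: integrableRZ => //; exact: integrable_box.
- by move=> x' _; exact: F_slice_diff.
Qed.

(** The box is closed: the margin 1 puts all of [M + 1 <= `|a|] outside it. *)
Lemma slice_mass_supp a : M + 1 <= `|a| -> slice_mass a = 0.
Proof.
move=> aM; rewrite /slice_mass /Rintegral (_ : (fun _ => _) = cst 0%E) ?integral0//.
apply/funext => x' /=; rewrite F_supp//; case/box_rsnoc => _.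
by move: aM; lra.
Qed.

Lemma measurable_slice_mass : measurable_fun setT slice_mass.
Proof.
have [D Dh] := slice_mass_holder.
have d0 : 0 < q - 1 by move: q1; lra.
exact: continuous_measurable_fun (holder_continuous d0 Dh).
Qed.

Definition shift_form (h x : 'rV[R]_n.+1) : R := w x * w (x - h) * (F x - F (x - h)).

Let mshift (h : 'rV[R]_n.+1) : measurable_fun setT (fun x : 'rV[R]_n.+1 => x - h).
Proof.
rewrite (_ : (fun _ => _) = (fun x => 1 *: x + (- h))); first exact: measurable_rV_affine.
by apply/funext => x; rewrite scale1r.
Qed.

Let mshift_form h : measurable_fun setT (shift_form h).
Proof.
apply: measurable_funM; last by apply: measurable_funB => //; exact: measurableT_comp mF (mshift h).
apply: measurable_funM; first exact: measurable_xweight.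
exact: measurableT_comp (measurable_xweight _) (mshift h).
Qed.

Lemma shift_form_integrable (h : 'rV[R]_n.+1) : xlast h != 0 ->
  (leb n.+1).-integrable setT (fun x => (shift_form h x)%:E).
Proof.
move=> t0; have /andP[s0 s1] := s01.
have p1 : -1 < s - 1 by lra.
have i1 := @integrable_weight_box R n (M + enorm h) (s - 1) p1.
have [i2 _] := leb_affine (- h) (oner_neq0 R) i1.
apply: (le_integrableR measurableT (mshift_form h) _ (integrableRZ measurableT
  (C * enorm h `^ (q - 1) * `|xlast h| `^ (s - 1)) (integrableRD measurableT i1 i2))) => x _.
rewrite scale1r /shift_form normrM ger0_norm ?mulr_ge0 ?xweight_ge0//.
have Ch : `|F x - F (x - h)| <= C * enorm h `^ (q - 1).
  by have := F_holder x (x - h); rewrite subKr.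
have Ch0 : 0 <= C * enorm h `^ (q - 1) by exact: le_trans (normr_ge0 _) Ch.
have boxes : box M x \/ box M (x - h) -> box (M + enorm h) x /\ box (M + enorm h) (x - h).
  have hj j : `|h 0 j| <= enorm h by exact: coord_le_enorm.
  case=> xM; split=> j; have := xM j; have := hj j; rewrite ?mxE => h1 h2.
  - by have := enorm_ge0 h; lra.
  - by have := ler_normB (x 0 j) (h 0 j); lra.
  - by have := ler_normD (x 0 j - h 0 j) (h 0 j); rewrite subrK; lra.
  - by have := enorm_ge0 h; lra.
have [/boxes[b1 b2]|nb] := pselect (box M x \/ box M (x - h)); last first.
  rewrite !F_supp ?subrr ?normr0 ?mulr0; [|by move=> bx; apply: nb; tauto..].
  rewrite mulr_ge0//; first by rewrite mulr_ge0// powR_ge0.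
  by rewrite addr_ge0// mulr_ge0 ?xweight_ge0.
rewrite !indicE !mem_set// !mul1r -mulrA mulrC.
apply: ler_pM; rewrite ?mulr_ge0 ?xweight_ge0//.
by rewrite /xweight xlastB; exact: shifted_weights_le.
Qed.

(** The weights only depend on the last coordinate, and a tangential shift does
    not change the mass of a slice. *)
Lemma integral_shift_form (h : 'rV[R]_n.+1) : xlast h != 0 ->
  (\int[leb n.+1]_x (shift_form h x)%:E = (shift_corr s slice_mass (xlast h))%:E)%E.
Proof.
move=> t0; have [D Dh] := slice_mass_holder.
have ci := shift_corr_integrable s01 measurable_slice_mass Dh slice_mass_supp t0.
rewrite (lebSr (shift_form_integrable t0)) /shift_corr /Rintegral fineK; last first.
  exact: (integrable_fin_num measurableT ci).
pose h' : 'rV[R]_n := \row_j h 0 (lift ord_max j).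
have hE : h = rsnoc h' (xlast h) := rsnoc_surj h.
apply: eq_integral => a _.
have E x' : shift_form h (rsnoc x' a) = pospow a (s - 1) * pospow (a - xlast h) (s - 1) *
    (F (rsnoc x' a) - F (rsnoc (1 *: x' + - h') (a - xlast h))).
  by rewrite /shift_form /xweight xlastB xlast_rsnoc scale1r {2}hE rsnocB.
under eq_integral do rewrite E EFinM.
have i1 := F_slice_integrable a.
have [i2 E2] := leb_affine (- h') (oner_neq0 R) (F_slice_integrable (a - xlast h)).
have id := integrableRB measurableT i1 i2.
rewrite (integralZl measurableT id).
have -> : (\int[leb n]_x' (F (rsnoc x' a) - F (rsnoc (1 *: x' + - h') (a - xlast h)))%:E =
    (slice_mass a - slice_mass (a - xlast h))%:E)%E.
  under eq_integral do rewrite EFinB.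
  rewrite (integralB measurableT i1 i2) E2 normr1 expr1n invr1 mul1e EFinB /slice_mass /Rintegral.
  by rewrite !fineK//; apply: (integrable_fin_num measurableT) => //; exact: F_slice_integrable.
by rewrite -EFinM.
Qed.

Definition grad_form (z : 'rV[R]_n.+1 * 'rV[R]_n.+1) : R :=
  w z.1 * w z.2 * (F z.1 - F z.2) * ((z.1 - z.2) 0 i * K (z.1 - z.2)).

Lemma grad_form_integrable : (leb n.+1 \x leb n.+1)%E.-integrable setT (fun z => (grad_form z)%:E).
Proof.
have m1 := @measurable_fst _ _ 'rV[R]_n.+1 'rV[R]_n.+1.
have m2 := @measurable_snd _ _ 'rV[R]_n.+1 'rV[R]_n.+1.
have m3 := @measurable_rVB R n.+1.
apply: (le_integrableR measurableT _ _ (integrableRZ measurableT (C * Lam)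
  (majorantN_integrable n M s01 q1 q2s qs1))).
- apply: measurable_funM; last first.
    apply: measurable_funM; last exact: measurableT_comp mK m3.
    exact: measurableT_comp (measurable_coord i) m3.
  apply: measurable_funM; last first.
    by apply: measurable_funB; [exact: measurableT_comp mF m1|exact: measurableT_comp mF m2].
  by apply: measurable_funM; [exact: measurableT_comp (measurable_xweight _) m1|
    exact: measurableT_comp (measurable_xweight _) m2].
- move=> z _; rewrite /grad_form /majorantN !normrM !(ger0_norm (xweight_ge0 _ _)).
  set r := z.1 - z.2; set W := w z.1 * w z.2.
  have W0 : 0 <= W by rewrite mulr_ge0 ?xweight_ge0.
  set S := \1_(box M) z.1 + \1_(box M) z.2.
  have S0 : 0 <= S by rewrite addr_ge0.
  have FS : `|F z.1 - F z.2| <= C * enorm r `^ (q - 1) * S.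
    have CS : 0 <= C * enorm r `^ (q - 1) by rewrite mulr_ge0 ?powR_ge0.
    have [b1|b1] := pselect (box M z.1).
      by apply: le_trans (F_holder _ _) _; rewrite ler_peMr// /S indicE mem_set ?lerDl.
    have [b2|b2] := pselect (box M z.2).
      by apply: le_trans (F_holder _ _) _; rewrite ler_peMr// /S addrC indicE mem_set ?lerDl.
    by rewrite !F_supp// subrr normr0 mulr_ge0.
  have e0 := enorm_ge0 r.
  have hK : `|r 0 i| * `|K r| <= enorm r `^ 1 * (Lam * enorm r `^ k0).
    by apply: ler_pM => //; rewrite powRr1 ?coord_le_enorm.
  have k1 : q + k0 != 0.
    by rewrite lt_eqF// /k0 -natr1; have := ler0n R n; move: qs1 s01 => ? /andP[? ?]; lra.
  have kE : enorm r `^ (q - n.+1%:R - 2 * s) = enorm r `^ (q - 1) * enorm r `^ 1 * enorm r `^ k0.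
    rewrite -powRD; last by rewrite gt_eqF//; move: q1; lra.
    rewrite subrK kernel_powR_mul//; last by move: q1; lra.
    by congr (_ `^ _); rewrite /k0; ring.
  rewrite kE; apply: (@le_trans _ _ (W * (C * enorm r `^ (q - 1) * S) * (enorm r `^ 1 * (Lam * enorm r `^ k0)))).
    apply: ler_pM => //; first by rewrite mulr_ge0.
    by rewrite ler_wpM2l.
  by rewrite le_eqVlt; apply/orP; left; apply/eqP; ring.
Qed.

Let sheared_form : (leb n.+1 \x leb n.+1)%E.-integrable setT
    (fun z => (shift_form z.2 z.1 * (z.2 0 i * K z.2))%:E) /\
  (\int[(leb n.+1 \x leb n.+1)%E]_z (grad_form z)%:E =
   \int[(leb n.+1 \x leb n.+1)%E]_z (shift_form z.2 z.1 * (z.2 0 i * K z.2))%:E)%E.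
Proof.
have E (z : 'rV[R]_n.+1 * 'rV[R]_n.+1) :
    1 * grad_form (z.1, z.1 - z.2) = shift_form z.2 z.1 * (z.2 0 i * K z.2).
  by rewrite mul1r /grad_form /shift_form/= subKr.
have [|i1 E1] := @integral_fiber R _ _ (leb n.+1) (fun=> 1) (fun x y => x - y)
    (@measurable_cst _ _ _ _ setT (1 : R)) (fun _ => ler01) (@measurable_rVB R n.+1) _
    grad_form grad_form_integrable.
  move=> x G mG G0.
  have mGE : measurable_fun setT (fun y => (G y)%:E) by exact/measurable_EFinP.
  have N1 : -1 != 0 :> R by rewrite oppr_eq0 oner_neq0.
  have GE0 y : (0 <= (G y)%:E)%E by rewrite lee_fin.
  have := ge0_leb_affine x N1 mGE GE0.
  rewrite normrN1 expr1n invr1 mul1e => <-; apply: eq_integral => y _.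
  by rewrite mul1r scaleN1r addrC.
split; first by apply: eq_integrable i1 => // z _; rewrite E.
by rewrite E1; apply: eq_integral => z _; rewrite E.
Qed.

(** Put [y = x - h]. For fixed [h], the integral in [x] depends on the last
    coordinate of [h] only, so the integral over [h] splits into the mass of
    [h_i K] on the slice of height 1, which is the integral in [theta], and the
    integral on the line. *)
Lemma grad_formE : (\int[(leb n.+1 \x leb n.+1)%E]_z (grad_form z)%:E =
  (- (theta s K 0 i * slice_mass 0))%:E)%E.
Proof.
have [si sE] := sheared_form.
have [D Dh] := slice_mass_holder.
have M10 : 0 < M + 1 by move: M0; lra.
have mD := measurable_shift_corr s01 q1 q2s qs1 measurable_slice_mass M10 Dh slice_mass_supp.
have [ci cE] := shift_corrE s01 q1 q2s qs1 measurable_slice_mass M10 Dh slice_mass_supp.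
have cfE (t : R) : `|t| ^+ n * (t * `|t| `^ k0) = t * `|t| `^ (- 1 - 2 * s).
  rewrite mulrCA powR_exprn_mul//.
  - by congr (_ * _ `^ _); rewrite /k0 -natr1; ring.
  - by rewrite /k0 -natr1; have := ler0n R n; move: s01 => /andP[? ?]; lra.
  - by rewrite lt_eqF// /k0 -natr1; move: s01 => /andP[? ?]; lra.
have k1 : 1 + k0 != 0.
  by rewrite lt_eqF// /k0 -natr1; have := ler0n R n; move: s01 => /andP[? ?]; lra.
have mQ : measurable_fun setT (fun h : 'rV[R]_n.+1 => h 0 i * K h).
  by apply: measurable_funM => //; exact: measurable_coord.
have rn : 1 + k0 < - n%:R by rewrite /k0 -natr1; move: s01 => /andP[? ?]; lra.
have Qle (h : 'rV[R]_n.+1) : `|h 0 i * K h| <= Lam * enorm h `^ (1 + k0).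
  rewrite normrM -kernel_powR_mul ?enorm_ge0// powRr1 ?enorm_ge0//.
  by rewrite mulrCA; apply: ler_pM => //; exact: coord_le_enorm.
have Qhom (t : R) (h : 'rV[R]_n.+1) : t != 0 -> (t *: h) 0 i * K (t *: h) = t * `|t| `^ k0 * (h 0 i * K h).
  by move=> t0; rewrite mxE K_hom//; rewrite -/k0; ring.
have cn (t : R) : t != 0 -> `|t| ^+ n * `|t * `|t| `^ k0| = `|t| `^ (n%:R + (1 + k0)).
  move=> t0; rewrite normrM (ger0_norm (powR_ge0 _ _)).
  by rewrite -powR_mulrn// -{2}(powRr1 (normr_ge0 t)) -!powRD ?normr_eq0 ?t0 ?implybT.
have ci' : lam.-integrable setT (fun t => (shift_corr s slice_mass t * (`|t| ^+ n * (t * `|t| `^ k0)))%:E).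
  by apply: eq_integrable ci => // t _; rewrite cfE.
have [ti tE] := tensor_integral mD (shift_corr0 s slice_mass) mQ rn Lam0 Qle Qhom cn ci'.
rewrite sE -(integral21_prod_meas1 si).
transitivity (\int[leb n.+1]_h (shift_corr s slice_mass (xlast h) * (h 0 i * K h))%:E)%E.
  apply: ae_eq_integral => //.
  - exact: measurable_int (integrable_fubini_F (integrable_swap si)).
  - exact: measurable_int ti.
  - apply: (@filterS _ _ (ae_filter_ringOfSetsType (leb n.+1)) _ _ _ ae_xlast_neq0) => h t0 _.
    rewrite /fubini_G/=; under eq_integral do rewrite EFinM.
    under eq_integral do rewrite muleC.
    by rewrite (integralZl measurableT (shift_form_integrable t0)) integral_shift_form// muleC.
rewrite tE; under [X in (_ * X)%E]eq_integral do rewrite cfE.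
have Qi : (leb n).-integrable setT (fun z => (rsnoc z 1 0 i * K (rsnoc z 1))%:E).
  apply: (le_integrableR measurableT _ _ (integrableRZ measurableT Lam (integrable_slice1 rn))).
    exact: measurableT_comp mQ (measurable_rsnocl 1).
  by move=> z _; exact: Qle.
rewrite cE -[X in (X * _)%E]fineK; last exact: (integrable_fin_num measurableT Qi).
rewrite -EFinM; congr EFin; rewrite mxE /Rintegral; ring.
Qed.

End boundary_term.

(** * Coordinatewise differential calculus *)

Lemma uniform_constant (R : realType) (n : nat) (P : 'I_n -> R -> Prop) :
  (forall i b c, b <= c -> P i b -> P i c) -> (forall i, exists2 B, 0 <= B & P i B) ->
  exists2 B, 0 <= B & forall i, P i B.
Proof.
move=> Pmon Pex.
pose B i := xget 0 [set B | 0 <= B /\ P i B].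
have BP i : 0 <= B i /\ P i (B i).
  by have [b b0 bP] := Pex i; exact: (@xgetI _ 0 [set B | 0 <= B /\ P i B] b).
exists (\sum_i B i) => [|i]; first by apply: sumr_ge0 => i _; case: (BP i).
apply: Pmon (BP i).2; rewrite (bigD1 i)//= lerDl.
by apply: sumr_ge0 => j _; case: (BP j).
Qed.

Section coordinatewise_calculus.
Context {R : realType}.
Variable n : nat.
Implicit Types (f : 'rV[R]_n -> R) (x y z : 'rV[R]_n).

Local Notation e_ := (fun i : 'I_n => delta_mx 0 i : 'rV[R]_n).

Lemma MVT_unordered (f df : R -> R) (a b : R) :
  (forall t, is_derive t (1 : R) f (df t)) ->
  exists2 c, a <= c <= b \/ b <= c <= a & f b - f a = df c * (b - a).
Proof.
move=> fd; have cf : continuous f.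
  move=> t; apply: differentiable_continuous; apply/derivable1_diffP.
  by have [] := fd t.
have [ab|ba] := leP a b.
  have [c cab ->] := MVT_segment ab (fun t _ => fd t) (continuous_subspaceT cf).
  by exists c => //; left; move: cab; rewrite in_itv.
have [c cab E] := MVT_segment (ltW ba) (fun t _ => fd t) (continuous_subspaceT cf).
by exists c; [right; move: cab; rewrite in_itv|rewrite -opprB E -mulrN opprB].
Qed.

Lemma derive_along_line f x (v : 'rV[R]_n) (t : R) : derivable f (x + t *: v) v ->
  is_derive t (1 : R) (fun r : R => f (x + r *: v)) ('D_v f (x + t *: v)).
Proof.
move=> df.
have E : (fun h : R => h^-1 *: (((fun r : R => f (x + r *: v)) \o shift t) (h *: (1 : R)) - f (x + t *: v))) =
    (fun h : R => h^-1 *: ((f \o shift (x + t *: v)) (h *: v) - f (x + t *: v))).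
  apply/funext => h /=; congr (_ *: (f _ - _)).
  by rewrite [h *: 1]mulr1 scalerDl addrCA.
by apply: DeriveDef; [rewrite /derivable E|rewrite /derive E].
Qed.

(** The corners of the broken line from [x] to [y] that follows the coordinate
    axes: only partial derivatives are available. *)
Definition hybrid x y (m : nat) : 'rV[R]_n := \row_j (if (j < m)%N then y 0 j else x 0 j).

Definition between x y z := forall j, x 0 j <= z 0 j <= y 0 j \/ y 0 j <= z 0 j <= x 0 j.

(** The mean value theorem on each edge of the broken line. *)
Lemma partial_MVT f x y : (forall z i, derivable f z (e_ i)) ->
  exists2 xi : 'I_n -> 'rV[R]_n, forall i, between x y (xi i) &
    f y - f x = \sum_i 'D_(e_ i) f (xi i) * (y 0 i - x 0 i).
Proof.
move=> df.
have step (i : 'I_n) : exists2 z, between x y z &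
    f (hybrid x y i.+1) - f (hybrid x y i) = 'D_(e_ i) f z * (y 0 i - x 0 i).
  pose z t := hybrid x y i + t *: e_ i.
  have [c c01 E] := @MVT_unordered (fun t => f (z t)) (fun t => 'D_(e_ i) f (z t)) 0 (y 0 i - x 0 i)
    (fun t => derive_along_line (df (z t) i)).
  exists (z c).
    move=> j; rewrite !mxE eqxx/=; have [ij|ij] := eqVneq j i; last first.
      rewrite mulr0 addr0; case: ifP => _; rewrite ?lexx ?andbT/=.
        by case: (leP (x 0 j) (y 0 j)) => [?|/ltW ?]; [left|right].
      by case: (leP (x 0 j) (y 0 j)) => [?|/ltW ?]; [left|right].
    rewrite ij ltnn mulr1; case: c01 => /andP[c1 c2]; [left|right]; apply/andP; split; lra.
  rewrite subr0 in E; rewrite -E /z scale0r addr0; congr (f _ - _).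
  apply/rowP => j; rewrite !mxE eqxx/= ltnS leq_eqVlt; have [ij|ij] := eqVneq j i.
    by rewrite ij eqxx/= ltnn mulr1; ring.
  by rewrite (negbTE (_ : (j : nat) != i))//= mulr0 addr0.
pose xi (i : 'I_n) := xget x [set z | between x y z /\
  f (hybrid x y i.+1) - f (hybrid x y i) = 'D_(e_ i) f z * (y 0 i - x 0 i)].
have xiP i : between x y (xi i) /\
    f (hybrid x y i.+1) - f (hybrid x y i) = 'D_(e_ i) f (xi i) * (y 0 i - x 0 i).
  have [z z1 z2] := step i.
  exact: (@xgetI _ x [set z | between x y z /\
    f (hybrid x y i.+1) - f (hybrid x y i) = 'D_(e_ i) f z * (y 0 i - x 0 i)] z).
exists xi => [i|]; first by case: (xiP i).
under eq_bigr => i _ do rewrite -(xiP i).2.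
have -> : y = hybrid x y n by apply/rowP => j; rewrite mxE ltn_ord.
have -> : f x = f (hybrid x (hybrid x y n) 0) by congr f; apply/rowP => j; rewrite mxE.
have -> : hybrid x (hybrid x y n) = hybrid x y.
  by apply/funext => m; apply/rowP => j; rewrite !mxE ltn_ord.
by rewrite -(big_mkord xpredT (fun i => f (hybrid x y i.+1) - f (hybrid x y i))) telescope_sumr.
Qed.

Lemma between_enorm x y z : between x y z -> enorm (x - z) <= n%:R * enorm (x - y).
Proof.
move=> b; apply: enorm_le_bound; first exact: enorm_ge0.
move=> i; apply: le_trans (coord_le_enorm (x - y) i); rewrite !mxE.
case: (b i) => /andP[h1 h2].
  by rewrite distrC (distrC (x 0 i)) !ger0_norm; lra.
by rewrite !ger0_norm; lra.
Qed.

Lemma between_box (M : R) x y z : between x y z -> box M x -> box M y -> box M z.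
Proof.
move=> b xM yM i; have := xM i; have := yM i; rewrite !ler_norml => /andP[h1 h2] /andP[h3 h4].
by case: (b i) => /andP[h5 h6]; apply/andP; split; lra.
Qed.

Lemma compact_box (M : R) : compact (@box R n M).
Proof.
have := @rV_compact R n (fun=> `[- M, M]%classic) (fun _ => @segment_compact R _ _).
congr compact; apply/seteqP; split => x h i; have := h i; rewrite /= in_itv/= -ler_norml//.
Qed.

Lemma bounded_on_box (M : R) f : {in box M, continuous f} ->
  exists2 B, 0 <= B & forall x, box M x -> `|f x| <= B.
Proof.
move=> cf.
have cfw : {within box M, continuous f}.
  by apply: continuous_in_subspaceT.
have /compact_bounded[B [_ BP]] := continuous_compact cfw (compact_box (M := M)).
exists (`|B| + 1); first by rewrite addr_ge0.
move=> x xM; apply: (BP (`|B| + 1)); first by have := ler_norm B; lra.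
by exists x.
Qed.

Lemma bounded_off_box (M : R) f : continuous f -> (forall x, ~ box M x -> f x = 0) ->
  exists2 B, 0 <= B & forall x, `|f x| <= B.
Proof.
move=> cf f0; have [B B0 BP] := bounded_on_box (fun x _ => cf x) (M := M).
exists B => // x; have [xM|xM] := pselect (box M x); first exact: BP.
by rewrite f0// normr0.
Qed.

Lemma partial_lipschitz f x y (B : R) : (forall z i, derivable f z (e_ i)) ->
  (forall z i, between x y z -> `|'D_(e_ i) f z| <= B) ->
  `|f x - f y| <= n%:R * B * enorm (x - y).
Proof.
move=> df dB; rewrite distrC; have [xi xib ->] := partial_MVT x y df.
apply: le_trans (ler_norm_sum _ _ _) _.
apply: (@le_trans _ _ (\sum_(i < n) B * enorm (x - y))); last first.
  by rewrite sumr_const card_ord -[leLHS]mulr_natl mulrA.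
apply: ler_sum => i _; rewrite normrM; apply: ler_pM => //; first exact: dB.
by rewrite distrC; have := coord_le_enorm (x - y) i; rewrite !mxE.
Qed.

Lemma derive_off_box (M : R) f i : (forall x, ~ box M x -> f x = 0) ->
  forall x, ~ box M x -> 'D_(e_ i) f x = 0.
Proof.
move=> f0 x xM; rewrite (@near_eq_derive _ _ _ f (cst 0)) ?derive_cst//.
have : nbhs x (~` @box R n M).
  apply: open_nbhs_nbhs; split => //; apply: closed_openC.
  exact: compact_closed (@norm_hausdorff _ _) (compact_box (M := M)).
by apply: filterS => y yM; rewrite f0.
Qed.

End coordinatewise_calculus.

Section test_functions.
Context {R : realType}.
Variables (n : nat) (M : R) (eta : 'rV[R]_n -> R).
Hypotheses (eta_smooth : forall k, is_Ck k setT eta).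
Hypothesis eta_supp : forall x, ~ box M x -> eta x = 0.

Local Notation e_ := (fun i : 'I_n => delta_mx 0 i : 'rV[R]_n).

Lemma pderivs_supp l x : ~ box M x -> pderivs l eta x = 0.
Proof. by elim: l x => [|i l IHl] x xM /=; [exact: eta_supp|exact: derive_off_box IHl _ xM]. Qed.

Lemma pderivs_continuous l : continuous (pderivs l eta).
Proof. by move=> x; have [] := eta_smooth (leqnn (size l)) (x := x) I. Qed.

Lemma pderivs_derivable l z i : derivable (pderivs l eta) z (e_ i).
Proof. by have [_ +] := eta_smooth (k := (size l).+1) (leqnSn _) (x := z) I; exact. Qed.

Lemma pderivs_bounded l : exists2 B, 0 <= B & forall x, `|pderivs l eta x| <= B.
Proof. by apply: (@bounded_off_box _ _ M); [exact: pderivs_continuous|exact: pderivs_supp]. Qed.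

Lemma pderivs_lipschitz l : exists2 L, 0 <= L &
  forall x y, `|pderivs l eta x - pderivs l eta y| <= L * enorm (x - y).
Proof.
have [|B B0 BP] := uniform_constant (P := fun i B => forall x, `|pderivs (i :: l) eta x| <= B) _
  (fun i => pderivs_bounded (i :: l)).
  by move=> i b c bc h x; exact: le_trans (h x) bc.
exists (n%:R * B) => [|x y]; first by rewrite mulr_ge0.
apply: partial_lipschitz => [z i|z i _]; first exact: pderivs_derivable.
exact: (BP i z).
Qed.

(** The quadratic bound is the better one for [t <= 1], the linear one for
    [1 <= t]. *)
Lemma le_powR_between (a c t r : R) : 0 <= t -> 1 <= r <= 2 -> 0 <= c ->
  a <= c * t -> a <= c * t ^+ 2 -> a <= c * t `^ r.
Proof.
move=> t0 /andP[r1 r2] c0 h1 h2; have [t1|t1] := leP t 1.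
  apply: le_trans h2 _; rewrite ler_wpM2l//.
  have [->|tn] := eqVneq t 0; first by rewrite expr0n powR_ge0.
  rewrite -powR_mulrn// (_ : 2%:R = r + (2 - r)); last by ring.
  rewrite powRD ?tn ?implybT// ler_piMr ?powR_ge0//.
  have := @ge0_ler_powR R (2 - r) _ t 1; rewrite powR1; apply; rewrite ?nnegrE//; lra.
apply: le_trans h1 _; rewrite ler_wpM2l//.
by rewrite -{1}(powRr1 t0) ler_powR// ltW.
Qed.

(** The remainder is at most linear because the gradient is bounded, and at most
    quadratic because it is Lipschitz; any power in between follows. *)
Lemma taylor_remainder_le (q : R) : 1 <= q <= 2 -> exists2 C, 0 <= C & forall x y,
  `|eta x - eta y + \sum_i 'D_(e_ i) eta x * (y 0 i - x 0 i)| <= C * enorm (x - y) `^ q.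
Proof.
move=> q12.
have [|B B0 BP] := uniform_constant (P := fun i B => forall x, `|'D_(e_ i) eta x| <= B) _
  (fun i => pderivs_bounded [:: i]).
  by move=> i b c bc h x; exact: le_trans (h x) bc.
have [|L L0 LP] := uniform_constant (P := fun i L => forall x y,
    `|'D_(e_ i) eta x - 'D_(e_ i) eta y| <= L * enorm (x - y)) _
  (fun i => pderivs_lipschitz [:: i]).
  by move=> i b c bc h x y; apply: le_trans (h x y) _; rewrite ler_wpM2r ?enorm_ge0.
pose A := 2 * B + L * n%:R; have A0 : 0 <= A by rewrite addr_ge0 ?mulr_ge0.
exists (n%:R * A) => [|x y]; first by rewrite mulr_ge0.
have e0 := enorm_ge0 (x - y).
have [xi xib E] := partial_MVT x y (@pderivs_derivable [::]).
have -> : eta x - eta y + \sum_i 'D_(e_ i) eta x * (y 0 i - x 0 i) =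
    \sum_i ('D_(e_ i) eta x - 'D_(e_ i) eta (xi i)) * (y 0 i - x 0 i).
  rewrite -opprB E addrC -sumrB; apply: eq_bigr => i _; ring.
have coord i : `|y 0 i - x 0 i| <= enorm (x - y).
  by rewrite distrC; have := coord_le_enorm (x - y) i; rewrite !mxE.
have bnd (b : R) : (forall i, `|'D_(e_ i) eta x - 'D_(e_ i) eta (xi i)| <= b) ->
    `|\sum_i ('D_(e_ i) eta x - 'D_(e_ i) eta (xi i)) * (y 0 i - x 0 i)| <= n%:R * (b * enorm (x - y)).
  move=> h; apply: le_trans (ler_norm_sum _ _ _) _.
  apply: (@le_trans _ _ (\sum_(i < n) b * enorm (x - y))); last first.
    by rewrite sumr_const card_ord -[leLHS]mulr_natl.
  by apply: ler_sum => i _; rewrite normrM; apply: ler_pM.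
apply: le_powR_between => //; first by rewrite mulr_ge0.
- apply: le_trans (bnd A _) _ => [i|]; last by rewrite mulrA.
  apply: le_trans (ler_normB _ _) _; have := BP i x; have := BP i (xi i) => /= h1 h2.
  have : 0 <= L * n%:R by rewrite mulr_ge0.
  by rewrite /A; lra.
- apply: le_trans (bnd (A * enorm (x - y)) _) _ => [i|]; last by rewrite expr2 !mulrA.
  apply: le_trans (LP i _ _) _.
  apply: (@le_trans _ _ (L * (n%:R * enorm (x - y)))).
    by rewrite ler_wpM2l//; exact: between_enorm.
  by rewrite mulrA ler_wpM2r// /A lerDr mulr_ge0.
Qed.

End test_functions.

(** * Estimates for the data *)

Lemma powR_ge1 (R : realType) (t r : R) : 1 <= t -> 0 <= r -> 1 <= t `^ r.
Proof.
move=> t1 r0; have := @ge0_ler_powR R r r0 1 t; by rewrite powR1; apply; rewrite ?nnegrE ?(le_trans ler01 t1).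
Qed.

Lemma exponent_exists (R : realType) (s gamma : R) : 0 < s < 1 ->
  Num.max 0 (2 * s - 1) < gamma < s + 1 ->
  exists q, [/\ 1 < q, 2 * s < q, gamma < q, q < 1 + s & q < 1 + gamma].
Proof.
move=> /andP[s0 s1]; rewrite gt_max => /andP[/andP[g0 g1] g2].
pose a := Num.max (Num.max 1 (2 * s)) gamma; pose b := Num.min (1 + s) (1 + gamma).
have ab : a < b.
  by rewrite /a /b !gt_max !lt_min; apply/andP; split; [apply/andP; split|]; apply/andP; split; lra.
have [a1 a2] := (midf_lt ab).
exists ((a + b) / 2%:R).
move: a1; rewrite {1}/a !gt_max => /andP[/andP[h1 h2] h3].
by move: a2; rewrite {2}/b lt_min => /andP[h4 h5].
Qed.

Section data_estimates.
Context {R : realType}.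
Variables (n : nat) (s q gamma M C : R) (v eta : 'rV[R]_n.+1 -> R).
Hypotheses (q1 : 1 < q) (q2 : q < 2) (gq : gamma < q) (qg : q < 1 + gamma) (g0 : 0 < gamma).
Hypothesis v_regular : is_Cgamma gamma setT v.
Hypothesis v_growth : forall x, `|v x| <= C * (1 + enorm x `^ gamma).
Hypothesis eta_smooth : forall k, is_Ck k setT eta.
Hypothesis eta_supp : forall x, ~ box M x -> eta x = 0.
Hypothesis M0 : 0 < M.

Local Notation e_ := (fun i : 'I_n.+1 => delta_mx 0 i : 'rV[R]_n.+1).
Local Notation grad i := (fun x => 'D_(e_ i) eta x).

Lemma Cgamma_continuous : continuous v.
Proof. by case: v_regular => m [beta [_ _ vk _]] x; have [] := vk [::] (leq0n m) x I. Qed.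

Lemma powR_le_diam (t D a b : R) : 0 <= t <= D -> 0 < a <= b -> t `^ b <= D `^ (b - a) * t `^ a.
Proof.
move=> /andP[t0 tD] /andP[a0 ab].
have [->|tn] := eqVneq t 0.
  by rewrite powR0 ?mulr_ge0 ?powR_ge0// gt_eqF//; lra.
rewrite (_ : t `^ b = t `^ (b - a) * t `^ a); last by rewrite -powRD ?tn ?implybT// subrK.
rewrite ler_wpM2r ?powR_ge0//; apply: ge0_ler_powR; rewrite ?nnegrE ?subr_ge0//.
exact: le_trans tD.
Qed.

Lemma box_diam (A : R) (x y : 'rV[R]_n.+1) : box A x -> box A y ->
  enorm (x - y) <= n.+1%:R * (2 * `|A|).
Proof.
move=> xA yA; apply: enorm_le_bound => [|i]; first by rewrite mulr_ge0.
rewrite !mxE; apply: le_trans (ler_normB _ _) _.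
by have := xA i; have := yA i; have := ler_norm A; lra.
Qed.

(** For [gamma <= 1] the exponent [q - 1 < gamma] is below the Hoelder exponent
    of [v]; for [gamma > 1] the function [v] is Lipschitz on the box and [q < 2]. *)
Lemma holder_on_box (A : R) : exists2 H, 0 <= H & forall x y, box A x -> box A y ->
  `|v x - v y| <= H * enorm (x - y) `^ (q - 1).
Proof.
move: q1 q2 gq qg g0 => Q1 Q2 Q3 Q4 Q5; have d0 : 0 < q - 1 by lra.
case: v_regular => m [beta [gE /andP[b0 b1] vk vh]].
pose D := n.+1%:R * (2 * `|A|).
have D0 : 0 <= D by rewrite !mulr_ge0.
case: m gE vk vh => [|m] gE vk vh.
  have [H HP] := vh [::] erefl _ (compact_box (M := A)) (fun _ _ => I).
  exists (`|H| * D `^ (beta - (q - 1))) => [|x y xA yA]; first by rewrite mulr_ge0 ?powR_ge0.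
  apply: le_trans (HP x y xA yA) _.
  apply: (@le_trans _ _ (`|H| * enorm (x - y) `^ beta)).
    by rewrite ler_wpM2r ?powR_ge0 ?ler_norm.
  rewrite -mulrA ler_wpM2l//; apply: powR_le_diam.
    by rewrite enorm_ge0 box_diam.
  by move: gE; rewrite add0r => gE; apply/andP; split; lra.
have dv z i : derivable v z (e_ i) by have [_ /(_ isT)] := vk [::] (leq0n _) z I.
have cdv i : {in box A, continuous ('D_(e_ i) v)}.
  by move=> x _; have [] := vk [:: i] (ltn0Sn m) x I.
have [|B B0 BP] := uniform_constant (P := fun i B => forall x, box A x -> `|'D_(e_ i) v x| <= B) _
  (fun i => bounded_on_box (cdv i)).
  by move=> i b c bc h x xA; exact: le_trans (h x xA) bc.
exists (n.+1%:R * B * D `^ (1 - (q - 1))) => [|x y xA yA]; first by rewrite !mulr_ge0 ?powR_ge0.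
apply: (@le_trans _ _ (n.+1%:R * B * enorm (x - y))).
  apply: (@partial_lipschitz R n.+1 v x y B dv) => z i xyz; exact: BP (between_box xyz xA yA).
rewrite -[leRHS]mulrA ler_wpM2l ?mulr_ge0// -{1}(powRr1 (enorm_ge0 (x - y))).
apply: powR_le_diam; first by rewrite enorm_ge0 box_diam.
by apply/andP; split; lra.
Qed.

(** If [x] stays in a box and [`|x - y| >= 1], then both points are of size
    [O(`|x - y|)], and [gamma < q]. *)
Lemma growth_away (A : R) : exists2 B, 0 <= B & forall x y, box A x -> 1 <= enorm (x - y) ->
  `|v x| <= B * enorm (x - y) `^ q /\ `|v y| <= B * enorm (x - y) `^ q.
Proof.
move: q1 q2 gq qg g0 => Q1 Q2 Q3 Q4 Q5.
have C0 : 0 <= C.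
  have e0 : enorm (0 : 'rV[R]_n.+1) = 0 by apply/eqP; rewrite enorm_eq0.
  by have := v_growth 0; rewrite e0 powR0 ?gt_eqF// addr0 mulr1; exact: le_trans.
pose B := n.+1%:R * (`|A| + 1); have B0 : 0 <= B by rewrite mulr_ge0// addr_ge0.
exists (C * (1 + B `^ gamma)) => [|x y xA t1]; first by rewrite mulr_ge0// addr_ge0 ?powR_ge0.
set t := enorm (x - y) in t1 *; have t0 : 0 <= t by exact: enorm_ge0.
have tq : t `^ gamma <= t `^ q by rewrite ler_powR// ltW.
have tq1 : 1 <= t `^ q.
  by apply: powR_ge1 => //; lra.
have bound (z : 'rV[R]_n.+1) : (forall i, `|z 0 i| <= (`|A| + 1) * t) -> `|v z| <= C * (1 + B `^ gamma) * t `^ q.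
  move=> zt; apply: le_trans (v_growth z) _; rewrite -mulrA ler_wpM2l// mulrDl mul1r.
  apply: lerD => //; apply: (@le_trans _ _ ((B * t) `^ gamma)).
    apply: ge0_ler_powR; rewrite ?nnegrE ?mulr_ge0 ?enorm_ge0 ?(ltW g0)//.
    by rewrite /B -mulrA; apply: enorm_le_bound => //; rewrite mulr_ge0// addr_ge0.
  by rewrite powRM// ler_wpM2l ?powR_ge0.
have xi i : `|x 0 i| <= `|A| * t.
  apply: le_trans (xA i) _; apply: le_trans (ler_norm A) _.
  by rewrite ler_peMr.
split; apply: bound => i; rewrite mulrDl mul1r.
  by apply: le_trans (xi i) _; rewrite lerDl.
rewrite -[y 0 i](subKr (x 0 i)); apply: le_trans (ler_normB _ _) _.
by apply: lerD => //; have := coord_le_enorm (x - y) i; rewrite !mxE.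
Qed.

Lemma near_box (A : R) (x y : 'rV[R]_n.+1) : box A x -> enorm (x - y) <= 1 -> box (A + 1) y.
Proof.
move=> xA xy i; rewrite -[y 0 i](subKr (x 0 i)); apply: le_trans (ler_normB _ _) _.
by apply: lerD => //; apply: le_trans xy; have := coord_le_enorm (x - y) i; rewrite !mxE.
Qed.

Lemma powR_pred_mul (t : R) : 0 <= t -> t `^ (q - 1) * t = t `^ q.
Proof.
move: q1 q2 gq qg g0 => Q1 Q2 Q3 Q4 Q5.
move=> t0; have [->|tn] := eqVneq t 0; first by rewrite mulr0 powR0// gt_eqF//; lra.
by rewrite -{2}(powRr1 t0) -powRD ?tn ?implybT// subrK.
Qed.

Lemma indic_sum_ge1 (A : R) (x y : 'rV[R]_n.+1) : box A x \/ box A y ->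
  1 <= \1_(box A) x + \1_(box A) y :> R.
Proof.
by case=> h; rewrite !indicE; [rewrite (mem_set h) lerDl|rewrite (mem_set h) lerDr].
Qed.

(** Near the diagonal, [v] is Hoelder of exponent [q - 1] and [eta] is Lipschitz;
    at distance at least 1, the growth of [v] is absorbed by [`|x - y|^q]. *)
Lemma energy_le : exists2 A, 0 <= A & forall x y,
  `|(v x - v y) * (eta x - eta y)| <= A * enorm (x - y) `^ q * (\1_(box M) x + \1_(box M) y).
Proof.
move: q1 q2 gq qg g0 => Q1 Q2 Q3 Q4 Q5.
have [H H0 HP] := holder_on_box (M + 1).
have [G G0 GP] := growth_away M.
have [L L0 LP] := pderivs_lipschitz eta_smooth eta_supp [::].
have [B B0 BP] := pderivs_bounded eta_smooth eta_supp [::].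
pose A := H * L + (2 * G) * (2 * B).
have A0 : 0 <= A by rewrite addr_ge0 ?mulr_ge0.
have aux x y : box M x -> `|(v x - v y) * (eta x - eta y)| <= A * enorm (x - y) `^ q.
  move=> xM; rewrite normrM; have t0 := enorm_ge0 (x - y).
  have tq0 : 0 <= enorm (x - y) `^ q by exact: powR_ge0.
  have [t1|t1] := leP (enorm (x - y)) 1.
    have xM1 : box (M + 1) x by move=> i; apply: le_trans (xM i) _; rewrite lerDl.
    apply: (@le_trans _ _ ((H * enorm (x - y) `^ (q - 1)) * (L * enorm (x - y)))).
      by apply: ler_pM => //; exact: HP xM1 (near_box xM t1).
    rewrite mulrACA powR_pred_mul// ler_wpM2r// /A lerDl !mulr_ge0//.
  have [Gx Gy] := GP x y xM (ltW t1).
  apply: (@le_trans _ _ ((2 * G * enorm (x - y) `^ q) * (2 * B))).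
    apply: ler_pM => //; apply: le_trans (ler_normB _ _) _; first by lra.
    by have := BP x; have := BP y => /= h1 h2; lra.
  by rewrite mulrAC ler_wpM2r// /A lerDr mulr_ge0.
exists A => // x y.
have [xy|xy] := pselect (box M x \/ box M y); last first.
  rewrite !eta_supp ?subrr ?mulr0 ?normr0; [|by move=> ?; apply: xy; tauto..].
  by rewrite !mulr_ge0 ?powR_ge0// addr_ge0.
apply: (@le_trans _ _ (A * enorm (x - y) `^ q)); last first.
  by rewrite ler_peMr ?mulr_ge0 ?powR_ge0//; exact: indic_sum_ge1.
case: xy => [|yM]; first exact: aux.
rewrite -(enormB y x) -mulrNN !opprB; exact: aux.
Qed.

(** For [x] off the enlarged box the remainder reduces to [- eta y], which vanishes
    unless [y] is in the support and hence at distance at least 1 from [x]. *)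
Lemma remainder_le : exists2 A, 0 <= A & forall x y,
  `|v x * (eta x - eta y + \sum_i 'D_(e_ i) eta x * (y 0 i - x 0 i))| <=
  A * enorm (x - y) `^ q * (\1_(box (M + 1)) x + \1_(box (M + 1)) y).
Proof.
move: q1 q2 gq qg g0 => Q1 Q2 Q3 Q4 Q5.
have q12 : 1 <= q <= 2 by apply/andP; split; lra.
have [T T0 TP] := taylor_remainder_le eta_smooth eta_supp q12.
have [G G0 GP] := growth_away M.
have [B B0 BP] := pderivs_bounded eta_smooth eta_supp [::].
have cv : {in @box R n.+1 (M + 1), continuous v} by move=> x _; exact: Cgamma_continuous.
have [V V0 VP] := bounded_on_box cv.
have sub (x : 'rV[R]_n.+1) : box M x -> box (M + 1) x by move=> h i; apply: le_trans (h i) _; rewrite lerDl.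
exists (V * T + G * B) => [|x y]; first by rewrite addr_ge0 ?mulr_ge0.
have tq0 : 0 <= enorm (x - y) `^ q by exact: powR_ge0.
have VT0 : 0 <= V * T by rewrite mulr_ge0.
have GB0 : 0 <= G * B by rewrite mulr_ge0.
have A0 : 0 <= (V * T + G * B) * enorm (x - y) `^ q by rewrite mulr_ge0// addr_ge0.
have [xM|xM] := pselect (box (M + 1) x).
  apply: (@le_trans _ _ ((V * T + G * B) * enorm (x - y) `^ q)); last first.
    by rewrite ler_peMr//; apply: indic_sum_ge1; left.
  rewrite normrM; apply: (@le_trans _ _ (V * (T * enorm (x - y) `^ q))).
    by apply: ler_pM => //; exact: VP.
  by rewrite mulrA ler_wpM2r// lerDl.
have xM' : ~ box M x by move/sub.
rewrite eta_supp// big1 => [|i _]; last by rewrite (derive_off_box _ eta_supp)// mul0r.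
rewrite sub0r addr0 mulrN normrN.
have [yM|yM] := pselect (box M y); last first.
  by rewrite (eta_supp yM) mulr0 normr0 mulr_ge0// addr_ge0.
apply: (@le_trans _ _ ((V * T + G * B) * enorm (x - y) `^ q)); last first.
  by rewrite ler_peMr//; apply: indic_sum_ge1; right; exact: sub.
have t1 : 1 <= enorm (y - x).
  rewrite leNgt; apply/negP => /ltW t1; exact: xM (near_box yM t1).
have [_ Gx] := GP y x yM t1; rewrite enormB in Gx.
rewrite normrM; apply: (@le_trans _ _ (G * enorm (x - y) `^ q * B)).
  by apply: ler_pM => //; exact: BP.
by rewrite mulrAC ler_wpM2r// lerDr.
Qed.

Lemma gradient_product_holder (i : 'I_n.+1) : exists A, forall x y,
  `|v x * 'D_(e_ i) eta x - v y * 'D_(e_ i) eta y| <= A * enorm (x - y) `^ (q - 1).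
Proof.
move: q1 q2 gq qg g0 => Q1 Q2 Q3 Q4 Q5.
have [H H0 HP] := holder_on_box (M + 1).
have [L L0 LP] := pderivs_lipschitz eta_smooth eta_supp [:: i].
have [B B0 BP] := pderivs_bounded eta_smooth eta_supp [:: i].
have cv : {in @box R n.+1 (M + 1), continuous v} by move=> x _; exact: Cgamma_continuous.
have [V V0 VP] := bounded_on_box cv.
pose A := V * L + B * H + 2 * (V * B).
have VL0 : 0 <= V * L by rewrite mulr_ge0.
have BH0 : 0 <= B * H by rewrite mulr_ge0.
have VB0 : 0 <= V * B by rewrite mulr_ge0.
have A0 : 0 <= A by rewrite /A; lra.
have g0' := derive_off_box i eta_supp.
have sub (x : 'rV[R]_n.+1) : box M x -> box (M + 1) x by move=> h j; apply: le_trans (h j) _; rewrite lerDl.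
have Fb (x : 'rV[R]_n.+1) : `|v x * 'D_(e_ i) eta x| <= V * B.
  have [xM|xM] := pselect (box M x); last by rewrite g0'// mulr0 normr0.
  by rewrite normrM; apply: ler_pM => //; [exact: VP (sub _ xM)|exact: BP].
have aux x y : box M x ->
    `|v x * 'D_(e_ i) eta x - v y * 'D_(e_ i) eta y| <= A * enorm (x - y) `^ (q - 1).
  move=> xM; have t0 := enorm_ge0 (x - y).
  set td := enorm (x - y) `^ (q - 1); have td0 : 0 <= td by exact: powR_ge0.
  have [t1|t1] := leP (enorm (x - y)) 1.
    have ttd : enorm (x - y) <= td.
      rewrite -{1}(powRr1 t0); have := @powR_le_diam (enorm (x - y)) 1 (q - 1) 1.
      by rewrite powR1 mul1r; apply; apply/andP; split => //; lra.
    rewrite (_ : _ - _ = v x * ('D_(e_ i) eta x - 'D_(e_ i) eta y) + 'D_(e_ i) eta y * (v x - v y)); last by ring.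
    apply: le_trans (ler_normD _ _) _; rewrite !normrM.
    have h1 : `|v x| * `|'D_(e_ i) eta x - 'D_(e_ i) eta y| <= V * (L * td).
      apply: ler_pM => //; first exact: VP (sub _ xM).
      by apply: le_trans (LP x y) _; rewrite ler_wpM2l.
    have h2 : `|'D_(e_ i) eta y| * `|v x - v y| <= B * (H * td).
      by apply: ler_pM => //; [exact: BP|exact: HP (sub _ xM) (near_box xM t1)].
    apply: le_trans (lerD h1 h2) _; rewrite !mulrA -mulrDl ler_wpM2r// /A; lra.
  have td1 : 1 <= td.
    by apply: powR_ge1; [exact: ltW|lra].
  apply: le_trans (ler_normB _ _) _; apply: (@le_trans _ _ A).
    by have := Fb x; have := Fb y; rewrite /A; lra.
  by rewrite ler_peMr.
exists A => x y; have [xM|xM] := pselect (box M x); first exact: aux.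
have [yM|yM] := pselect (box M y); first by rewrite distrC -(enormB y x); exact: aux.
by rewrite !g0'// !mulr0 subrr normr0 mulr_ge0 ?powR_ge0.
Qed.

End data_estimates.

(** * The energy identity for homogeneous kernels *)

Lemma Rintegral_prod d1 d2 (T1 : measurableType d1) (T2 : measurableType d2) (R : realType)
    (m1 : {sigma_finite_measure set T1 -> \bar R}) (m2 : {sigma_finite_measure set T2 -> \bar R})
    (f : T1 * T2 -> R) : (m1 \x m2)%E.-integrable setT (fun z => (f z)%:E) ->
  \int[m1]_x \int[m2]_y f (x, y) = fine (\int[(m1 \x m2)%E]_z (f z)%:E)%E.
Proof.
move=> fi; rewrite -(integral12_prod_meas1 fi) [LHS]/Rintegral; congr fine.
have mF := measurable_int _ (integrable_fubini_F fi).
apply: ae_eq_integral => //.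
- apply/measurable_EFinP.
  exact: (measurableT_comp (@fine_measurable R _ measurableT) mF).
- apply: (@filterS _ _ (ae_filter_ringOfSetsType m1) _ _ _ (ae_integrable1 fi)) => x xi _.
  by rewrite /Rintegral fineK//; exact: (integrable_fin_num measurableT xi).
Qed.

Lemma measurable_half (R : realType) (n : nat) : measurable [set x : 'rV[R]_n.+1 | 0 < xlast x].
Proof.
rewrite -[X in measurable X]setTI.
by apply: measurable_fun_ltr => //; exact: measurable_xlast.
Qed.

Section energy_identity.
Context {R : realType}.
Variables (n : nat) (s q gamma M C Lam : R) (K v eta : 'rV[R]_n.+1 -> R).
Hypotheses (s01 : 0 < s < 1) (q1 : 1 < q) (q2s : 2 * s < q) (qs1 : q < 1 + s).
Hypotheses (gq : gamma < q) (qg : q < 1 + gamma) (g0 : 0 < gamma) (M0 : 0 < M).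
Hypotheses (mK : measurable_fun setT K) (Lam0 : 0 <= Lam).
Hypothesis K_le : forall h, `|K h| <= Lam * enorm h `^ (- n.+1%:R - 2 * s).
Hypothesis K_hom : forall t h, t != 0 -> K (t *: h) = `|t| `^ (- n.+1%:R - 2 * s) * K h.
Hypothesis v_regular : is_Cgamma gamma setT v.
Hypothesis v_growth : forall x, `|v x| <= C * (1 + enorm x `^ gamma).
Hypothesis eta_smooth : forall k, is_Ck k setT eta.
Hypothesis eta_supp : forall x, ~ box M x -> eta x = 0.

Local Notation e_ := (fun i : 'I_n.+1 => delta_mx 0 i : 'rV[R]_n.+1).
Local Notation w := (@xweight R n (s - 1)).
Let k0 : R := - n.+1%:R - 2 * s.
Let T := 'rV[R]_n.+1.

Definition energy_density (z : 'rV[R]_n.+1 * 'rV[R]_n.+1) : R :=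
  (v z.1 - v z.2) * (eta z.1 - eta z.2) * w z.1 * w z.2 * K (z.1 - z.2).

Definition remainder (x y : 'rV[R]_n.+1) : R :=
  eta x - eta y + \sum_i 'D_(e_ i) eta x * (y 0 i - x 0 i).

Definition remainder_density (z : 'rV[R]_n.+1 * 'rV[R]_n.+1) : R :=
  v z.1 * w z.1 * (w z.2 * remainder z.1 z.2 * K (z.1 - z.2)).

(** The functions [F_i] whose boundary values appear in the flux. *)
Definition vgrad (i : 'I_n.+1) (x : 'rV[R]_n.+1) : R := v x * 'D_(e_ i) eta x.

Let q2 : q < 2. Proof. by move: qs1 s01 => ? /andP[? ?]; lra. Qed.

Let mv : measurable_fun setT v.
Proof. exact: continuousT_measurable_rV (Cgamma_continuous v_regular). Qed.

Let meta : measurable_fun setT eta.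
Proof. exact: continuousT_measurable_rV (@pderivs_continuous R n.+1 eta eta_smooth [::]). Qed.

Let mgrad i : measurable_fun setT (fun x => 'D_(e_ i) eta x).
Proof. exact: continuousT_measurable_rV (@pderivs_continuous R n.+1 eta eta_smooth [:: i]). Qed.

Let m1 := @measurable_fst _ _ T T.
Let m2 := @measurable_snd _ _ T T.
Let m3 := @measurable_rVB R n.+1.

Let mw1 : measurable_fun setT (fun z : T * T => w z.1).
Proof. exact: measurableT_comp (measurable_xweight _) m1. Qed.
Let mw2 : measurable_fun setT (fun z : T * T => w z.2).
Proof. exact: measurableT_comp (measurable_xweight _) m2. Qed.
Let mK12 : measurable_fun setT (fun z : T * T => K (z.1 - z.2)).
Proof. exact: measurableT_comp mK m3. Qed.

Lemma kernel_dominated (A : T -> T -> R) (c M' : R) (x y : T) : 0 <= c ->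
  `|A x y| <= c * enorm (x - y) `^ q * (\1_(box M') x + \1_(box M') y) ->
  `|A x y * (w x * w y * K (x - y))| <= c * Lam * majorantN s q M' (x, y).
Proof.
have W0 : 0 <= w x * w y by rewrite mulr_ge0 ?xweight_ge0.
move=> c0 Ale; rewrite /majorantN/= normrM [`|w x * _ * _|]normrM (ger0_norm W0).
have k1 : q + k0 != 0.
  by rewrite lt_eqF// /k0 -natr1; have := ler0n R n; move: qs1 s01 => ? /andP[? ?]; lra.
rewrite (_ : q - n.+1%:R - 2 * s = q + k0); last by rewrite /k0; ring.
rewrite -kernel_powR_mul ?enorm_ge0//; last by move: q1; lra.
rewrite [leRHS](_ : _ = c * enorm (x - y) `^ q * (\1_(box M') x + \1_(box M') y) *
    (w x * w y * (Lam * enorm (x - y) `^ k0))); last by ring.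
apply: ler_pM => //; first exact: mulr_ge0.
by rewrite ler_wpM2l.
Qed.

Lemma energy_integrable :
  (leb n.+1 \x leb n.+1)%E.-integrable setT (fun z => (energy_density z)%:E).
Proof.
have [A A0 AP] := energy_le q1 q2 gq qg g0 v_regular v_growth eta_smooth eta_supp.
apply: (le_integrableR measurableT _ _ (integrableRZ measurableT (A * Lam)
  (majorantN_integrable n M s01 q1 q2s qs1))).
- apply: measurable_funM mK12; apply: measurable_funM mw2; apply: measurable_funM mw1.
  apply: measurable_funM; apply: measurable_funB; by
    [exact: measurableT_comp mv m1|exact: measurableT_comp mv m2
    |exact: measurableT_comp meta m1|exact: measurableT_comp meta m2].
- move=> [x y] _; rewrite /energy_density/=.
  rewrite (_ : _ * K _ = (v x - v y) * (eta x - eta y) * (w x * w y * K (x - y))); last by ring.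
  exact: (kernel_dominated (A := fun x y => (v x - v y) * (eta x - eta y)) A0 (AP x y)).
Qed.

Lemma remainder_density_integrable :
  (leb n.+1 \x leb n.+1)%E.-integrable setT (fun z => (remainder_density z)%:E).
Proof.
have [A A0 AP] := remainder_le q1 q2 gq qg g0 v_regular v_growth eta_smooth eta_supp.
apply: (le_integrableR measurableT _ _ (integrableRZ measurableT (A * Lam)
  (majorantN_integrable n (M + 1) s01 q1 q2s qs1))).
- apply: measurable_funM.
    by apply: measurable_funM mw1; exact: measurableT_comp mv m1.
  apply: measurable_funM mK12; apply: measurable_funM; first exact: mw2.
  apply: measurable_funD.
    by apply: measurable_funB; [exact: measurableT_comp meta m1|exact: measurableT_comp meta m2].
  apply: measurable_sum => i; apply: measurable_funM.
    exact: measurableT_comp (mgrad i) m1.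
  by apply: measurable_funB; [exact: measurableT_comp (measurable_coord i) m2
    |exact: measurableT_comp (measurable_coord i) m1].
- move=> [x y] _; rewrite /remainder_density/=.
  rewrite (_ : v x * w x * _ = v x * remainder x y * (w x * w y * K (x - y))); last by ring.
  exact: (kernel_dominated (A := fun x y => v x * remainder x y) A0 (AP x y)).
Qed.

Let mvgrad i : measurable_fun setT (vgrad i).
Proof. exact: measurable_funM. Qed.

Let vgrad_supp i x : ~ box M x -> vgrad i x = 0.
Proof. by move=> xM; rewrite /vgrad (derive_off_box _ eta_supp)// mulr0. Qed.

Let vgrad_holder i := gradient_product_holder q1 q2 gq qg g0 v_regular eta_smooth eta_supp i.

(** [eta x - eta y] is expanded at [x] in the term with [v x] and at [y] in the
    term with [v y]. *)
Lemma energy_split (x y : T) : energy_density (x, y) =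
  remainder_density (x, y) + remainder_density (y, x) +
  \sum_i grad_form s K (vgrad i) i (x, y).
Proof.
have -> : \sum_i grad_form s K (vgrad i) i (x, y) = w x * w y * K (x - y) *
    (v x * - (\sum_i 'D_(e_ i) eta x * (y 0 i - x 0 i)) -
     v y * \sum_i 'D_(e_ i) eta y * (x 0 i - y 0 i)).
  rewrite -sumrN !mulr_sumr -sumrB mulr_sumr; apply: eq_bigr => i _.
  by rewrite /grad_form /vgrad/= !mxE; ring.
rewrite /energy_density /remainder_density /remainder/=.
have -> : K (y - x) = K (x - y) by rewrite -(even_kernel K_hom) opprB.
ring.
Qed.

Lemma gradient_terms : (leb n.+1 \x leb n.+1)%E.-integrable setT
    (fun z => (\sum_i grad_form s K (vgrad i) i z)%:E) /\
  fine (\int[(leb n.+1 \x leb n.+1)%E]_z (\sum_i grad_form s K (vgrad i) i z)%:E)%E =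
  - \sum_i theta s K 0 i * slice_mass (vgrad i) 0.
Proof.
have gi i : (leb n.+1 \x leb n.+1)%E.-integrable setT (fun z => (grad_form s K (vgrad i) i z)%:E).
  have [A AP] := vgrad_holder i.
  exact: grad_form_integrable i s01 q1 q2s qs1 mK K_le (mvgrad i) AP (@vgrad_supp i).
split; first exact: integrableR_sum.
have := @Rintegral_sum _ _ R (leb n.+1 \x leb n.+1)%E setT n.+1
  (fun i => grad_form s K (vgrad i) i) measurableT gi.
rewrite /Rintegral => ->; rewrite -sumrN; apply: eq_bigr => i _.
have [A AP] := vgrad_holder i.
by rewrite (grad_formE i s01 q1 q2s qs1 mK Lam0 K_le K_hom (mvgrad i) M0 AP (@vgrad_supp i)).
Qed.

Let P := (\int[(leb n.+1 \x leb n.+1)%E]_z (remainder_density z)%:E)%E.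

Lemma energy_integral : \int[leb n.+1]_x \int[leb n.+1]_y energy_density (x, y) =
  2 * fine P - \sum_i theta s K 0 i * slice_mass (vgrad i) 0.
Proof.
have ri := remainder_density_integrable.
have [gi gE] := gradient_terms.
have si := integrable_swap ri.
rewrite (Rintegral_prod energy_integrable).
have -> : (\int[(leb n.+1 \x leb n.+1)%E]_z (energy_density z)%:E =
    (P + P) + \int[(leb n.+1 \x leb n.+1)%E]_z (\sum_i grad_form s K (vgrad i) i z)%:E)%E.
  transitivity (\int[(leb n.+1 \x leb n.+1)%E]_z
    (((remainder_density z)%:E + (remainder_density (z.2, z.1))%:E) +
     (\sum_i grad_form s K (vgrad i) i z)%:E))%E.
    by apply: eq_integral => -[x y] _; rewrite energy_split !EFinD.
  rewrite (integralD measurableT (integrableD measurableT ri si) gi).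
  by rewrite (integralD measurableT ri si) (integral_prod_swap ri).
have Pf : P \is a fin_num := integrable_fin_num measurableT ri.
have Gf := integrable_fin_num measurableT gi.
rewrite -[in LHS](fineK Pf) -(fineK Gf) -!EFinD /= gE; ring.
Qed.

Let weta (x : T) : R := w x * eta x.
Let half : set T := [set x | 0 < xlast x].
Let bulk (x : T) : R := v x * w x * Lop K weta x.

Let Lop_half (x : T) : 0 < xlast x -> [/\ Lop_defined K weta x,
    (leb n.+1).-integrable setT (fun y => (w y * remainder x y * K (x - y))%:E) &
    Lop K weta x = 2 * \int[leb n.+1]_y (w y * remainder x y * K (x - y))].
Proof.
move=> x0; have q12 : 1 <= q <= 2 by move: q1 q2 => ? ?; apply/andP; split; lra.
have [A A0 AP] := taylor_remainder_le eta_smooth eta_supp q12.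
have [Ld LE] := Lop_remainder (g := fun i => 'D_(e_ i) eta x) s01 q1 q2s qs1 mK Lam0 K_le K_hom x0 meta (AP x).
split => //.
exact: (remainder_integrable (g := fun i => 'D_(e_ i) eta x) s01 q1 q2s qs1 mK K_le x0 meta (AP x)).
Qed.

Let bulk_section (x : T) : 0 < xlast x ->
  ((bulk x)%:E = 2%:E * fubini_F (leb n.+1) (fun z => (remainder_density z)%:E) x)%E.
Proof.
move=> x0; have [_ ri LE] := Lop_half x0; rewrite /bulk LE.
rewrite /fubini_F /remainder_density/=; under eq_integral do rewrite EFinM.
rewrite (integralZl measurableT ri) muleA -EFinM /Rintegral -[X in (_ * X)%E]fineK; last first.
  exact: (integrable_fin_num measurableT ri).
by rewrite -EFinM; congr EFin; rewrite /Rintegral; ring.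
Qed.

Let section_off_half (x : T) : ~ half x ->
  fubini_F (leb n.+1) (fun z => (remainder_density z)%:E) x = 0%E.
Proof.
move=> /negP; rewrite -leNgt => x0.
rewrite /fubini_F (_ : (fun y => _) = cst 0%E) ?integral0//.
by apply/funext => y /=; rewrite /remainder_density/= /xweight (pospow_le0 _ x0) mulr0 mul0r.
Qed.

Lemma bulk_integrable : (leb n.+1).-integrable half (fun x => (bulk x)%:E).
Proof.
have Fi := integrable_fubini_F remainder_density_integrable.
have := integrableS measurableT (@measurable_half R n) (@subsetT _ _) (integrableZl measurableT 2 Fi).
by apply: eq_integrable => [|x /[!inE] x0]; [exact: measurable_half|rewrite -bulk_section].
Qed.

(** [L] applied to the weighted test function is an inner integral of the
    remainder density, so this is Fubini. *)
Lemma bulk_integral : \int[leb n.+1]_(x in half) bulk x = 2 * fine P.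
Proof.
have ri := remainder_density_integrable.
have Fi := integrable_fubini_F ri.
have Pf := integrable_fin_num measurableT ri.
rewrite /Rintegral -[RHS]/(fine (2 * fine P)%:E); congr fine.
rewrite EFinM /P fineK// -(integral12_prod_meas1 ri) -(integralZl measurableT Fi).
rewrite integral_mkcond; apply: eq_integral => x _; rewrite patchE.
case: ifPn => [|]; first by rewrite inE => x0; rewrite bulk_section.
by rewrite notin_setE => xh; rewrite section_off_half// mule0.
Qed.

Let flux (x' : 'rV[R]_n) : R := dot (theta s K) (gradient eta (rsnoc x' 0)) * v (rsnoc x' 0).

Let fluxE x' : flux x' = \sum_i theta s K 0 i * vgrad i (rsnoc x' 0).
Proof.
rewrite /flux /dot mulr_suml; apply: eq_bigr => i _.
by rewrite /vgrad [gradient _ _ 0 i]mxE; ring.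
Qed.

Let slice_i i : (leb n).-integrable setT (fun x' => (vgrad i (rsnoc x' 0))%:E).
Proof.
by have [A AP] := vgrad_holder i; exact: F_slice_integrable (mvgrad i) AP (@vgrad_supp i) 0.
Qed.

Lemma flux_integrable : (leb n).-integrable setT (fun x' => (flux x')%:E).
Proof.
under eq_fun do rewrite fluxE.
by apply: integrableR_sum => // i; apply: integrableRZ.
Qed.

Lemma flux_integral : \int[leb n]_x' flux x' = \sum_i theta s K 0 i * slice_mass (vgrad i) 0.
Proof.
under eq_Rintegral do rewrite fluxE.
rewrite (Rintegral_sum measurableT) ; last by move=> i; apply: integrableRZ => //; exact: slice_i.
by apply: eq_bigr => i _; rewrite RintegralZl//; exact: slice_i.
Qed.

Lemma energy_identity :
  [/\ (leb n.+1 \x leb n.+1)%E.-integrable setT (fun z => (energy_density z)%:E),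
      (forall x, half x -> Lop_defined K weta x),
      (leb n.+1).-integrable half (fun x => (bulk x)%:E) &
      (leb n).-integrable setT (fun x' => (flux x')%:E)] /\
  \int[leb n.+1]_x \int[leb n.+1]_y energy_density (x, y) =
    \int[leb n.+1]_(x in half) bulk x - \int[leb n]_x' flux x'.
Proof.
split; last by rewrite energy_integral bulk_integral flux_integral.
split; [exact: energy_integrable| |exact: bulk_integrable|exact: flux_integrable].
by move=> x x0; have [] := Lop_half x0.
Qed.

End energy_identity.

(** * Kernels given on the sphere *)

Section homogeneous_kernels.
Context {R : realType}.
Variables (n : nat) (s lambda Lambda : R) (K : 'rV[R]_n.+1 -> R).
Hypotheses (s01 : 0 < s < 1) (lambda0 : 0 < lambda).
Hypothesis K_homogeneous : forall h, h != 0 ->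
  K h = enorm h `^ (- n.+1%:R - 2 * s) * K ((enorm h)^-1 *: h).
Hypothesis K_even : forall h, h != 0 ->
  K ((enorm h)^-1 *: h) = K (- ((enorm h)^-1 *: h)).
Hypothesis K_elliptic : forall h, h != 0 -> lambda <= K ((enorm h)^-1 *: h) <= Lambda.

(** With the value 0 at the origin, homogeneity and the pointwise bound hold there
    too. *)
Definition punctured (h : 'rV[R]_n.+1) : R := if h == 0 then 0 else K h.

Lemma puncturedE h : h != 0 -> punctured h = K h.
Proof. by rewrite /punctured => /negbTE ->. Qed.

Lemma punctured_hom (t : R) h : t != 0 ->
  punctured (t *: h) = `|t| `^ (- n.+1%:R - 2 * s) * punctured h.
Proof.
move=> t0; have [->|h0] := eqVneq h 0; first by rewrite /punctured scaler0 eqxx mulr0.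
have th0 : t *: h != 0 by rewrite scaler_eq0 negb_or t0.
rewrite !puncturedE// (K_homogeneous th0) (K_homogeneous h0) enormZ powRM ?enorm_ge0//.
rewrite -mulrA; congr (_ * (_ * _)).
have -> : (`|t| * enorm h)^-1 *: (t *: h) = Num.sg t *: ((enorm h)^-1 *: h).
  rewrite !scalerA invfM; congr (_ *: _).
  by rewrite mulrAC; congr (_ * _); rewrite {2}[t]numEsg mulrCA mulVf ?mulr1// normr_eq0.
case: sgrP t0 => //= _ _; first by rewrite scale1r.
by rewrite scaleN1r -K_even.
Qed.

Lemma punctured_le h : `|punctured h| <= Lambda * enorm h `^ (- n.+1%:R - 2 * s).
Proof.
have [->|h0] := eqVneq h 0.
  rewrite /punctured eqxx normr0 mulr_ge0 ?powR_ge0//.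
  have e0 : (const_mx 1 : 'rV[R]_n.+1) != 0.
    by apply/eqP => /rowP/(_ ord0); rewrite !mxE => /eqP; rewrite oner_eq0.
  by have /andP[] := K_elliptic e0; move: lambda0; lra.
rewrite puncturedE// (K_homogeneous h0) normrM (ger0_norm (powR_ge0 _ _)) mulrC.
rewrite ler_wpM2r ?powR_ge0//; have /andP[h1 h2] := K_elliptic h0.
by rewrite ger0_norm//; move: lambda0 h1; lra.
Qed.

Lemma chart_direction (h : 'rV[R]_n.+1) (i : 'I_n.+1) : h 0 i != 0 ->
  let y : 'rV[R]_n := \row_j ((enorm h)^-1 * h 0 (lift i j)) in
  enorm y < 1 /\ sphere_chart i (h 0 i < 0) y = (enorm h)^-1 *: h.
Proof.
move=> hi y; have h0 : h != 0 by apply: contra hi => /eqP ->; rewrite mxE.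
have e0 : 0 < enorm h by rewrite enorm_gt0.
have eN : enorm h != 0 by rewrite gt_eqF.
have e2 : enorm h ^+ 2 = h 0 i ^+ 2 + \sum_j h 0 (lift i j) ^+ 2.
  by rewrite /enorm sqr_sqrtr ?ge0_sumsq// (bigD1_ord i).
have y2 : 1 - enorm y ^+ 2 = ((enorm h)^-1 * h 0 i) ^+ 2.
  have -> : enorm y ^+ 2 = (enorm h) ^- 2 * \sum_j h 0 (lift i j) ^+ 2.
    rewrite {1}/enorm sqr_sqrtr ?ge0_sumsq// mulr_sumr; apply: eq_bigr => j _.
    by rewrite mxE exprMn exprVn.
  rewrite exprMn exprVn (_ : \sum_j _ = enorm h ^+ 2 - h 0 i ^+ 2); last by rewrite e2; ring.
  by field.
have p0 : 0 < ((enorm h)^-1 * h 0 i) ^+ 2.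
  by rewrite exprn_even_gt0//= mulf_neq0// invr_eq0.
split.
  have y0 := enorm_ge0 y.
  by rewrite ltNge; apply/negP => y1; have := mulr_ege1 y1 y1; rewrite -expr2; lra.
apply/rowP => j; rewrite !mxE; case: unliftP => [k ->|->]; first by rewrite mxE.
rewrite y2 sqrtr_sqr normrM normfV (gtr0_norm e0) mulrCA; congr (_ * _).
have [n0|p] := ltP (h 0 i) 0; first by rewrite ltr0_norm// expr1 mulN1r opprK.
by rewrite ger0_norm// expr0 mul1r.
Qed.

Variable delta : R.
Hypothesis K_regular : is_Cgamma_sphere delta K.

(** Some coordinate of [h0] is nonzero and keeps its sign nearby, so that a single
    chart of the sphere covers the directions of all nearby points. *)
Lemma kernel_continuous (h0 : 'rV[R]_n.+1) : h0 != 0 -> {for h0, continuous K}.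
Proof.
move=> h0N.
have [i hi] : exists i, h0 0 i != 0.
  apply/existsP; apply: contraNT h0N => /existsPn h; apply/eqP/rowP => i.
  by rewrite mxE; apply/eqP; have := h i; rewrite negbK.
pose b := h0 0 i < 0.
pose y (h : 'rV[R]_n.+1) : 'rV[R]_n := \row_j ((enorm h)^-1 * h 0 (lift i j)).
have [y1 chartE] := chart_direction hi.
have [m [beta [_ _ Kk _]]] := K_regular i b.
have [cf _] := Kk [::] (leq0n m) (y h0) y1.
have e0 : 0 < enorm h0 by rewrite enorm_gt0.
have ce : enorm h @[h --> h0] --> enorm h0 by exact: enorm_continuous.
have cc j : h 0 j @[h --> h0] --> h0 0 j by exact: coord_continuous.
have cy : y h @[h --> h0] --> y h0.
  apply/(@cvg_ballP R 'rV[R]_n _ _ (nbhs_filter h0)) => e ep.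
  have yj j : \forall h \near h0, `|y h0 0 j - y h 0 j| < e.
    have : y h 0 j @[h --> h0] --> y h0 0 j.
      under eq_fun do rewrite mxE; rewrite mxE.
      have cV : (enorm h)^-1 @[h --> h0] --> (enorm h0)^-1.
        by apply: (cvgV (lt0r_neq0 e0) ce).
      by apply: (cvgM cV (cc (lift i j))).
    by move=> /cvgrPdist_lt/(_ e ep).
  have := @filter_forall _ _ (fun j h => `|y h0 0 j - y h 0 j| < e) _ (nbhs_filter h0) yj.
  by apply: (@filterS _ (nbhs h0) (nbhs_filter h0)) => h hy; apply/rV_ballP.
have near_sign : nbhs h0 (fun h : 'rV[R]_n.+1 => (h 0 i != 0) && ((h 0 i < 0) == b)).
  have hi0 : 0 < `|h0 0 i| by rewrite normr_gt0.
  have /cvgrPdist_lt/(_ _ hi0) := cc i.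
  apply: (@filterS _ (nbhs h0) (nbhs_filter h0)) => h; rewrite /b ltr_norml.
  have [hn|hp|h00] := ltgtP (h0 0 i) 0; last by rewrite h00 eqxx in hi.
    by rewrite (ltr0_norm hn) => /andP[h1 _]; rewrite (_ : h 0 i < 0) ?ltr0_neq0//; lra.
  rewrite (gtr0_norm hp) => /andP[_ h1]; have h2 : 0 < h 0 i by lra.
  by rewrite (lt0r_neq0 h2) ltNge (ltW h2).
have cK : enorm h `^ (- n.+1%:R - 2 * s) * K (sphere_chart i b (y h)) @[h --> h0] -->
    enorm h0 `^ (- n.+1%:R - 2 * s) * K (sphere_chart i b (y h0)).
  have cp := cvg_comp _ _ ce (powR_continuous_gt0 (p := - n.+1%:R - 2 * s) e0).
  have cs := cvg_comp _ _ cy cf.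
  by apply: (cvgM cp cs).
have K0E : K h0 = enorm h0 `^ (- n.+1%:R - 2 * s) * K (sphere_chart i b (y h0)).
  by rewrite (K_homogeneous h0N) chartE.
rewrite /prop_for /continuous_at K0E.
apply: cvg_trans cK; apply: (@near_eq_cvg _ _ _ (nbhs_filter h0)).
apply: (@filterS _ (nbhs h0) (nbhs_filter h0) _ _ _ near_sign) => h /andP[hN /eqP hb].
have [_ hE] := chart_direction hN.
have hN0 : h != 0 by apply: contra hN => /eqP ->; rewrite mxE.
by rewrite (K_homogeneous hN0) -hE hb.
Qed.

Lemma measurable_punctured : measurable_fun setT punctured.
Proof.
have mK : measurable_fun setT K by apply: continuous0_measurable_rV; exact: kernel_continuous.
rewrite (_ : punctured = (fun h => \1_(~` [set (0 : 'rV[R]_n.+1)]) h * K h)).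
  apply: measurable_funM => //; apply: measurable_indic; apply: measurableC.
  exact: measurable_rV_set1.
apply/funext => h; rewrite /punctured; have [->|h0] := eqVneq h 0.
  by rewrite indicE memNset ?mul0r//=; apply/not_notE.
by rewrite indicE mem_set ?mul1r//=; apply/eqP.
Qed.

Lemma Lop_punctured (u : 'rV[R]_n.+1 -> R) (x : 'rV[R]_n.+1) :
  Lop K u x = Lop punctured u x /\ (Lop_defined punctured u x -> Lop_defined K u x).
Proof.
have E : (fun y => (u x - u y) * K (x - y)) = (fun y => (u x - u y) * punctured (x - y)).
  apply/funext => y; have [->|xy] := eqVneq x y; first by rewrite !subrr !mul0r.
  by rewrite puncturedE// subr_eq0.
have LE : L_trunc K u x = L_trunc punctured u x.
  by apply/funext => eps; rewrite /L_trunc E.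
split; first by rewrite /Lop LE.
case=> pi pc; split; last by rewrite LE.
move=> eps e0; have := pi eps e0; apply: eq_integrable; first exact: measurable_outsideB.
by move=> y _; rewrite (congr1 (@^~ y) E).
Qed.

Lemma theta_punctured : theta s punctured = theta s K.
Proof.
apply/rowP => i; rewrite !mxE; congr (_ * _); apply: eq_Rintegral => z _.
rewrite puncturedE//; apply/eqP => /rsnoc_eq0/eqP; by rewrite oner_eq0.
Qed.

End homogeneous_kernels.

Lemma compact_sub_box (R : realType) (n : nat) (A : set 'rV[R]_n) : compact A ->
  exists2 M : R, 0 < M & A `<=` box M.
Proof.
move=> cA; have ce : {within A, continuous (@enorm R n)}.
  exact: continuous_subspaceT (@enorm_continuous R n).
have /compact_bounded[B [_ BP]] := continuous_compact ce cA.
exists (`|B| + 1) => [|x Ax i]; first by rewrite ltr_wpDl.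
apply: le_trans (coord_le_enorm x i) _.
have := BP (`|B| + 1) (ltac:(by have := ler_norm B; lra)) (enorm x) (ltac:(by exists x)).
by apply: le_trans; exact: ler_norm.
Qed.

Theorem lemma3p1 (R : realType) (n : nat) (s lambda Lambda : R)
  (K : 'rV[R]_n.+1 -> R)
  (s01 : 0 < s < 1)
  (lambda_Lambda : 0 < lambda <= Lambda)
  (K_homogeneous : forall h, h != 0 ->
     K h = enorm h `^ (- n.+1%:R - 2 * s) * K ((enorm h)^-1 *: h))
  (K_even : forall h, h != 0 ->
     K ((enorm h)^-1 *: h) = K (- ((enorm h)^-1 *: h)))
  (K_elliptic : forall h, h != 0 -> lambda <= K ((enorm h)^-1 *: h) <= Lambda)
  (alpha : R) (alpha_s : 0 < alpha < s)
  (K_regular : is_Cgamma_sphere (5 + 2 * alpha) K)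
  (v : 'rV[R]_n.+1 -> R) (gamma : R)
  (gamma_range : Num.max 0 (2 * s - 1) < gamma < s + 1)
  (v_regular : is_Cgamma gamma setT v)
  (C : R) (v_growth : forall x, `|v x| <= C * (1 + enorm x `^ gamma))
  (eta : 'rV[R]_n.+1 -> R) (eta_test : is_Cc_smooth eta) :
  let w := fun x : 'rV[R]_n.+1 => pospow (xlast x) (s - 1) in
  let weta := fun x => w x * eta x in
  let half := [set x : 'rV[R]_n.+1 | 0 < xlast x] in
  let energy := fun x y =>
    (v x - v y) * (eta x - eta y) * w x * w y * K (x - y) in
  let bulk := fun x => v x * w x * Lop K weta x in
  let flux := fun x' : 'rV[R]_n =>
    dot (theta s K) (gradient eta (rsnoc x' 0)) * v (rsnoc x' 0) in
  (* all terms of the identity are well defined *)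
  [/\ (leb n.+1 \x leb n.+1)%E.-integrable setT
        (fun p => (energy p.1 p.2)%:E),
      (forall x, half x -> Lop_defined K weta x),
      (leb n.+1).-integrable half (fun x => (bulk x)%:E) &
      (leb n).-integrable setT (fun x' => (flux x')%:E)] /\
  \int[leb n.+1]_x \int[leb n.+1]_y energy x y =
    \int[leb n.+1]_(x in half) bulk x - \int[leb n]_x' flux x'.
Proof.
move=> w weta half energy bulk flux.
have [q [q1 q2s gq qs1 qg]] := exponent_exists s01 gamma_range.
have g0 : 0 < gamma by move: gamma_range; rewrite gt_max => /andP[/andP[]].
have /andP[l0 lL] := lambda_Lambda; have L0 : 0 <= Lambda by lra.
have [eta_smooth eta_compact] := eta_test.
have [M M0 MP] := compact_sub_box eta_compact.
have eta_supp x : ~ box M x -> eta x = 0.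
  move=> xM; apply/eqP; apply: contra_notT xM => xN.
  by apply: MP; exact: subset_closure.
have mK := measurable_punctured K_homogeneous K_regular.
have Kle := punctured_le l0 K_homogeneous K_elliptic.
have Khom := punctured_hom K_homogeneous K_even.
have := energy_identity s01 q1 q2s qs1 gq qg g0 M0 mK L0 Kle Khom v_regular v_growth eta_smooth eta_supp.
have energyE x y : energy_density s (punctured K) v eta (x, y) = energy x y.
  rewrite /energy_density /energy/=; have [->|xy] := eqVneq x y.
    by rewrite !subrr !mul0r.
  by rewrite puncturedE// subr_eq0.
have LE x : Lop (punctured K) weta x = Lop K weta x by have [] := Lop_punctured K weta x.
rewrite theta_punctured => -[[h1 h2 h3 h4] h5]; split; first split.
- by apply: eq_integrable h1 => // -[x y] _; rewrite energyE.
- by move=> x x0; apply: (Lop_punctured K weta x).2; exact: h2.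
- by apply: eq_integrable h3 => [|x _]; [exact: measurable_half|rewrite LE].
- exact: h4.
transitivity (\int[leb n.+1]_x \int[leb n.+1]_y energy_density s (punctured K) v eta (x, y)).
  by apply: eq_Rintegral => x _; apply: eq_Rintegral => y _; rewrite energyE.
rewrite h5; apply: (congr1 (fun r => r - \int[leb n]_x' flux x')).
by apply: eq_Rintegral => x _; rewrite LE.
Qed.
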